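(* Let $\{\alpha(n)\}_{n\in\mathbb Z}$ be a sequence in $\mathbb D$, let $\mathcal E$ be the associated extended CMV matrix on $\ell^2(\mathbb Z)$, and write $G_{kl}(w)=\langle\delta_k,(\mathcal E-w)^{-1}\delta_l\rangle$. Let $\Lambda=\mu_{\delta_0}+\mu_{\delta_1}$ be the sum of the spectral measures of $\mathcal E$ for $\delta_0$ and $\delta_1$. (1) Let $\Sigma\subset\partial\mathbb D$, and suppose that there are constants $C_1,C_2,\gamma_1,\gamma_2>0$ and $L_0>0$ such that for every $z\in\Sigma$, every normalized solution $\eta(z)$ of the transfer matrix recursion at $z$ satisfies $$C_1L^{\gamma_1}\le\|\eta(z)\|_L\le C_2L^{\gamma_2}\quad\text{for all }L\ge L_0 .$$ Put $\beta=\frac{2\gamma_1}{\gamma_1+\gamma_2}$. Then there is a constant $C_4$, independent of $z$ and $r$, such that $$|G_{00}(rz)+G_{11}(rz)|\le C_4(1-r)^{\beta-1}\quad\text{for all }z\in\Sigma\text{ and all } r\in(0.9,1).$$ Consequently, $\Lambda$ is $\beta$-Hölder continuous at every $z\in\Sigma$. (2) In particular, let $S\subset\partial\mathbb D$ be a Borel set such that there are constants $\gamma_1,\gamma_2>0$ and, for each $z\in S$, constants $C_1(z),C_2(z)>0$ such that every normalized solution $\eta$ of the transfer matrix recursion at $z$ satisfies $$C_1(z)L^{\gamma_1}\le\|\eta\|_L\le C_2(z)L^{\gamma_2}$$ for all sufficiently large $L$ (how large may depend on $z$). Then the restriction to $S$ of every spectral measure of $\mathcal E$ is purely $\frac{2\gamma_1}{\gamma_1+\gamma_2}$-continuous,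 that is, it gives zero weight to sets of zero $h^{\frac{2\gamma_1}{\gamma_1+\gamma_2}}$ measure.
   Context: $\mathbb D$ is the open unit disk in $\mathbb C$ and $\rho(n)=\sqrt{1-|\alpha(n)|^2}$. Extended CMV matrix: $\mathcal E$ is the unitary operator on $\ell^2(\mathbb Z)$ whose matrix entries $\mathcal E_{j,k}$ (row $j$, column $k$) are, for every $m\in\mathbb Z$: in row $2m$, $\mathcal E_{2m,2m-1}=\overline{\alpha(2m)}\rho(2m-1)$, $\mathcal E_{2m,2m}=-\overline{\alpha(2m)}\alpha(2m-1)$, $\mathcal E_{2m,2m+1}=\overline{\alpha(2m+1)}\rho(2m)$, $\mathcal E_{2m,2m+2}=\rho(2m+1)\rho(2m)$; in row $2m+1$, $\mathcal E_{2m+1,2m-1}=\rho(2m)\rho(2m-1)$, $\mathcal E_{2m+1,2m}=-\rho(2m)\alpha(2m-1)$, $\mathcal E_{2m+1,2m+1}=-\overline{\alpha(2m+1)}\alpha(2m)$, $\mathcal E_{2m+1,2m+2}=-\rho(2m+1)\alpha(2m)$; all other entries are $0$. $\{\delta_k\}_{k\in\mathbb Z}$ is the standard basis of $\ell^2(\mathbb Z)$. Transfer matrix recursion at $z\in\partial\mathbb D$ (it uses only $\alpha(n)$ with $n\ge0$): a sequence $\eta=(\eta_j)_{j\ge0}$ of complex numbers is a solution if for all $n\ge0$ $$\begin{pmatrix}\eta_{2n+3}\\ \eta_{2n+2}\end{pmatrix}=\frac1{\rho(n)}\begin{pmatrix}z&-\overline{\alpha(n)}\\-\alpha(n)z&1\end{pmatrix}\begin{pmatrix}\eta_{2n+1}\\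 \eta_{2n}\end{pmatrix}.$$ It is normalized if $|\eta_0|^2+|\eta_1|^2=2$. For an integer $n\ge 0$, $\|\eta\|_n=\big(\sum_{j=0}^n|\eta_j|^2\big)^{1/2}$; for non-integer $L>0$, $\|\eta\|_L$ is defined by linear interpolation between consecutive integers. The spectral measure $\mu_\varphi$ of $\mathcal E$ for $\varphi\in\ell^2(\mathbb Z)$ is the Borel measure on $\partial\mathbb D$ with $\langle\varphi,(\mathcal E-w)^{-1}\varphi\rangle=\int\frac{d\mu_\varphi(\zeta)}{\zeta-w}$ for $w\in\mathbb C\setminus\partial\mathbb D$. A measure $\mu$ on $\partial\mathbb D$ is $\beta$-Hölder continuous at $z=e^{i\Theta}$ if there is $C$ with $\mu(\{e^{i\theta}:|\theta-\Theta|\le\epsilon\})\le C\epsilon^\beta$ for all sufficiently small $\epsilon>0$. $h^\beta$ denotes $\beta$-dimensional Hausdorff measure. *)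

(* Defs.v *)
From HB Require Import structures.
From mathcomp Require Import all_boot all_order all_algebra.
From mathcomp Require Import all_classical all_reals all_analysis.
From mathcomp Require Import complex.

Set Implicit Arguments.
Unset Strict Implicit.
Unset Printing Implicit Defensive.
Import Order.TTheory GRing.Theory Num.Theory.
Import numFieldTopology.Exports numFieldNormedType.Exports.

Local Open Scope classical_set_scope.
Local Open Scope ring_scope.
Local Open Scope complex_scope.

(* Throughout, R is the real line and R[i] the complex plane. The modulus is
   normc, with values in R, rather than `|_|, whose values lie in R[i]. *)
Notation normc := ComplexField.Normc.normc.

Section unit_circle.
Variable R : realType.

Definition unit_circle : set (R[i]^o) := [set z | normc z = 1].

Definition circle : Type := set_type unit_circle.

Lemma one_in_unit_circle : (1 : R[i]^o) \in unit_circle.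
Proof. by apply/mem_set; exact: ComplexField.Normc.normc1. Qed.

Definition circle1 : circle := SigSub one_in_unit_circle.

HB.instance Definition _ := Topological.on circle.
HB.instance Definition _ := isPointed.Build circle circle1.

(* The Borel sigma-algebra of the circle. *)
HB.instance Definition _ :=
  Measurable.copy circle (g_sigma_algebraType (@open circle)).

Definition cval (z : circle) : R[i] := \val z.

Definition cis (t : R) : R[i] := cos t +i* sin t.

(* [closed_arc z eps] is {e^(it) : |t - T| <= eps} where z = e^(iT); the set does not
   depend on which argument T of z is used. *)
Definition closed_arc (z : circle) (eps : R) : set circle :=
  [set x | exists T t, [/\ cval z = cis T, cval x = cis t & `|t - T| <= eps]].

Definition holder_continuous_at (beta : R) (mu : set circle -> \bar R)
    (z : circle) : Prop :=
  exists C : R, \forall eps \near 0^'+,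
    (mu (closed_arc z eps) <= (C * eps `^ beta)%:E)%E.

Definition cintegral (mu : {measure set circle -> \bar R}) (f : circle -> R[i]) : R[i] :=
  (\int[mu]_x complex.Re (f x)) +i* (\int[mu]_x complex.Im (f x)).

Definition chord_dist (x y : circle) : R := normc (cval x - cval y).

End unit_circle.

Section hausdorff.
Variables (R : realType) (T : Type) (dist : T -> T -> R).
Local Open Scope ereal_scope.

Definition diameter (U : set T) : \bar R :=
  ereal_sup [set d | exists x y, [/\ U x, U y & d = (dist x y)%:E]].

(* Empty members of a cover contribute 0 (their diameter is -oo here). *)
Definition hausdorff_premeasure (s delta : R) (A : set T) : \bar R :=
  ereal_inf [set m | exists U : nat -> set T,
    [/\ A `<=` \bigcup_i U i,
        forall i, diameter (U i) <= delta%:E &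
        m = \esum_(i in [set i | U i !=set0]) (diameter (U i) `^ s)]].

Definition hausdorff_measure (s : R) (A : set T) : \bar R :=
  ereal_sup [set hausdorff_premeasure s delta A | delta in [set d | (0 < d)%R]].

End hausdorff.

(* mu gives zero weight to the Borel sets of zero h^beta measure, the metric
   on the circle being the one inherited from the plane. *)
Definition purely_continuous (R : realType) (beta : R)
    (mu : set (circle R) -> \bar R) : Prop :=
  forall A : set (circle R), measurable A ->
    hausdorff_measure (@chord_dist R) beta A = 0%E -> mu A = 0%E.

Section extended_CMV.
Variable R : realType.
Implicit Types (alpha u v phi : int -> R[i]) (w z : R[i]).

Definition rho alpha (n : int) : R := Num.sqrt (1 - normc (alpha n) ^+ 2).

Definition cmv_entry alpha (j k : int) : R[i] :=
  let a n := alpha n in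
  let r n := (rho alpha n)%:C in
  let m := (j %/ 2)%Z in
  if j == 2 * m then
    if k == 2 * m - 1 then (a (2 * m))^* * r (2 * m - 1)
    else if k == 2 * m then - (a (2 * m))^* * a (2 * m - 1)
    else if k == 2 * m + 1 then (a (2 * m + 1))^* * r (2 * m)
    else if k == 2 * m + 2 then r (2 * m + 1) * r (2 * m)
    else 0
  else (* j = 2 * m + 1 *)
    if k == 2 * m - 1 then r (2 * m) * r (2 * m - 1)
    else if k == 2 * m then - r (2 * m) * a (2 * m - 1)
    else if k == 2 * m + 1 then - (a (2 * m + 1))^* * a (2 * m)
    else if k == 2 * m + 2 then - r (2 * m + 1) * a (2 * m)
    else 0.

Definition cmv alpha u : int -> R[i] :=
  fun j => \sum_(k \in [set: int]) cmv_entry alpha j k * u k.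

Definition l2 u : Prop :=
  summable [set: int] (fun j => (normc (u j) ^+ 2)%:E).

(* Sums over the integers of absolutely summable families. *)
Definition rsum (f : int -> R) : R :=
  fine (\esum_(j in [set: int]) (EFin \o f)^\+ j
        - \esum_(j in [set: int]) (EFin \o f)^\- j)%E.

Definition csum (f : int -> R[i]) : R[i] :=
  rsum (fun j => complex.Re (f j)) +i* rsum (fun j => complex.Im (f j)).

(* Linear in the second argument. *)
Definition l2_inner u v : R[i] := csum (fun j => (u j)^* * v j).

Definition delta (k : int) : int -> R[i] := fun j => (j == k)%:R.

(* (E - w)^-1 phi : the l2 solution psi of (E - w) psi = phi. As E is unitary,
   it exists and is unique when phi is in l2 and |w| <> 1; otherwise the value
   is arbitrary. *)
Definition resolvent alpha w phi : int -> R[i] :=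
  xget (fun=> 0)
    [set psi | l2 psi /\ forall j, cmv alpha psi j - w * psi j = phi j].

Definition green alpha (k l : int) w : R[i] :=
  l2_inner (delta k) (resolvent alpha w (delta l)).

Definition is_spectral_measure alpha phi
    (mu : {finite_measure set (circle R) -> \bar R}) : Prop :=
  forall w, normc w <> 1 ->
    l2_inner phi (resolvent alpha w phi) =
    cintegral mu (fun zeta => (cval zeta - w)^-1).

Definition transfer_mx alpha z (n : nat) : 'M[R[i]]_(1 + 1) :=
  ((rho alpha n%:Z)%:C)^-1 *:
  block_mx z%:M                  (- (alpha n%:Z)^*)%:M
           (- alpha n%:Z * z)%:M 1%:M.

Definition transfer_solution alpha z (eta : nat -> R[i]) : Prop :=
  forall n : nat,
    col_mx (eta (2 * n + 3)%N)%:M (eta (2 * n + 2)%N)%:M =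
    transfer_mx alpha z n *m
      col_mx (eta (2 * n + 1)%N)%:M (eta (2 * n)%N)%:M :> 'cV[R[i]]_(1 + 1).

Definition normalized (eta : nat -> R[i]) : Prop :=
  normc (eta 0%N) ^+ 2 + normc (eta 1%N) ^+ 2 = 2.

Definition norm_upto (eta : nat -> R[i]) (n : nat) : R :=
  Num.sqrt (\sum_(j < n.+1) normc (eta j) ^+ 2).

(* Linear interpolation of norm_upto between consecutive integers. *)
Definition norm_at (eta : nat -> R[i]) (L : R) : R :=
  let n := Num.truncn L in
  norm_upto eta n + (L - n%:R) * (norm_upto eta n.+1 - norm_upto eta n).

Definition power_law_bounds alpha z (C1 C2 g1 g2 L0 : R) : Prop :=
  forall eta, transfer_solution alpha z eta -> normalized eta ->
  forall L, L0 <= L ->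
    C1 * L `^ g1 <= norm_at eta L /\ norm_at eta L <= C2 * L `^ g2.

End extended_CMV.

(* Main.v *)
(* With w = r z and d = 1 - r, a decaying solution (P, Q) of the Szego recursion at w
   satisfies |P_0|^2 - |Q_0|^2 >= (1 - r^2) sum_n |P_n|^2. Variation of constants compares
   (P, Q) with the normalized solutions at z up to length L, about d^(-1 / (g1 + g2)), and
   the power laws give |P_0|^2 - |Q_0|^2 >= c d^(1 - beta) |P_0|^2. On the left half line
   the energy inequality is reversed, and gluing the two halves at the origin bounds G_00
   and G_11 by C d^(beta - 1). The Poisson kernel turns that into the Hoelder bound.

   For part (2), if balls B(z_i, e_i) cover a set, the product W of the polynomials
   approximating (1 - conj z_i E) (1 - conj w_i E)^-1, with w_i = (1 - e_i) z_i, is a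
   contraction as an operator and has |W|^2 <= 7/8 on each ball. Hence |phi|^2 - |W(E)
   phi|^2 = int (1 - |W|^2) dmu is at least mu of the cover divided by 8. On delta_0 and
   delta_1 this quantity is at most a constant times sum_i e_i^beta by the Green function
   bounds; cyclicity of delta_0 and delta_1 carries the estimate to a general phi. *)
Require Import Defs.
From HB Require Import structures.
From mathcomp Require Import all_boot all_order all_algebra.
From mathcomp Require Import all_classical all_reals all_analysis.
From mathcomp Require Import complex measurable_realfun ring lra zify.
Import Order.TTheory GRing.Theory Num.Theory.
Import numFieldTopology.Exports numFieldNormedType.Exports.
Set Implicit Arguments.
Unset Strict Implicit.
Unset Printing Implicit Defensive.
Local Open Scope classical_set_scope.
Local Open Scope ring_scope.
Local Open Scope complex_scope.

(** The spectral measures enter only through their Cauchy transforms off the circle. Their moments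
    are recovered by letting [w] tend to infinity, and in part (2) the measure is then reached
    through polynomials in [E]; this is why resolvents are replaced there by truncated geometric
    series.

    For [delta 0] and [delta 1] alone, part (2) would follow from the Hoelder bound by covering. A
    general [phi] would call for absolute continuity of its measure with respect to [Lambda]. The
    defect |phi|^2 - |W(E) phi|^2 of a contraction replaces this: it is a nonnegative quadratic
    form, hence subadditive up to a factor 2, and it is at most |phi|^2, so the tail of [phi] costs
    little. Multiplying the damping factors, rather than adding them, keeps [W(E)] a contraction
    however much the balls overlap.

    In part (2) the constants depend on [z], so the set is cut into countably many pieces with
    uniform constants. Measurability of these pieces is not established; each is shown to be
    negligible. The inequality beta <= 1, which absorbs the lower order terms, is forced by the two
    power laws together. *)

HB.lock Definition sq (R : realType) (x : R[i]) : R :=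
  complex.Re x ^+ 2 + complex.Im x ^+ 2.

(** * Squared moduli in real coordinates *)

Section complex_modulus.
Variable R : realType.
Implicit Types (x y z : R[i]) (k : R).
Local Notation Re := complex.Re.
Local Notation Im := complex.Im.

Lemma sqE x : sq x = Re x ^+ 2 + Im x ^+ 2.
Proof. by rewrite unlock. Qed.

Lemma Re_add x y : Re (x + y) = Re x + Re y. Proof. by case: x; case: y. Qed.
Lemma Im_add x y : Im (x + y) = Im x + Im y. Proof. by case: x; case: y. Qed.
Lemma Re_opp x : Re (- x) = - Re x. Proof. by case: x. Qed.
Lemma Im_opp x : Im (- x) = - Im x. Proof. by case: x. Qed.
Lemma Re_mul x y : Re (x * y) = Re x * Re y - Im x * Im y.
Proof. by case: x; case: y. Qed.
Lemma Im_mul x y : Im (x * y) = Re x * Im y + Im x * Re y.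
Proof. by case: x; case: y. Qed.
Lemma Re_conjc x : Re x^* = Re x. Proof. by case: x. Qed.
Lemma Im_conjc x : Im x^* = - Im x. Proof. by case: x. Qed.
Lemma Re_real k : Re k%:C = k. Proof. by []. Qed.
Lemma Im_real k : Im k%:C = 0. Proof. by []. Qed.

Definition ReImE := (Re_add, Im_add, Re_opp, Im_opp, Re_mul, Im_mul,
  Re_conjc, Im_conjc, Re_real, Im_real).

Lemma sq_normc x : normc x ^+ 2 = sq x.
Proof. by case: x => a b; rewrite sqE sqr_sqrtr// addr_ge0 ?sqr_ge0. Qed.

Lemma normc_ge0 x : 0 <= normc x.
Proof. by case: x => a b; exact: sqrtr_ge0. Qed.

Lemma normc_sqrt x : normc x = Num.sqrt (sq x).
Proof. by rewrite sqE; case: x. Qed.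

Lemma sq_ge0 x : 0 <= sq x.
Proof. by rewrite sqE addr_ge0 ?sqr_ge0. Qed.

Lemma sq0 : sq (0 : R[i]) = 0.
Proof. by rewrite sqE /= expr0n addr0. Qed.

Lemma sq_eq0 x : sq x = 0 -> x = 0.
Proof. by rewrite -sq_normc => /eqP; rewrite sqrf_eq0 => /eqP/ComplexField.Normc.eq0_normc. Qed.

Lemma sqM x y : sq (x * y) = sq x * sq y.
Proof. rewrite !sqE !ReImE; ring. Qed.

Lemma sqN x : sq (- x) = sq x.
Proof. rewrite !sqE !ReImE; ring. Qed.

Lemma sq_conj x : sq x^* = sq x.
Proof. rewrite !sqE !ReImE; ring. Qed.

Lemma sq_real k : sq k%:C = k ^+ 2.
Proof. rewrite !sqE !ReImE; ring. Qed.

Lemma mulc_conj x : x * x^* = (sq x)%:C.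
Proof. by rewrite sqE; case: x => a b; congr (_ +i* _); rewrite ?mulrN ?opprK ?expr2 //= mulrC addNr. Qed.

Lemma sqD_le2 x y : sq (x + y) <= 2 * (sq x + sq y).
Proof.
rewrite !sqE !ReImE.
have := sqr_ge0 (Re x - Re y); have := sqr_ge0 (Im x - Im y); nra.
Qed.

Lemma sqD_le3 x y z : sq (x + y + z) <= 3 * (sq x + sq y + sq z).
Proof.
rewrite !sqE !ReImE.
have := sqr_ge0 (Re x - Re y); have := sqr_ge0 (Im x - Im y).
have := sqr_ge0 (Re x - Re z); have := sqr_ge0 (Im x - Im z).
have := sqr_ge0 (Re z - Re y); have := sqr_ge0 (Im z - Im y); nra.
Qed.

(** Induction on [n]: in |S + x y|^2 the cross term [2 * t] satisfies t^2 <= P U |x|^2 |y|^2, and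
    the inequality of arithmetic and geometric means bounds it by [P * sq y + U * sq x]. *)
Lemma cauchy_schwarz_sq (x y : nat -> R[i]) n :
  sq (\sum_(k < n) x k * y k) <= (\sum_(k < n) sq (x k)) * (\sum_(k < n) sq (y k)).
Proof.
elim: n => [|n IH]; first by rewrite !big_ord0 sq0 mul0r.
rewrite !big_ord_recr /=.
move: (\sum_(i < n) x i * y i) IH => S.
have : 0 <= \sum_(i < n) sq (x i) by apply: sumr_ge0 => i _; exact: sq_ge0.
have : 0 <= \sum_(i < n) sq (y i) by apply: sumr_ge0 => i _; exact: sq_ge0.
move: (\sum_(i < n) sq (x i)) (\sum_(i < n) sq (y i)) (x n) (y n) => P U {}x {}y U0 P0 H.
pose t := Re (S * (x * y)^*).
have -> : sq (S + x * y) = sq S + sq x * sq y + 2 * t by rewrite /t !sqE !ReImE; ring.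
have ht : t ^+ 2 <= sq S * (sq x * sq y).
  by rewrite -sqM -(sq_conj (x * y)) -sqM [leRHS]sqE -/t lerDl sqr_ge0.
have hx := sq_ge0 x; have hy := sq_ge0 y.
have ht2 : t ^+ 2 <= (P * U) * (sq x * sq y).
  by apply: (le_trans ht); rewrite ler_wpM2r// mulr_ge0.
suff : 2 * t <= P * sq y + U * sq x by nra.
have m0 : 0 <= P * sq y + U * sq x by rewrite addr_ge0 ?mulr_ge0.
have [t0|t0] := leP t 0; first by apply: le_trans m0; lra.
rewrite -(@ler_pXn2r _ 2)// ?nnegrE; last by lra.
have := sqr_ge0 (P * sq y - U * sq x); nra.
Qed.

End complex_modulus.

(** * The Szego recursion: energy and determinant *)

Section szego_recursion.
Variable R : realType.
Local Notation C := R[i].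
Variables (a : nat -> C) (rh : nat -> R).
Hypothesis rh_gt0 : forall n, 0 < rh n.
Hypothesis rh_sqr : forall n, rh n ^+ 2 = 1 - sq (a n).

Definition szego (w : C) (P Q : nat -> C) : Prop := forall n,
  (rh n)%:C * P n.+1 = w * P n - (a n)^* * Q n /\
  (rh n)%:C * Q n.+1 = Q n - a n * (w * P n).

Fixpoint szego_sol (w p0 q0 : C) (n : nat) : C * C :=
  if n is m.+1 then
    let: (p, q) := szego_sol w p0 q0 m in
    (((rh m)^-1)%:C * (w * p - (a m)^* * q), ((rh m)^-1)%:C * (q - a m * (w * p)))
  else (p0, q0).

Lemma real_mulVK k (x : C) : k != 0 -> k%:C * ((k^-1)%:C * x) = x.
Proof. by move=> k0; rewrite mulrA -rmorphM divff// rmorph1 mul1r. Qed.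

Lemma szego_solP w p0 q0 :
  szego w (fun n => (szego_sol w p0 q0 n).1) (fun n => (szego_sol w p0 q0 n).2).
Proof.
move=> n /=; case: (szego_sol w p0 q0 n) => p q /=.
by rewrite !real_mulVK// gt_eqF.
Qed.

(** The transfer matrix preserves the indefinite form |P|^2 - |Q|^2 once its first input is
    multiplied by [w]: the factor 1 - |a|^2 that comes out is [rh n ^+ 2]. *)
Lemma szego_energy w P Q n : szego w P Q ->
  sq (P n.+1) - sq (Q n.+1) = sq w * sq (P n) - sq (Q n).
Proof.
move=> /(_ n) [h1 h2].
have r0 : rh n ^+ 2 != 0 by rewrite expf_neq0 ?gt_eqF.
have e1 : rh n ^+ 2 * sq (P n.+1) = sq (w * P n - (a n)^* * Q n).
  by rewrite -sq_real -sqM h1.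
have e2 : rh n ^+ 2 * sq (Q n.+1) = sq (Q n - a n * (w * P n)).
  by rewrite -sq_real -sqM h2.
apply: (mulfI r0); rewrite mulrBr e1 e2 rh_sqr !sqE !ReImE; ring.
Qed.

(** Each step has determinant [w], because (1 - |a|^2) / rh^2 = 1. *)
Lemma szego_det w P Q P' Q' n : szego w P Q -> szego w P' Q' ->
  P n.+1 * Q' n.+1 - Q n.+1 * P' n.+1 = w * (P n * Q' n - Q n * P' n).
Proof.
move=> /(_ n) [h1 h2] /(_ n) [h3 h4].
have r0 : (rh n)%:C != 0 :> C by rewrite eq_complex /= eqxx andbT gt_eqF.
apply: (mulfI r0); apply: (mulfI r0).
have -> : (rh n)%:C * ((rh n)%:C * (P n.+1 * Q' n.+1 - Q n.+1 * P' n.+1)) =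
  ((rh n)%:C * P n.+1) * ((rh n)%:C * Q' n.+1) -
  ((rh n)%:C * Q n.+1) * ((rh n)%:C * P' n.+1) by ring.
have -> : (rh n)%:C * ((rh n)%:C * (w * (P n * Q' n - Q n * P' n))) =
  (1 - a n * (a n)^*) * (w * (P n * Q' n - Q n * P' n)).
  rewrite mulrA -[(rh n)%:C * _]rmorphM -expr2 rh_sqr rmorphB rmorph1 /=.
  by rewrite -mulc_conj.
rewrite h1 h2 h3 h4; ring.
Qed.

End szego_recursion.

(** * Comparison of solutions at [w] and at [z] *)

Section comparison.
Variable R : realType.
Local Notation C := R[i].
Variables (a : nat -> C) (rh : nat -> R).
Hypothesis rh_gt0 : forall n, 0 < rh n.
Hypothesis rh_sqr : forall n, rh n ^+ 2 = 1 - sq (a n).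

(* With [w = r z] and [d = 1 - r], the solution [(P, Q)] at [w] obeys the recursion at [z] up
   to the perturbation [- d P n] of its first entry; by Cramer's rule its coordinates in the
   basis [(e1, e2)], [(u1, u2)] of solutions at [z] are sums over that perturbation. *)
Lemma variation_of_constants (z : C) (r : R) (P Q e1 e2 u1 u2 : nat -> C) (s : R) :
  sq z = 1 -> szego a rh (r%:C * z) P Q -> szego a rh z e1 e2 -> szego a rh z u1 u2 ->
  e1 0%N = P 0%N -> e2 0%N = Q 0%N -> u1 0%N = - (Q 0%N)^* -> u2 0%N = (P 0%N)^* ->
  s = sq (P 0%N) + sq (Q 0%N) ->
  let A n := s%:C - (1 - r)%:C * \sum_(k < n) P k * (u2 k * z^* ^+ k) in
  let B n := (1 - r)%:C * \sum_(k < n) P k * (e2 k * z^* ^+ k) in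
  forall n, s%:C * P n = A n * e1 n + B n * u1 n /\ s%:C * Q n = A n * e2 n + B n * u2 n.
Proof.
move=> z1 hX he hu e10 e20 u10 u20 sE A B n.
have zz : z * z^* = 1 by rewrite mulc_conj z1.
have z0 : z != 0.
  by apply/eqP => z0; move/eqP: zz; rewrite z0 mul0r eq_sym oner_eq0.
have zzn k : z ^+ k * z^* ^+ k = 1 by rewrite -exprMn zz expr1n.
(* The pair [(P, Q)] sees r z P in place of z P, which accounts for the extra term [- (1 - r) P] in
   the Wronskian. *)
have step k (f g : nat -> C) : szego a rh z f g ->
  P k.+1 * g k.+1 - Q k.+1 * f k.+1 =
    z * ((P k * g k - Q k * f k) - (1 - r)%:C * P k * g k).
  move=> hf.
  have [h1 h2] := hX k; have [h3 h4] := hf k.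
  have r0 : (rh k)%:C != 0 :> C by rewrite eq_complex /= eqxx andbT gt_eqF.
  apply: (mulfI r0); apply: (mulfI r0).
  have -> : (rh k)%:C * ((rh k)%:C * (P k.+1 * g k.+1 - Q k.+1 * f k.+1)) =
    ((rh k)%:C * P k.+1) * ((rh k)%:C * g k.+1) -
    ((rh k)%:C * Q k.+1) * ((rh k)%:C * f k.+1) by ring.
  rewrite [RHS]mulrA -[(rh k)%:C * (rh k)%:C]rmorphM -expr2 rh_sqr.
  rewrite (rmorphB _ 1 (sq (a k))) rmorph1 /= -mulc_conj h1 h2 h3 h4.
  rewrite rmorphB rmorph1; ring.
(* The initial value of [(u1, u2)] is orthogonal to that of [(e1, e2)], so the determinant at 0 is
   [s] and both solutions start with squared norm [s]. *)
have detA k : P k * u2 k - Q k * u1 k = z ^+ k * A k.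
  elim: k => [|k IH].
    rewrite /A big_ord0 mulr0 subr0 expr0 mul1r u10 u20 sE rmorphD /= -!mulc_conj; ring.
  rewrite (step k u1 u2 hu) IH /A big_ord_recr /= exprS.
  have := zzn k; move: (z ^+ k) (z^* ^+ k) => x y xy.
  by rewrite -[X in _ - _ * _ * X](mulr1) -xy; ring.
have detB k : e1 k * Q k - e2 k * P k = z ^+ k * B k.
  elim: k => [|k IH].
    by rewrite /B big_ord0 mulr0 mulr0 e10 e20 mulrC subrr.
  have -> : e1 k.+1 * Q k.+1 - e2 k.+1 * P k.+1 =
    - (P k.+1 * e2 k.+1 - Q k.+1 * e1 k.+1) by ring.
  rewrite (step k e1 e2 he).
  have -> : P k * e2 k - Q k * e1 k = - (z ^+ k * B k) by rewrite -IH; ring.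
  rewrite /B big_ord_recr /= exprS.
  have := zzn k; move: (z ^+ k) (z^* ^+ k) => x y xy.
  by rewrite -[X in _ - _ * _ * X](mulr1) -xy; ring.
have detS k : e1 k * u2 k - e2 k * u1 k = z ^+ k * s%:C.
  elim: k => [|k IH].
    rewrite expr0 mul1r e10 e20 u10 u20 sE rmorphD /= -!mulc_conj; ring.
  by rewrite (szego_det rh_gt0 rh_sqr _ he hu) IH exprS mulrA.
have zn0 : z ^+ n != 0 by rewrite expf_neq0.
have lin (x y : C) : z ^+ n * (A n * x + B n * y) =
    (P n * u2 n - Q n * u1 n) * x + (e1 n * Q n - e2 n * P n) * y.
  by rewrite detA detB; ring.
by split; apply: (mulfI zn0); rewrite [LHS]mulrA -detS lin; ring.
Qed.

Definition sum_sq2 n (f g : nat -> C) : R := \sum_(k < n) (sq (f k) + sq (g k)).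

Lemma sum_sq_ge0 (f : nat -> C) n : 0 <= \sum_(k < n) sq (f k).
Proof. by apply: sumr_ge0 => i _; exact: sq_ge0. Qed.

Lemma le_sum_sq (f : nat -> C) m n : (m <= n)%N ->
  \sum_(k < m) sq (f k) <= \sum_(k < n) sq (f k).
Proof.
move=> mn; rewrite -!(big_mkord xpredT (fun k => sq (f k))) [leRHS](big_cat_nat (leq0n m) mn)//= lerDl.
by apply: sumr_ge0 => i _; exact: sq_ge0.
Qed.

(** Variation of constants is read as an equation for the solution at [z]: s e = s P + (s - A) e - B
    u. Cauchy-Schwarz bounds [s - A] by [u] and [B] by [e], so after summation both error terms are
    the same product of the two sums of squares. Since |Q| <= |P|, the main term involves [P] only.
    The 6 is 3, from squaring three terms, times 2. *)
Lemma solution_comparison (z : C) (r : R) (P Q e1 e2 u1 u2 : nat -> C) (s : R) K :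
  sq z = 1 -> szego a rh (r%:C * z) P Q -> szego a rh z e1 e2 -> szego a rh z u1 u2 ->
  e1 0%N = P 0%N -> e2 0%N = Q 0%N -> u1 0%N = - (Q 0%N)^* -> u2 0%N = (P 0%N)^* ->
  s = sq (P 0%N) + sq (Q 0%N) -> (forall n, sq (Q n) <= sq (P n)) ->
  s ^+ 2 * sum_sq2 K e1 e2 <= 6 * s ^+ 2 * (\sum_(k < K) sq (P k)) +
    6 * (1 - r) ^+ 2 * (\sum_(k < K) sq (P k)) * sum_sq2 K u1 u2 * sum_sq2 K e1 e2.
Proof.
move=> z1 hX he hu e10 e20 u10 u20 sE QP.
pose S := sum_sq2 K; rewrite -/S; set p := \sum_(k < K) sq (P k).
pose A n := s%:C - (1 - r)%:C * \sum_(k < n) P k * (u2 k * z^* ^+ k).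
pose B n := (1 - r)%:C * \sum_(k < n) P k * (e2 k * z^* ^+ k).
have AB n : s%:C * P n = A n * e1 n + B n * u1 n /\ s%:C * Q n = A n * e2 n + B n * u2 n.
  exact: variation_of_constants.
have sub1 (f g : nat -> C) : \sum_(k < K) sq (f k) <= S f g.
  by apply: ler_sum => i _; rewrite lerDl sq_ge0.
have sub2 (f g : nat -> C) : \sum_(k < K) sq (g k) <= S f g.
  by apply: ler_sum => i _; rewrite lerDr sq_ge0.
have szn (f : nat -> C) n : (n < K)%N -> \sum_(k < n) sq (f k * z^* ^+ k) <= \sum_(k < K) sq (f k).
  move=> nK; apply: le_trans (le_sum_sq f (ltnW nK)).
  apply: ler_sum => i _; rewrite sqM.
  have -> : sq (z^* ^+ i) = 1; last by rewrite mulr1.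
  by elim: (nat_of_ord i) => [|k IH]; rewrite ?expr0 ?exprS ?sqM ?IH ?sq_conj ?z1 ?mulr1// sqE /=; ring.
have bound (f : nat -> C) n M : (n < K)%N -> \sum_(k < K) sq (f k) <= M ->
    sq ((1 - r)%:C * \sum_(k < n) P k * (f k * z^* ^+ k)) <= (1 - r) ^+ 2 * p * M.
  move=> nK fM; rewrite sqM sq_real -mulrA ler_wpM2l ?sqr_ge0//.
  apply: (le_trans (cauchy_schwarz_sq _ (fun k => f k * z^* ^+ k) n)).
  apply: ler_pM; rewrite ?sum_sq_ge0//; first by apply: sumr_ge0 => *; exact: sq_ge0.
    exact: le_sum_sq (ltnW nK).
  exact: le_trans (szn _ _ nK) fM.
have pt n : (n < K)%N -> s ^+ 2 * (sq (e1 n) + sq (e2 n)) <=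
    3 * (s ^+ 2 * (2 * sq (P n)) + ((1 - r) ^+ 2 * p * S u1 u2) * (sq (e1 n) + sq (e2 n))
     + ((1 - r) ^+ 2 * p * S e1 e2) * (sq (u1 n) + sq (u2 n))).
  move=> nK; have [h1 h2] := AB n.
  have bA : sq (s%:C - A n) <= (1 - r) ^+ 2 * p * S u1 u2.
    by rewrite /A opprB addrC subrK; exact: bound (sub2 _ _).
  have bB : sq (- B n) <= (1 - r) ^+ 2 * p * S e1 e2.
    by rewrite sqN; exact: bound (sub2 _ _).
  have c1 : s ^+ 2 * sq (e1 n) <= 3 * (s ^+ 2 * sq (P n) + sq (s%:C - A n) * sq (e1 n) + sq (- B n) * sq (u1 n)).
    rewrite -sq_real -!sqM; apply: le_trans (sqD_le3 _ _ _).
    by rewrite h1 le_eqVlt; apply/orP; left; apply/eqP; congr sq; ring.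
  have c2 : s ^+ 2 * sq (e2 n) <= 3 * (s ^+ 2 * sq (Q n) + sq (s%:C - A n) * sq (e2 n) + sq (- B n) * sq (u2 n)).
    rewrite -sq_real -!sqM; apply: le_trans (sqD_le3 _ _ _).
    by rewrite h2 le_eqVlt; apply/orP; left; apply/eqP; congr sq; ring.
  have c3 : s ^+ 2 * sq (Q n) <= s ^+ 2 * sq (P n) by rewrite ler_wpM2l ?sqr_ge0.
  have c4 := ler_wpM2r (sq_ge0 (e1 n)) bA; have c5 := ler_wpM2r (sq_ge0 (e2 n)) bA.
  have c6 := ler_wpM2r (sq_ge0 (u1 n)) bB; have c7 := ler_wpM2r (sq_ge0 (u2 n)) bB.
  move: c1 c2 c3 c4 c5 c6 c7; clear.
  move: ((1 - r) ^+ 2 * p * S u1 u2) ((1 - r) ^+ 2 * p * S e1 e2) => M N.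
  move: (sq (s%:C - A n)) (sq (- B n)) (sq (e1 n)) (sq (e2 n)) (sq (u1 n)) (sq (u2 n)).
  move: (sq (P n)) (sq (Q n)) (s ^+ 2) => x1 x2 x3 x4 x5 x6 x7 x8 x9; lra.
have -> : s ^+ 2 * S e1 e2 = \sum_(n < K) s ^+ 2 * (sq (e1 n) + sq (e2 n)) by rewrite /S /sum_sq2 mulr_sumr.
apply: le_trans (_ : \sum_(n < K) 3 * (s ^+ 2 * (2 * sq (P n)) + ((1 - r) ^+ 2 * p * S u1 u2) * (sq (e1 n) + sq (e2 n))
     + ((1 - r) ^+ 2 * p * S e1 e2) * (sq (u1 n) + sq (u2 n))) <= _).
  by apply: ler_sum => i _; exact: pt.
rewrite -mulr_sumr big_split /= big_split /= -!mulr_sumr -/(sum_sq2 K e1 e2) -/(sum_sq2 K u1 u2) -/p -/S.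
by rewrite le_eqVlt; apply/orP; left; apply/eqP; ring.
Qed.

End comparison.

(** * Solutions on the right half line *)

Section half_line.
Variable R : realType.
Local Notation C := R[i].
Variable alpha : int -> C.
Hypothesis alpha_in_D : forall n : int, normc (alpha n) < 1.

Lemma rho_gt0 n : 0 < rho alpha n.
Proof.
by rewrite sqrtr_gt0 subr_gt0 expr_lt1// ?normc_ge0.
Qed.

Lemma rho_sqr n : rho alpha n ^+ 2 = 1 - sq (alpha n).
Proof. by rewrite sqr_sqrtr ?sq_normc// subr_ge0 -sq_normc ltW// expr_lt1// ?normc_ge0. Qed.

Local Notation a := (fun n : nat => alpha n%:Z).
Local Notation rh := (fun n : nat => rho alpha n%:Z).

Definition interleave (P Q : nat -> C) (j : nat) : C := if odd j then P j./2 else Q j./2.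

Lemma interleave_even P Q n : interleave P Q (2 * n)%N = Q n.
Proof. by rewrite /interleave mul2n odd_double doubleK. Qed.

Lemma interleave_odd P Q n : interleave P Q (2 * n + 1)%N = P n.
Proof. by rewrite /interleave mul2n addn1 /= odd_double uphalf_double. Qed.

Lemma szego_transfer z P Q : szego a rh z P Q -> transfer_solution alpha z (interleave P Q).
Proof.
move=> h n; have [h1 h2] := h n.
have -> : (2 * n + 3 = 2 * n.+1 + 1)%N by lia.
have -> : (2 * n + 2 = 2 * n.+1)%N by lia.
rewrite !interleave_even !interleave_odd /transfer_mx -scalemxAl mul_block_col.
rewrite -!scalar_mxM -!raddfD /= scale_col_mx !scale_scalar_mx.
have r0 : (rho alpha n%:Z)%:C != 0 :> C.
  by rewrite eq_complex /= eqxx andbT gt_eqF// rho_gt0.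
by congr (col_mx _%:M _%:M); apply: (mulfI r0); rewrite ?h1 ?h2 [RHS]mulrA divff//; ring.
Qed.

Lemma norm_upto_interleave P Q K :
  norm_upto (interleave P Q) (2 * K + 1)%N ^+ 2 = sum_sq2 K.+1 P Q.
Proof.
rewrite sqr_sqrtr; last by apply: sumr_ge0 => *; exact: sqr_ge0.
have -> : ((2 * K + 1).+1 = 2 * K.+1)%N by lia.
rewrite /sum_sq2; move: K.+1 => {}K; elim: K => [|K IH]; first by rewrite muln0 !big_ord0.
have -> : (2 * K.+1 = (2 * K).+2)%N by lia.
have e1 : interleave P Q (2 * K).+1 = P K by rewrite -addn1 interleave_odd.
by rewrite !big_ord_recr /= IH e1 interleave_even !sq_normc -addrA [sq (Q K) + _]addrC.
Qed.

Lemma norm_at_nat eta n : norm_at eta n%:R = norm_upto eta n :> R.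
Proof. by rewrite /norm_at natrK subrr mul0r addr0. Qed.

(** At L = 2 K + 1 the norm runs over the complete pairs (P_0, Q_0), ..., (P_K, Q_K), and [norm_at]
    is [norm_upto] there since L is an integer. *)
Lemma power_law_sum_sq z C1 C2 g1 g2 L0 P Q K :
  0 <= C1 -> power_law_bounds alpha z C1 C2 g1 g2 L0 -> szego a rh z P Q ->
  sq (P 0%N) + sq (Q 0%N) = 2 -> L0 <= (2 * K + 1)%:R ->
  (C1 * (2 * K + 1)%:R `^ g1) ^+ 2 <= sum_sq2 K.+1 P Q <= (C2 * (2 * K + 1)%:R `^ g2) ^+ 2.
Proof.
move=> C10 pl h nrm hK.
have [] := pl (interleave P Q) (szego_transfer h) _ _ hK.
  by rewrite /normalized (interleave_even P Q 0) (interleave_odd P Q 0) !sq_normc addrC.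
rewrite norm_at_nat => h1 h2; rewrite -norm_upto_interleave.
have n0 : 0 <= norm_upto (interleave P Q) (2 * K + 1)%N by exact: sqrtr_ge0.
rewrite !ler_pXn2r ?nnegrE ?h1 ?h2//; first exact: le_trans h2.
by rewrite mulr_ge0 ?powR_ge0.
Qed.

Lemma exists_solution z (p q : C) : exists P Q, [/\ szego a rh z P Q, P 0%N = p & Q 0%N = q].
Proof.
exists (fun n => (szego_sol a rh z p q n).1), (fun n => (szego_sol a rh z p q n).2).
by split=> //; apply: szego_solP => n; exact: rho_gt0.
Qed.

(** The energy |P_n|^2 - |Q_n|^2 drops by (1 - |w|^2) |P_n|^2 at each step. If it became negative it
    would stay below a negative constant, against the decay of the solution. So it is nonnegative,
    and the drops add up to at most its initial value. *)
Lemma decaying_energy w P Q : sq w <= 1 -> szego a rh w P Q ->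
  (fun n => sq (P n) + sq (Q n)) @ \oo --> (0 : R) ->
  forall n, (1 - sq w) * (\sum_(k < n) sq (P k)) <= sq (P 0%N) - sq (Q 0%N) /\
    sq (Q n) <= sq (P n).
Proof.
move=> w1 h cv.
have rg n : 0 < rh n by exact: rho_gt0.
have rs n : rh n ^+ 2 = 1 - sq (a n) by exact: rho_sqr.
pose e n := sq (P n) - sq (Q n).
have eS n : e n = e n.+1 + (1 - sq w) * sq (P n).
  rewrite /e (szego_energy rg rs n h); ring.
have e_dec : {homo e : m n / (m <= n)%N >-> n <= m}.
  move=> m n /subnKC <-; elim: (n - m)%N => [|k IH]; first by rewrite addn0.
  by apply: le_trans IH; rewrite [leRHS]eS addnS lerDl mulr_ge0 ?sq_ge0 ?subr_ge0.
have e_ge0 n : 0 <= e n.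
  rewrite leNgt; apply/negP => en.
  have e0 : 0 < - e n by rewrite oppr_gt0.
  move/cvgrPdist_lt : cv => /(_ _ e0) [N _ /(_ (maxn N n))] /=.
  rewrite leq_maxl => /(_ isT); rewrite sub0r normrN ger0_norm; last exact: (addr_ge0 (sq_ge0 _) (sq_ge0 _)).
  have := e_dec _ _ (leq_maxr N n); rewrite /e.
  have := sq_ge0 (P (maxn N n)); lra.
move=> n; split; last by rewrite -subr_ge0 e_ge0.
rewrite -/(e 0%N); suff <- : e n + (1 - sq w) * (\sum_(k < n) sq (P k)) = e 0%N.
  by rewrite lerDr.
elim: n => [|n IH]; first by rewrite big_ord0 mulr0 addr0.
rewrite -IH big_ord_recr /= (eS n); ring.
Qed.

End half_line.

(** * The quantitative half-line estimate *)

Section half_line_bound.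
Variable R : realType.
Local Notation C := R[i].
Variable alpha : int -> C.
Hypothesis alpha_in_D : forall n : int, normc (alpha n) < 1.
Local Notation a := (fun n : nat => alpha n%:Z).
Local Notation rh := (fun n : nat => rho alpha n%:Z).

Lemma szego_scale w P Q (k : C) : szego a rh w P Q ->
  szego a rh w (fun n => k * P n) (fun n => k * Q n).
Proof.
move=> h n; have [h1 h2] := h n.
by split; rewrite mulrCA ?h1 ?h2; ring.
Qed.

Lemma power_law_sum_sq_scaled z C1 C2 g1 g2 L0 P Q K s :
  0 <= C1 -> power_law_bounds alpha z C1 C2 g1 g2 L0 -> szego a rh z P Q ->
  0 < s -> sq (P 0%N) + sq (Q 0%N) = s -> L0 <= (2 * K + 1)%:R ->
  s / 2 * (C1 * (2 * K + 1)%:R `^ g1) ^+ 2 <= sum_sq2 K.+1 P Q <=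
  s / 2 * (C2 * (2 * K + 1)%:R `^ g2) ^+ 2.
Proof.
move=> C10 pl h s0 sE hK.
pose k := Num.sqrt (2 / s).
have k2 : k ^+ 2 = 2 / s by rewrite sqr_sqrtr// divr_ge0// ltW.
have nrm : sq (k%:C * P 0%N) + sq (k%:C * Q 0%N) = 2.
  by rewrite !sqM sq_real k2 -mulrDr sE mulfVK// gt_eqF.
have := power_law_sum_sq alpha_in_D C10 pl (szego_scale k%:C h) nrm hK.
have -> : sum_sq2 K.+1 (fun n => k%:C * P n) (fun n => k%:C * Q n) = 2 / s * sum_sq2 K.+1 P Q.
  by rewrite /sum_sq2 mulr_sumr; apply: eq_bigr => i _; rewrite !sqM sq_real k2 -mulrDr.
have e X : s / 2 * (2 / s * X) = X by rewrite mulrA mulf_div mulrC [s * 2]mulrC divff ?mulr1// mulf_neq0 ?gt_eqF.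
have s2 : 0 <= s / 2 by rewrite divr_ge0// ltW.
by case/andP => h1 h2; rewrite -[X in _ <= X <= _]e !ler_wpM2l.
Qed.

(** The length x = d^(-1/g), with g = g1 + g2, balances the two power laws. Put y = d^(-beta). The
    lower law gives H >= const s y, and the upper law gives d^2 U y <= const s because 2 - 2 g2 / g
    = beta. After multiplication of the comparison by [y], both terms on the right are at most const
    s p H, so s H cancels and p >= const s y. The energy inequality then bounds d p from above. The
    constant is fixed before [z] and [r]. *)
Lemma half_line_bound (C1 C2 g1 g2 L0 : R) :
  0 < C1 -> 0 < C2 -> 0 < g1 -> 0 < g2 -> 0 < L0 ->
  exists2 c, 0 < c & forall (z : C) (r : R) P Q, sq z = 1 ->
    power_law_bounds alpha z C1 C2 g1 g2 L0 -> 0 < r -> r < 1 ->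
    szego a rh (r%:C * z) P Q -> (fun n => sq (P n) + sq (Q n)) @ \oo --> (0 : R) ->
    c * (1 - r) `^ (1 - 2 * g1 / (g1 + g2)) * sq (P 0%N) <= sq (P 0%N) - sq (Q 0%N).
Proof.
move=> C10 C20 g10 g20 L00.
pose g := g1 + g2; have g0 : 0 < g by rewrite addr_gt0.
have gn0 : g != 0 by rewrite gt_eqF.
pose M := 2 * L0 + 3; pose D := (C2 * M `^ g2) ^+ 2.
have D0 : 0 <= D by exact: sqr_ge0.
have cD : 0 < 12 / C1 ^+ 2 + 3 * D.
  by rewrite ltr_pwDl// ?divr_gt0 ?exprn_gt0// mulr_ge0.
exists (12 / C1 ^+ 2 + 3 * D)^-1; first by rewrite invr_gt0.
move=> z r P Q z1 pl r0 r1 h cv.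
have w1 : sq (r%:C * z) = r ^+ 2 by rewrite sqM sq_real z1 mulr1.
have en := decaying_energy alpha_in_D _ h cv.
have r21 : r ^+ 2 <= 1 by rewrite expr_le1 ?ltW.
rewrite w1 in en; have {}en := en r21.
set s := sq (P 0%N) + sq (Q 0%N).
have := sq_ge0 (P 0%N); rewrite le_eqVlt => /orP[/eqP P0|P0].
  by rewrite -P0 mulr0 sub0r oppr_ge0 P0; case: (en 0%N).
have s0 : 0 < s by rewrite ltr_pwDl// sq_ge0.
pose d : R := 1 - r; have d0 : 0 < d by rewrite subr_gt0.
have dn0 : d != 0 by rewrite gt_eqF.
have dD e f : d `^ e * d `^ f = d `^ (e + f).
  by rewrite powRD// dn0 implybT.
pose x := d `^ (- g^-1).
have x1 : 1 <= x.
  rewrite /x powRN invr_ge1 ?unitfE ?powR_gt0 ?gt_eqF ?powR_gt0//.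
  have e1 : 1 `^ g^-1 = 1 :> R by rewrite powR1.
  rewrite -[leRHS]e1; apply: ge0_ler_powR; rewrite ?nnegrE ?invr_ge0 ?ltW//.
  by rewrite /d; lra.
(* The maximum with [L0] brings the odd integer [L] into the range of the power laws. The factor [M]
   absorbs it: L <= 2 (x + L0) + 1 <= M x, since x >= 1. *)
pose mx := Num.max x L0.
pose K := Num.truncn mx.
have mx0 : 0 <= mx by rewrite le_max (le_trans _ x1).
have [Kl Ku] := andP (truncn_itv mx0).
pose L : R := (2 * K + 1)%:R.
have LE : L = 2 * K%:R + 1 by rewrite /L natrD natrM.
have Lmx : mx <= L by rewrite LE; move: Ku; rewrite -/K -natr1; have := ler0n R K; lra.
have LM : L <= M * x.
  have : mx <= x + L0 by rewrite ge_max lerDl lerDr (ltW L00) (le_trans _ x1).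
  rewrite LE /M; move: Kl x1 L00; rewrite -/K; nra.
have xL : x <= L by apply: le_trans Lmx; rewrite le_max lexx.
have L0L : L0 <= L by apply: le_trans Lmx; rewrite le_max lexx orbT.
have x0 : 0 < x by exact: lt_le_trans x1.
have [e1 [e2 [he e10 e20]]] := exists_solution alpha_in_D z (P 0%N) (Q 0%N).
have [u1 [u2 [hu u10 u20]]] := exists_solution alpha_in_D z (- (Q 0%N)^*) ((P 0%N)^*).
have rg n : 0 < rh n by exact: rho_gt0.
have rs n : rh n ^+ 2 = 1 - sq (a n) by exact: rho_sqr.
have := @solution_comparison R a rh rg rs z r P Q e1 e2 u1 u2 s K.+1 z1 h he hu e10 e20
  u10 u20 erefl (fun n => (en n).2).
have se : sq (e1 0%N) + sq (e2 0%N) = s by rewrite e10 e20.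
have su : sq (u1 0%N) + sq (u2 0%N) = s by rewrite u10 u20 sqN !sq_conj addrC.
have /andP[H1 _] := power_law_sum_sq_scaled (ltW C10) pl he s0 se L0L.
have /andP[_ U2] := power_law_sum_sq_scaled (ltW C10) pl hu s0 su L0L.
have [p1 _] := en K.+1.
move: p1 H1 U2; rewrite -/L -/s -/d.
set H := sum_sq2 _ e1 e2; set U := sum_sq2 _ u1 u2; set p := \sum_(k < _) _.
have p0 : 0 <= p by exact: sum_sq_ge0.
move=> p1 H1 U2 main.
pose y := d `^ (- (2 * g1 / g)).
have y0 : 0 < y by rewrite powR_gt0.
have Hy : s / 2 * C1 ^+ 2 * y <= H.
  apply: le_trans H1; rewrite exprMn [leRHS]mulrA ler_wpM2l//; first by rewrite mulr_ge0 ?divr_ge0 ?sqr_ge0 ?ltW.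
  apply: le_trans (_ : (x `^ g1) ^+ 2 <= _); last first.
    rewrite ler_pXn2r ?nnegrE ?powR_ge0//.
    by apply: ge0_ler_powR; rewrite ?nnegrE ?(ltW g10) ?(ltW x0) ?(le_trans _ xL) ?(ltW x0).
  by rewrite /x -powRrM expr2 dD /y le_eqVlt; apply/orP; left; apply/eqP; congr (_ `^ _); field.
have Uy : d ^+ 2 * U * y <= s / 2 * D.
  apply: le_trans (_ : d ^+ 2 * (s / 2 * (C2 * (M * x) `^ g2) ^+ 2) * y <= _).
    rewrite ler_wpM2r ?(ltW y0)// ler_wpM2l ?sqr_ge0//; apply: (le_trans U2).
    rewrite ler_wpM2l ?divr_ge0 ?(ltW s0)// ler_pXn2r ?nnegrE ?mulr_ge0 ?powR_ge0 ?(ltW C20)//.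
    rewrite ler_wpM2l ?(ltW C20)//; apply: ge0_ler_powR; rewrite ?nnegrE ?(ltW g20) ?ler0n//.
    exact: le_trans LM.
  have M0 : 0 <= M by rewrite addr_ge0 ?mulr_ge0 ?(ltW L00).
  rewrite powRM ?(ltW x0)// /D.
  have -> : d ^+ 2 * (s / 2 * (C2 * (M `^ g2 * x `^ g2)) ^+ 2) * y =
    s / 2 * (C2 * M `^ g2) ^+ 2 * (d ^+ 2 * (x `^ g2) ^+ 2 * y) by ring.
  have -> : d ^+ 2 * (x `^ g2) ^+ 2 * y = 1; last by rewrite mulr1.
  rewrite -(powR_mulrn 2 (ltW d0)) /x -powRrM expr2 /y !dD.
  rewrite -[RHS](powRr0 d); congr (_ `^ _); rewrite /g; field; exact: gn0.
have H0 : 0 < H.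
  by apply: lt_le_trans Hy; rewrite !mulr_gt0 ?invr_gt0 ?exprn_gt0.
have key : s * y <= p * (12 / C1 ^+ 2 + 3 * D).
  rewrite -(ler_pM2r H0) -(ler_pM2l s0).
  have b1 : 6 * s ^+ 2 * p * y <= s * p * (12 / C1 ^+ 2) * H.
    have -> : 6 * s ^+ 2 * p * y = s * p * (12 / C1 ^+ 2) * (s / 2 * C1 ^+ 2 * y).
      field; by rewrite gt_eqF.
    by rewrite ler_wpM2l// !mulr_ge0 ?invr_ge0 ?sqr_ge0 ?(ltW s0).
  have b2 : 6 * d ^+ 2 * p * U * H * y <= s * p * (3 * D) * H.
    have -> : 6 * d ^+ 2 * p * U * H * y = 6 * p * H * (d ^+ 2 * U * y) by ring.
    have -> : s * p * (3 * D) * H = 6 * p * H * (s / 2 * D) by field.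
    by rewrite ler_wpM2l// !mulr_ge0// ltW.
  have := ler_wpM2r (ltW y0) main.
  move: b1 b2; move: (12 / C1 ^+ 2) => N; move: (s ^+ 2) (d ^+ 2) (expr2 s) => ss dd ->; lra.
have dp : d * p <= sq (P 0%N) - sq (Q 0%N).
  apply: le_trans p1; rewrite ler_wpM2r// /d; nra.
apply: le_trans dp; rewrite -mulrA mulrC ler_pdivrMr//.
have -> : d `^ (1 - 2 * g1 / (g1 + g2)) = d * y.
  by rewrite -[X in _ = X * _](powRr1 (ltW d0)) /y dD.
rewrite -mulrA -mulrA ler_wpM2l ?(ltW d0)//; apply: le_trans key.
by rewrite mulrC ler_wpM2r ?(ltW y0)// /s lerDl sq_ge0.
Qed.

End half_line_bound.

(** * Factorization of the CMV matrix into 2 x 2 blocks *)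

Section theta.
Variable R : realType.
Local Notation C := R[i].
Implicit Types (alpha u : int -> C) (b : bool).

(* The direct sum of the blocks [[conj (alpha j), rho j], [rho j, - alpha j]] acting on the
   coordinates [(j, j + 1)], over the [j] of parity [b]. *)
Definition theta b alpha u (j : int) : C :=
  if odd `|j|%N == b then (alpha j)^* * u j + (rho alpha j)%:C * u (j + 1)
  else (rho alpha (j - 1))%:C * u (j - 1) - alpha (j - 1) * u j.

Lemma odd_absz_add1 (j : int) : odd `|(j + 1)%R|%N = ~~ odd `|j|%N.
Proof. lia. Qed.

Lemma odd_absz_sub1 (j : int) : odd `|(j - 1)%R|%N = ~~ odd `|j|%N.
Proof. lia. Qed.

Lemma theta_fst b alpha u j : odd `|j|%N = b ->
  theta b alpha u j = (alpha j)^* * u j + (rho alpha j)%:C * u (j + 1).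
Proof. by rewrite /theta => ->; rewrite eqxx. Qed.

Lemma theta_snd b alpha u j : odd `|j|%N = b ->
  theta b alpha u (j + 1) = (rho alpha j)%:C * u j - alpha j * u (j + 1).
Proof. by rewrite /theta odd_absz_add1 => ->; rewrite addrK; case: b. Qed.

(** The factorization of the extended CMV matrix into two block diagonal unitaries. Row [j] is
    supported on the columns 2 m - 1, ..., 2 m + 2 with m = j div 2, so the sum over the integers
    has four terms, and these are compared according to the parity of [j]. *)
Lemma cmv_theta alpha u : cmv alpha u =1 theta false alpha (theta true alpha u).
Proof.
move=> j; rewrite /cmv.
pose m := (j %/ 2)%Z.
have sum4 : \sum_(k \in [set: int]) cmv_entry alpha j k * u k =
  \sum_(k <- [:: 2 * m - 1; 2 * m; 2 * m + 1; 2 * m + 2]) cmv_entry alpha j k * u k.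
  rewrite (@fsbigE _ _ _ _ _ [:: 2 * m - 1; 2 * m; 2 * m + 1; 2 * m + 2])//.
  - by apply: eq_bigl => i; rewrite in_setT.
  - by rewrite /= !inE; lia.
  - move=> k _; rewrite !inE !negb_or => /and4P[k1 k2 k3 k4].
    rewrite /cmv_entry -/m (negbTE k1) (negbTE k2) (negbTE k3) (negbTE k4).
    by rewrite if_same mul0r.
rewrite sum4 !big_cons big_nil addr0.
have ne1 : (2 * m == 2 * m - 1) = false by lia.
have ne2 : (2 * m + 1 == 2 * m - 1) = false by lia.
have ne3 : (2 * m + 1 == 2 * m) = false by lia.
have ne4 : (2 * m + 2 == 2 * m - 1) = false by lia.
have ne5 : (2 * m + 2 == 2 * m) = false by lia.
have ne6 : (2 * m + 2 == 2 * m + 1) = false by lia.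
have o1 : odd `|(2 * m - 1)%R|%N by lia.
have o2 : odd `|(2 * m)%R|%N = false by lia.
have o3 : odd `|(2 * m + 1)%R|%N by lia.
have B1 : theta true alpha u (2 * m) =
    (rho alpha (2 * m - 1))%:C * u (2 * m - 1) - alpha (2 * m - 1) * u (2 * m).
  by rewrite -[X in theta _ _ _ X = _](subrK 1) theta_snd// subrK.
have B2 : theta true alpha u (2 * m + 1) =
    (alpha (2 * m + 1))^* * u (2 * m + 1) + (rho alpha (2 * m + 1))%:C * u (2 * m + 2).
  by rewrite theta_fst// -addrA.
rewrite /cmv_entry -/m !eqxx ne1 ne2 ne3 ne4 ne5 ne6.
have [jE|jE] := boolP (odd `|j|%N).
  have -> : (j == 2 * m) = false by rewrite /m; lia.
  have -> : j = 2 * m + 1 by rewrite /m; lia.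
  by rewrite theta_snd// B1 B2; ring.
have -> : j == 2 * m by rewrite /m; lia.
have -> : j = 2 * m by rewrite /m; lia.
by rewrite theta_fst// B1 B2; ring.
Qed.

Variable alpha : int -> C.
Hypothesis alpha_in_D : forall n : int, normc (alpha n) < 1.

Lemma real_rho_sqr j : (rho alpha j)%:C * (rho alpha j)%:C = 1 - alpha j * (alpha j)^* :> C.
Proof. by rewrite -rmorphM -expr2 rho_sqr// mulc_conj rmorphB. Qed.

Lemma theta_isometry b u j : odd `|j|%N = b ->
  sq (theta b alpha u j) + sq (theta b alpha u (j + 1)) = sq (u j) + sq (u (j + 1)).
Proof.
move=> jb; rewrite theta_fst// theta_snd//.
move: (u j) (u (j + 1)) (rho_sqr alpha_in_D j) => x y.
move: (rho alpha j) (alpha j) => r al; rewrite !sqE !ReImE => h.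
apply/eqP; rewrite -subr_eq0; apply/eqP.
transitivity ((r ^+ 2 - (1 - (complex.Re al ^+ 2 + complex.Im al ^+ 2))) *
  (complex.Re x ^+ 2 + complex.Im x ^+ 2 + complex.Re y ^+ 2 + complex.Im y ^+ 2)); first ring.
by rewrite h subrr mul0r.
Qed.

(** Read across instead of down, a unitary block is a transfer matrix: the pair at [j + 1] is
    expressed by the pair at [j], up to the factor [rho]. *)
Lemma theta_invert j (p q p' q' : C) :
  p = (alpha j)^* * q + (rho alpha j)%:C * p' -> q' = (rho alpha j)%:C * q - alpha j * p' ->
  (rho alpha j)%:C * p' = p - (alpha j)^* * q /\ (rho alpha j)%:C * q' = q - alpha j * p.
Proof.
move=> -> ->; split; first by ring.
by rewrite mulrBr mulrA real_rho_sqr; ring.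
Qed.

End theta.

(** * Decay of square summable sequences and sums with a single term *)

Section l2_decay.
Variable R : realType.
Local Notation C := R[i].

(** Along an injective enumeration the summable family becomes a convergent series, whose terms tend
    to 0. *)
Lemma l2_cvg0 (u : int -> C) (e : nat -> int) : injective e -> l2 u ->
  (fun n => sq (u (e n))) @ \oo --> (0 : R).
Proof.
move=> inj_e u2.
have s0 j : (0 <= (normc (u j) ^+ 2)%:E)%E by rewrite lee_fin sqr_ge0.
have sm : summable xpredT (fun n => (normc (u (e n)) ^+ 2)%:E).
  rewrite /summable; apply: le_lt_trans u2; rewrite /summable.
  rewrite -(@esum_image _ _ _ [set` xpredT] e (fun j => `|(normc (u j) ^+ 2)%:E|)%E); last first.
    by move=> x y _ _; exact: inj_e.
  rewrite esum_mkcond; apply: le_esum => j _.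
  by case: ifPn => // _; exact: abse_ge0.
have := summable_cvg (fun n _ => s0 (e n)) sm.
move=> /cvg_series_cvg_0; apply: cvg_trans.
by apply: near_eq_cvg; apply: nearW => n /=; rewrite sq_normc.
Qed.

Lemma esum_single (T : choiceType) (k : T) (a : T -> \bar R) :
  (forall j, 0 <= a j)%E -> (forall j, j != k -> a j = 0%E) ->
  (\esum_(j in [set: T]) a j)%E = a k.
Proof.
move=> a0 ak; rewrite -[RHS](@esum_set1 _ _ k a)// [RHS]esum_mkcond.
apply: eq_esum => j _; case: ifPn => //; rewrite in_set1 => /ak//.
Qed.

Lemma rsum_single (k : int) (f : int -> R) : (forall j, j != k -> f j = 0) -> rsum f = f k.
Proof.
move=> fk; rewrite /rsum !(@esum_single _ k)//.
  by rewrite -[RHS]/(fine (f k)%:E); congr fine; have /(congr1 (@^~ k)) := funeposneg (EFin \o f).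
all: try by move=> j; rewrite ?funenegE ?funeposE le_max lexx orbT.
all: by move=> j /fk; rewrite ?funenegE ?funeposE /= => ->; rewrite ?oppr0 ?oppe0 maxxx.
Qed.

Lemma inner_delta (k : int) (u : int -> C) : l2_inner (@delta R k) u = u k.
Proof.
rewrite /l2_inner /csum !(@rsum_single k).
- by rewrite /delta eqxx; case: (u k) => x y /=; rewrite !(oppr0, mul0r, subr0, addr0, mul1r).
- by move=> j /negbTE jk; rewrite /delta jk ReImE /= oppr0 !mul0r addr0.
- by move=> j /negbTE jk; rewrite /delta jk ReImE /= oppr0 !mul0r subr0.
Qed.

End l2_decay.

(** * From resolvent vectors to Szego solutions, and the gluing inequality *)

Section green_bound.
Variable R : realType.
Local Notation C := R[i].
Implicit Types (w z : C) (r : R).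

Lemma normc_add (x y : C) : normc (x + y) <= normc x + normc y.
Proof. exact: le_normcD. Qed.

Lemma normc_conj (x : C) : normc x^* = normc x.
Proof. by rewrite !normc_sqrt sq_conj. Qed.

Lemma normc_opp (x : C) : normc (- x) = normc x.
Proof. by rewrite !normc_sqrt sqN. Qed.

Lemma normc_real (k : R) : 0 <= k -> normc (k%:C : C) = k.
Proof. by move=> k0; rewrite normc_sqrt sq_real sqrtr_sqr ger0_norm. Qed.

Lemma le_sq_normc (x y : C) : (sq x <= sq y) = (normc x <= normc y).
Proof. by rewrite !normc_sqrt ler_sqrt// sq_ge0. Qed.

Variable alpha : int -> C.
Hypothesis alpha_in_D : forall n : int, normc (alpha n) < 1.
Local Notation a := (fun n : nat => alpha n%:Z).
Local Notation rh := (fun n : nat => rho alpha n%:Z).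

(** The equations relating [u] and [v] carry [w] at even steps only, while every Szego step contains
    it, and the roles of [u] and [v] alternate with the parity. The powers of [w], with exponents
    n/2 rounded down and up, redistribute the spectral parameter. *)
Definition weyl_szego w (u v : nat -> C) : (nat -> C) * (nat -> C) :=
  ((fun n => w ^+ n./2 * (if odd n then v n else u n)),
   (fun n => w ^+ uphalf n * (if odd n then u n else v n))).

Lemma weyl_szegoP w (u v : nat -> C) :
  (forall n, ~~ odd n ->
    w * u n = (a n)^* * v n + (rh n)%:C * v n.+1 /\
    w * u n.+1 = (rh n)%:C * v n - a n * v n.+1) ->
  (forall n, odd n ->
    v n = (a n)^* * u n + (rh n)%:C * u n.+1 /\
    v n.+1 = (rh n)%:C * u n - a n * u n.+1) ->
  szego a rh w (weyl_szego w u v).1 (weyl_szego w u v).2.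
Proof.
move=> he ho n; rewrite /weyl_szego /=.
rewrite exprS uphalf_half.
have [odn|evn] /= := boolP (odd n).
  have [h1 h2] := ho n odn.
  have [h3 h4] := theta_invert alpha_in_D h1 h2.
  rewrite add1n exprS; move: (w ^+ n./2) => W.
  by rewrite !(mulrCA (rho alpha n)%:C (w * W)) h3 h4; split; ring.
have [h1 h2] := he n evn.
have [h3 h4] := theta_invert alpha_in_D h1 h2.
rewrite add0n; move: (w ^+ n./2) => W.
rewrite (mulrCA (rho alpha n)%:C W) h3 [w * W]mulrC -[W * w * _]mulrA.
by rewrite (mulrCA (rho alpha n)%:C W) h4; split; ring.
Qed.

Lemma weyl_szego_cvg w (u v : nat -> C) : sq w <= 1 ->
  (fun n => sq (u n) + sq (v n)) @ \oo --> (0 : R) ->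
  (fun n => sq ((weyl_szego w u v).1 n) + sq ((weyl_szego w u v).2 n)) @ \oo --> (0 : R).
Proof.
move=> w1; apply: squeeze_cvgr (cvg_cst 0).
apply: nearW => n /=; rewrite addr_ge0 ?sq_ge0//=.
have wn k : sq (w ^+ k) <= 1.
  elim: k => [|k IH]; first by rewrite expr0 sqE /= expr0n /= addr0 expr1n.
  by rewrite exprS sqM mulr_ile1 ?sq_ge0.
have le k x : sq (w ^+ k * x) <= sq x by rewrite sqM ler_piMl ?sq_ge0.
by case: ifP => _; [rewrite [leRHS]addrC|]; rewrite lerD.
Qed.

(** The odd blocks preserve the norm on the pairs (-2n-1, -2n), the even blocks do so up to |w|^2 on
    the pairs (-2n-2, -2n-1). Hence |v|^2 - |u|^2 at -2n does not increase with n. It is at least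
    -|u|^2, which tends to 0, so its value at n = 0 is nonnegative. *)
Lemma left_energy w (u v : int -> C) : sq w <= 1 ->
  (forall n : nat, sq (v (- (2 * n + 1)%N%:Z)) + sq (v (- (2 * n)%N%:Z)) =
    sq (u (- (2 * n + 1)%N%:Z)) + sq (u (- (2 * n)%N%:Z))) ->
  (forall n : nat, sq w * (sq (u (- (2 * n + 2)%N%:Z)) + sq (u (- (2 * n + 1)%N%:Z))) =
    sq (v (- (2 * n + 2)%N%:Z)) + sq (v (- (2 * n + 1)%N%:Z))) ->
  (fun n : nat => sq (u (- (2 * n)%N%:Z))) @ \oo --> (0 : R) ->
  sq (u 0) <= sq (v 0).
Proof.
move=> w1 hB hA cv.
pose e n := sq (v (- (2 * n)%N%:Z)) - sq (u (- (2 * n)%N%:Z)).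
have eS n : e n.+1 <= e n.
  rewrite /e (_ : (2 * n.+1 = 2 * n + 2)%N); last lia.
  have := hB n; have := hA n; have := sq_ge0 (u (- (2 * n + 2)%N%:Z)).
  have := sq_ge0 (u (- (2 * n + 1)%N%:Z)); move: w1; nra.
have e_dec n : e n <= e 0%N by elim: n => [//|n IH]; exact: le_trans IH.
have : 0 <= e 0%N; last by rewrite /e muln0 oppr0 subr_ge0.
rewrite leNgt; apply/negP => e0.
have e0' : 0 < - e 0%N by rewrite oppr_gt0.
move/cvgrPdist_lt : cv => /(_ _ e0') [N _ /(_ N (leqnn N))] /=.
rewrite sub0r normrN ger0_norm ?sq_ge0//.
by have := e_dec N; have := sq_ge0 (v (- (2 * N)%N%:Z)); rewrite {1}/e; lra.
Qed.

(** The right half gives |v + j2| <= (1 - k/2) |u + j1| and the left half |u| <= |v|. Chained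
    through the two jumps, they yield |u + j1| <= (1 - k/2) |u + j1| + 2 J. *)
Lemma gluing_bound (u v j1 j2 : C) (k J : R) : 0 < k ->
  sq u <= sq v -> k * sq (u + j1) <= sq (u + j1) - sq (v + j2) ->
  normc j1 <= J -> normc j2 <= J -> normc (u + j1) <= 4 * J / k.
Proof.
move=> k0; rewrite le_sq_normc => uv hk h1 h2.
have := sq_ge0 (v + j2).
have := normc_ge0 (u + j1); rewrite le_eqVlt => /orP[/eqP <-|n0] vj.
  by rewrite divr_ge0 ?(ltW k0)// mulr_ge0// (le_trans (normc_ge0 j1)).
have k1 : k <= 1.
  have : 0 < sq (u + j1) by rewrite -sq_normc exprn_gt0.
  nra.
have : normc (v + j2) <= (1 - k / 2) * normc (u + j1).
  rewrite -(@ler_pXn2r _ 2) ?nnegrE ?normc_ge0// ?mulr_ge0 ?normc_ge0//; last by lra.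
  rewrite exprMn !sq_normc; have := sq_ge0 (u + j1); nra.
have := normc_add u j1; have := normc_add (v + j2) (- j2); rewrite addrK normc_opp.
rewrite ler_pdivlMr//; move: uv h1 h2; lra.
Qed.

End green_bound.

(** * Bounds for G_00 and G_11 *)

Section green_power_bound.
Variable R : realType.
Local Notation C := R[i].
Local Notation normcM := ComplexField.Normc.normcM.
Variable alpha : int -> C.
Hypothesis alpha_in_D : forall n : int, normc (alpha n) < 1.
Local Notation a := (fun n : nat => alpha n%:Z).
Local Notation rh := (fun n : nat => rho alpha n%:Z).

Lemma theta_sq_le b (u : int -> C) j :
  sq (theta b alpha u j) <= sq (u (j - 1)) + sq (u j) + sq (u (j + 1)).
Proof.
have [jb|jb] := eqVneq (odd `|j|%N) b.
  have h := theta_isometry alpha_in_D u jb.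
  apply: le_trans (_ : sq (u j) + sq (u (j + 1)) <= _); first by rewrite -h lerDl sq_ge0.
  by rewrite -addrA lerDr sq_ge0.
have jb' : odd `|(j - 1)%R|%N = b by rewrite odd_absz_sub1; move: jb; case: (odd _); case: b.
have h := theta_isometry alpha_in_D u jb'; rewrite subrK in h.
apply: le_trans (_ : sq (u (j - 1)) + sq (u j) <= _); first by rewrite -h lerDr sq_ge0.
by rewrite lerDl sq_ge0.
Qed.

(* [psi] is the resolvent applied to [delta 0] or [delta 1]. Its left half solves the
   homogeneous equation, and so does its right half once [(u, v)] at [0] is corrected by
   [(j1, j2)]. *)
Lemma resolvent_gluing w (psi f : int -> C) (j1 j2 : C) :
  w != 0 -> sq w < 1 -> l2 psi -> (forall j, cmv alpha psi j - w * psi j = f j) ->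
  (forall j, j != 0 -> j != 1 -> f j = 0) ->
  w * j1 + f 0 * -1 = (alpha 0)^* * j2 -> (rho alpha 0)%:C * j2 = - f 1 ->
  let v := theta true alpha psi in
  exists P Q, [/\ szego a rh w P Q, (fun n => sq (P n) + sq (Q n)) @ \oo --> (0 : R),
    P 0%N = psi 0 + j1, Q 0%N = v 0 + j2 & sq (psi 0) <= sq (v 0)] /\
    (rho alpha 0)%:C * (w * psi 1) = (v 0 + j2) - alpha 0 * (w * (psi 0 + j1)).
Proof.
move=> w0 w1 psi2 eqn f0 hj1 hj2 v.
have Av j : theta false alpha v j = w * psi j + f j by rewrite -eqn -cmv_theta addrC subrK.
have cvp (e : nat -> int) : injective e -> (fun n => sq (psi (e n))) @ \oo --> (0 : R).
  by move=> /l2_cvg0; apply.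
have cv_pos : (fun n : nat => sq (psi n%:Z) + sq (v n%:Z)) @ \oo --> (0 : R).
  have z : (fun n : nat => sq (psi n%:Z) + (sq (psi (n%:Z - 1)) + sq (psi n%:Z) + sq (psi (n%:Z + 1))))
      @ \oo --> (0 + (0 + 0 + 0) : R).
    by repeat apply: cvgD; apply: cvp => x y; lia.
  rewrite !addr0 in z; apply: squeeze_cvgr (cvg_cst 0) z.
  apply: nearW => n; rewrite addr_ge0 ?sq_ge0//= lerD//.
  exact: theta_sq_le.
(* The source sits in the even block on (0, 1). Changing the values at 0 alone absorbs it: the
   hypotheses on [j1] and [j2] say that the new values satisfy the homogeneous equations of this
   block. *)
pose u' n : C := if n is 0%N then psi 0 + j1 else psi n%:Z.
pose v' n : C := if n is 0%N then v 0 + j2 else v n%:Z.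
have A0 : (alpha 0)^* * v 0 + (rho alpha 0)%:C * v 1 = w * psi 0 + f 0.
  by rewrite -Av theta_fst.
have A1 : (rho alpha 0)%:C * v 0 - alpha 0 * v 1 = w * psi 1 + f 1.
  by rewrite -Av -[1]add0r theta_snd.
have E1 : w * psi 1 = (rho alpha 0)%:C * (v 0 + j2) - alpha 0 * v 1.
  by rewrite mulrDr hj2 addrAC A1 addrK.
have even_eq n : ~~ odd n ->
    w * u' n = (a n)^* * v' n + (rh n)%:C * v' n.+1 /\
    w * u' n.+1 = (rh n)%:C * v' n - a n * v' n.+1.
  case: n => [_|n evn].
    split=> /=; last exact: E1.
    change (w * (psi 0 + j1) = (alpha 0)^* * (v 0 + j2) + (rho alpha 0)%:C * v 1).
    by rewrite [in RHS]mulrDr [RHS]addrAC A0 -hj1; ring.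
  have fE k : (0 < k)%N -> (1 < k)%N -> f k%:Z = 0 by move=> k0 k1; apply: f0; lia.
  have n1 : (0 < n)%N by case: (n) evn.
  have nE : (n.+2%:Z : int) = n.+1%:Z + 1 by rewrite -addn1 PoszD.
  rewrite /u' /v' !nE; split.
    rewrite -(@theta_fst _ false); last by rewrite absz_nat; exact/negbTE.
    by rewrite Av fE ?addr0.
  rewrite -(@theta_snd _ false); last by rewrite absz_nat; exact/negbTE.
  by rewrite Av -nE fE ?addr0.
have odd_eq n : odd n ->
    v' n = (a n)^* * u' n + (rh n)%:C * u' n.+1 /\
    v' n.+1 = (rh n)%:C * u' n - a n * u' n.+1.
  case: n => // n odn.
  have nE : (n.+2%:Z : int) = n.+1%:Z + 1 by rewrite -addn1 PoszD.
  by rewrite /u' /v' !nE /v theta_fst ?theta_snd.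
(* The same block, solved for [psi 1], gives access to G_11 from the corrected values at 0. *)
have [h1 h2] := even_eq 0%N isT.
exists (weyl_szego w u' v').1, (weyl_szego w u' v').2; split; last first.
  by have [_] := theta_invert alpha_in_D h1 h2.
split.
- exact: weyl_szegoP.
- apply: weyl_szego_cvg; first exact: ltW.
  rewrite -(cvg_shiftn 1); rewrite -(cvg_shiftn 1) in cv_pos.
  by apply: cvg_trans cv_pos; apply: near_eq_cvg; apply: nearW => n; rewrite /= !addn1.
- by rewrite /= mul1r.
- by rewrite /= mul1r.
apply: (@left_energy R w psi v); first exact: ltW.
- move=> n.
  have -> : - (2 * n)%N%:Z = - (2 * n + 1)%N%:Z + 1 by lia.
  by apply: (theta_isometry alpha_in_D); lia.
- move=> n.
  have -> : - (2 * n + 1)%N%:Z = - (2 * n + 2)%N%:Z + 1 by lia.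
  rewrite -(@theta_isometry _ alpha alpha_in_D false v); last by lia.
  rewrite !Av !f0 ?addr0 ?sqM ?mulrDr//; lia.
- by apply: cvp => x y; lia.
Qed.

Lemma green_delta (k : int) w : green alpha k k w = resolvent alpha w (@delta R k) k.
Proof. exact: inner_delta. Qed.

(** For the default value 0 of [xget] the Green function is 0, so both alternatives are compatible
    with an upper bound. *)
Lemma resolvent_cases w phi :
  resolvent alpha w phi = (fun=> 0) \/ (l2 (resolvent alpha w phi) /\
    forall j, cmv alpha (resolvent alpha w phi) j - w * resolvent alpha w phi j = phi j).
Proof. by rewrite /resolvent; case: xgetP => [x _ h|_]; [right|left]. Qed.

(** For [delta 0] the jump [j2] is 0, so [psi 0] is bounded by the uncorrected [v 0]. For [delta 1],
    [psi 1] is read off from the block on (0, 1), at the price of a factor 1 / rho(0). The common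
    bound J = 2 / rho(0) on the jumps comes from |w^-1| <= 2. *)
Lemma green_power_bound (C1 C2 g1 g2 L0 : R) :
  0 < C1 -> 0 < C2 -> 0 < g1 -> 0 < g2 -> 0 < L0 ->
  exists C4 : R, 0 < C4 /\ forall (z : C) (r : R), sq z = 1 ->
    power_law_bounds alpha z C1 C2 g1 g2 L0 -> 9 / 10 < r -> r < 1 ->
    normc (green alpha 0 0 (r%:C * z)) <= C4 * (1 - r) `^ (2 * g1 / (g1 + g2) - 1) /\
    normc (green alpha 1 1 (r%:C * z)) <= C4 * (1 - r) `^ (2 * g1 / (g1 + g2) - 1).
Proof.
move=> C10 C20 g10 g20 L00.
have [c c0 hc] := half_line_bound alpha_in_D C10 C20 g10 g20 L00.
set beta := 2 * g1 / (g1 + g2) in hc *.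
have rho0 := rho_gt0 alpha_in_D 0.
have rho1 : rho alpha 0 <= 1.
  rewrite -(@ler_pXn2r _ 2) ?nnegrE ?(ltW rho0)// rho_sqr// expr1n.
  by rewrite gerBl sq_ge0.
pose J := 2 / rho alpha 0.
have J2 : 2 <= J by rewrite ler_pdivlMr//; nra.
have J0 : 0 < J by exact: lt_le_trans J2.
exists (8 * J * (4 * J / c)); split; first by rewrite !mulr_gt0 ?invr_gt0.
move=> z r z1 pl r9 r1.
have r0 : 0 < r by lra.
set w := r%:C * z.
have nw : normc w = r.
  by rewrite normcM normc_real ?(ltW r0)// normc_sqrt z1 sqrtr1 mulr1.
have w0 : w != 0 by apply/eqP => w0; move: nw; rewrite w0 ComplexField.Normc.normc0; lra.
have w1 : sq w < 1 by rewrite -sq_normc nw expr_lt1 ?(ltW r0).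
have d0 : 0 < 1 - r by rewrite subr_gt0.
pose k := c * (1 - r) `^ (1 - beta).
have k0 : 0 < k by rewrite mulr_gt0 ?powR_gt0.
have kV : c^-1 * (1 - r) `^ (beta - 1) = k^-1.
  by rewrite /k invfM -powRN opprB.
have -> : 8 * J * (4 * J / c) * (1 - r) `^ (beta - 1) = 8 * J * (4 * J / k) .
  by rewrite -kV; ring.
have rn0 : (rho alpha 0)%:C != 0 :> C by rewrite eq_complex /= eqxx andbT gt_eqF.
have b0 : 0 <= 4 * J / k by apply: divr_ge0; [apply: mulr_ge0|]; rewrite ?ltW.
have wi2 : normc w^-1 <= 2.
  rewrite ComplexField.Normc.normcV nw invf_ple ?posrE//; lra.
have rVE : normc ((rho alpha 0)^-1)%:C = (rho alpha 0)^-1 :> R.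
  by rewrite normc_real// invr_ge0 ltW.
have glue (psi f : int -> C) (j1 j2 : C) :
    l2 psi -> (forall j, cmv alpha psi j - w * psi j = f j) ->
    (forall j, j != 0 -> j != 1 -> f j = 0) ->
    w * j1 + f 0 * -1 = (alpha 0)^* * j2 -> (rho alpha 0)%:C * j2 = - f 1 ->
    normc j1 <= J -> normc j2 <= J ->
    let v0 := theta true alpha psi 0 in
    [/\ normc (psi 0 + j1) <= 4 * J / k, normc (v0 + j2) <= 4 * J / k,
     normc (psi 0) <= normc v0 & normc (psi 1) <= 8 * J * (4 * J / k)].
  move=> psi2 eqn f0 hj1 hj2 bj1 bj2 v0.
  have [P [Q [[h1 h2 h3 h4 h5] h6]]] := resolvent_gluing w0 w1 psi2 eqn f0 hj1 hj2.
  have := hc _ _ _ _ z1 pl r0 r1 h1 h2; rewrite h3 h4 -/k => hk.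
  have b1 := gluing_bound k0 h5 hk bj1 bj2.
  have b2 : normc (v0 + j2) <= 4 * J / k.
    apply: le_trans b1; rewrite -le_sq_normc -subr_ge0; apply: le_trans hk.
    by rewrite mulr_ge0 ?sq_ge0 ?ltW.
  split=> //; first by rewrite -le_sq_normc.
  have psi1E : psi 1 = w^-1 * ((rho alpha 0)^-1)%:C * ((v0 + j2) - alpha 0 * (w * (psi 0 + j1))).
    apply: (mulfI w0); rewrite !mulrA divff// mul1r.
    by apply: (mulfI rn0); rewrite h6 !mulrA -rmorphM divff ?gt_eqF// mul1r.
  rewrite psi1E normcM normcM rVE.
  have aw : normc (alpha 0 * (w * (psi 0 + j1))) <= 4 * J / k.
    rewrite normcM (normcM w) nw mulrA; apply: le_trans b1; rewrite ler_piMl ?normc_ge0//.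
    by rewrite mulr_ile1 ?normc_ge0 ?ltW//.
  have := normc_add (v0 + j2) (- (alpha 0 * (w * (psi 0 + j1)))); rewrite normc_opp => tri.
  have e1 : normc (v0 + j2 - alpha 0 * (w * (psi 0 + j1))) <= 2 * (4 * J / k) by lra.
  have e2 : normc w^-1 * (rho alpha 0)^-1 <= J.
    by rewrite ler_wpM2r ?invr_ge0 ?(ltW rho0).
  apply: le_trans (_ : J * (2 * (4 * J / k)) <= _).
    by rewrite ler_pM ?mulr_ge0 ?normc_ge0 ?invr_ge0 ?(ltW rho0).
  by move: b0 J0; nra.
have bb : 0 <= 8 * J * (4 * J / k) by apply: mulr_ge0 => //; rewrite mulr_ge0// ltW.
rewrite !green_delta; split.
  case: (resolvent_cases w (@delta R 0)) => [->|[psi2 eqn]].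
    by rewrite ComplexField.Normc.normc0.
  have [|||||b1 b2 b3 _] := glue _ _ w^-1 0 psi2 eqn.
  - by move=> j /negbTE j0 _; rewrite /delta j0.
  - by rewrite /delta /= mulr1n mulr0 divff// mul1r subrr.
  - by rewrite /delta /= mulr0 oppr0.
  - by apply: le_trans J2.
  - by rewrite ComplexField.Normc.normc0 ltW.
  apply: (le_trans b3); rewrite addr0 in b2; apply: (le_trans b2).
  by move: b0 J2; nra.
case: (resolvent_cases w (@delta R 1)) => [->|[psi2 eqn]].
  by rewrite ComplexField.Normc.normc0.
have [|||||_ _ _ //] := glue _ _ (- (w^-1 * ((alpha 0)^* * ((rho alpha 0)^-1)%:C)))
  (- ((rho alpha 0)^-1)%:C) psi2 eqn.
- by move=> j _ /negbTE j0; rewrite /delta j0.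
- by rewrite /delta /= mul0r addr0 mulrN mulVKf// mulrN.
- by rewrite /delta /= mulr1n mulrN -rmorphM divff ?gt_eqF.
- rewrite normc_opp !normcM normc_conj rVE mulrA ler_wpM2r ?invr_ge0 ?(ltW rho0)//.
  rewrite -[leRHS]mulr1 ler_pM ?normc_ge0//; exact: ltW.
- rewrite normc_opp rVE ler_peMl ?invr_ge0 ?(ltW rho0)//; lra.
Qed.

End green_power_bound.

(** * Bounded Borel functions on the circle *)

Section circle_functions.
Variable R : realType.
Local Notation C := R[i].
Local Notation Re := complex.Re.
Local Notation Im := complex.Im.

Lemma Re_continuous : continuous (fun z : C^o => Re z : R).
Proof.
move=> z A /nbhs_ballP [e e0 eA].
have e0' : (0 : C) < e%:C by rewrite ltcR.
apply: filterS (@nbhsx_ballx _ (C^o) z _ e0') => t.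
rewrite -ball_normE /= => bt.
apply: eA; rewrite -ball_normE /= -Re_opp -Re_add.
by rewrite -ltcR; apply: le_lt_trans bt; exact: normc_ge_Re.
Qed.

Lemma Im_continuous : continuous (fun z : C^o => Im z : R).
Proof.
move=> z A /nbhs_ballP [e e0 eA].
have e0' : (0 : C) < e%:C by rewrite ltcR.
apply: filterS (@nbhsx_ballx _ (C^o) z _ e0') => t.
rewrite -ball_normE /= => bt.
apply: eA; rewrite -ball_normE /= -Im_opp -Im_add.
rewrite -ltcR; apply: le_lt_trans bt; have := normc_ge_Re ('i * (z - t)).
rewrite normrM; have -> : `|'i : C| = 1.
  by rewrite normc_def /= expr0n expr1n /= add0r sqrtr1.
by rewrite mul1r Re_mul /= mul0r sub0r mul1r normrN.
Qed.

Lemma continuous_circle_measurable (f : circle R -> R) :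
  continuous f -> measurable_fun setT f.
Proof.
move=> cf; apply: (measurability _ (measurable_realfun.RGenOpens.measurableE R)).
move=> _ [_ [a [b ->] <-]].
rewrite setTI; apply: sub_sigma_algebra.
by apply: open_comp => //; exact: interval_open.
Qed.

(** A class stable under sums and products, whose members are integrable for every finite
    measure. *)
Definition bmeas (f : circle R -> R) :=
  measurable_fun setT f /\ exists M, forall x, `|f x| <= M.

Lemma bmeas_cst k : bmeas (fun=> k).
Proof. by split; [exact: measurable_cst|exists `|k|]. Qed.

Lemma bmeasD f g : bmeas f -> bmeas g -> bmeas (fun x => f x + g x).
Proof.
move=> [mf [M hM]] [mg [N hN]]; split; first exact: measurable_funD.
by exists (M + N) => x; apply: le_trans (ler_normD _ _) _; exact: lerD.
Qed.

Lemma bmeasM f g : bmeas f -> bmeas g -> bmeas (fun x => f x * g x).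
Proof.
move=> [mf [M hM]] [mg [N hN]]; split; first exact: measurable_funM.
by exists (M * N) => x; rewrite normrM ler_pM.
Qed.

Lemma bmeasN f : bmeas f -> bmeas (fun x => - f x).
Proof.
move=> [mf [M hM]]; split; first exact: measurable_funN.
by exists M => x; rewrite normrN.
Qed.

Definition cbmeas (f : circle R -> C) :=
  bmeas (fun x => Re (f x)) /\ bmeas (fun x => Im (f x)).

Lemma cbmeas_cst c : cbmeas (fun=> c).
Proof. by split; exact: bmeas_cst. Qed.

Lemma eq_bmeas f g : f =1 g -> bmeas f -> bmeas g.
Proof. by move=> /funext ->. Qed.

Lemma cbmeasD f g : cbmeas f -> cbmeas g -> cbmeas (fun x => f x + g x).
Proof.
move=> [f1 f2] [g1 g2]; split.
- by apply: eq_bmeas (bmeasD f1 g1) => x; rewrite Re_add.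
- by apply: eq_bmeas (bmeasD f2 g2) => x; rewrite Im_add.
Qed.

Lemma cbmeasM f g : cbmeas f -> cbmeas g -> cbmeas (fun x => f x * g x).
Proof.
move=> [f1 f2] [g1 g2]; split.
- apply: eq_bmeas (bmeasD (bmeasM f1 g1) (bmeasN (bmeasM f2 g2))) => x.
  by rewrite Re_mul.
- by apply: eq_bmeas (bmeasD (bmeasM f1 g2) (bmeasM f2 g1)) => x; rewrite Im_mul.
Qed.

Lemma cbmeas_conj f : cbmeas f -> cbmeas (fun x => (f x)^*).
Proof.
move=> [f1 f2]; split; first by apply: eq_bmeas f1 => x; rewrite Re_conjc.
by apply: eq_bmeas (bmeasN f2) => x; rewrite Im_conjc.
Qed.

Lemma cbmeas_sq f : cbmeas f -> bmeas (fun x => sq (f x)).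
Proof.
move=> [f1 f2]; apply: eq_bmeas (bmeasD (bmeasM f1 f1) (bmeasM f2 f2)) => x.
by rewrite sqE !expr2.
Qed.

Lemma normc_cval (x : circle R) : normc (cval x) = 1.
Proof. by have := set_valP x. Qed.

Lemma sq_cval (x : circle R) : sq (cval x) = 1.
Proof. by rewrite -sq_normc normc_cval expr1n. Qed.

Lemma cbmeas_cval : cbmeas (@cval R).
Proof.
have bnd (a b : R) : a ^+ 2 + b ^+ 2 = 1 -> `|a| <= 1 /\ `|b| <= 1.
  move=> h; rewrite -[`|a| <= 1](@ler_pXn2r _ 2)// ?nnegrE// -[`|b| <= 1](@ler_pXn2r _ 2)// ?nnegrE//.
  rewrite !real_normK ?num_real// expr1n -h.
  by rewrite lerDl lerDr !sqr_ge0.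
split; split.
- apply: continuous_circle_measurable => x.
  apply: (@continuous_comp _ _ _ (fun z : circle R => (cval z : C^o)) (fun z : C^o => Re z)).
    exact: initial_continuous.
  exact: Re_continuous.
- by exists 1 => x; have := sq_cval x; rewrite sqE => /bnd [].
- apply: continuous_circle_measurable => x.
  apply: (@continuous_comp _ _ _ (fun z : circle R => (cval z : C^o)) (fun z : C^o => Im z)).
    exact: initial_continuous.
  exact: Im_continuous.
- by exists 1 => x; have := sq_cval x; rewrite sqE => /bnd [].
Qed.

Lemma sq_cval_sub_ge (x : circle R) (w : C) : (1 - normc w) ^+ 2 <= sq (cval x - w).
Proof.
have h1 := normc_add (cval x - w) w; have h2 := normc_add (w - cval x) (cval x).
rewrite subrK normc_cval in h1; rewrite subrK normc_cval -opprB normc_opp in h2.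
rewrite -sq_normc -subr_ge0 subr_sqr mulr_ge0//; lra.
Qed.

Lemma sq_cval_sub_gt0 (x : circle R) (w : C) : normc w != 1 -> 0 < sq (cval x - w).
Proof.
by move=> w1; apply: lt_le_trans (sq_cval_sub_ge x w); rewrite exprn_even_gt0//= subr_eq0 eq_sym.
Qed.

Lemma bmeas_inv_sq (w : C) : normc w != 1 -> bmeas (fun x => (sq (cval x - w))^-1).
Proof.
move=> w1.
have b : bmeas (fun x => sq (cval x - w)).
  by apply: cbmeas_sq; apply: cbmeasD; [exact: cbmeas_cval|exact: cbmeas_cst].
have d0 : 0 < (1 - normc w) ^+ 2 by rewrite exprn_even_gt0//= subr_eq0 eq_sym.
split.
  have -> : (fun x => (sq (cval x - w))^-1) = (fun x => sq (cval x - w) `^ (-1)).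
    by apply/funext => x; rewrite powR_inv1// sq_ge0.
  exact: (measurableT_comp (measurable_powR (-1)) b.1).
exists ((1 - normc w) ^+ 2)^-1 => x.
rewrite ger0_norm ?invr_ge0 ?sq_ge0// lef_pV2 ?posrE ?sq_cval_sub_gt0//.
exact: sq_cval_sub_ge.
Qed.

Lemma inv_conj_sq (x : C) : x^-1 = ((sq x)^-1)%:C * x^*.
Proof.
have [->|x0] := eqVneq x 0; first by rewrite invr0 sq0 invr0 mul0r.
apply: (mulfI x0); rewrite divff// mulrCA mulc_conj -rmorphM mulVf//.
by apply: contra_neq x0; exact: sq_eq0.
Qed.

(** Writing an inverse as the conjugate over the squared modulus leaves one real inverse, which is
    bounded because |x - w| >= |1 - |w||. *)
Lemma cbmeas_cauchy (w : C) : normc w != 1 -> cbmeas (fun x => (cval x - w)^-1).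
Proof.
move=> w1.
have b : cbmeas (fun x => ((sq (cval x - w))^-1)%:C * (cval x - w)^*).
  apply: cbmeasM; first by split; [exact: bmeas_inv_sq|exact: bmeas_cst].
  apply: cbmeas_conj.
  by apply: cbmeasD; [exact: cbmeas_cval|exact: cbmeas_cst].
by split; [apply: eq_bmeas b.1|apply: eq_bmeas b.2] => x; rewrite inv_conj_sq.
Qed.

Section integral.
Variable mu : {finite_measure set (circle R) -> \bar R}.
Local Notation I f := (\int[mu]_x (f x)).

Lemma finite_measure_ltoo (A : set (circle R)) : measurable A -> (mu A < +oo)%E.
Proof. by move=> mA; rewrite -ge0_fin_numE ?fin_num_measure. Qed.

Lemma bmeas_integrable f : bmeas f -> mu.-integrable setT (EFin \o f).
Proof.
move=> [mf [M hM]]; apply: measurable_bounded_integrable => //.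
  exact: finite_measure_ltoo.
exists M; split=> [|y My x _ /=]; first exact: num_real.
exact: le_trans (hM x) (ltW My).
Qed.

Lemma integD f g : bmeas f -> bmeas g -> I (fun x => f x + g x) = I f + I g.
Proof. by move=> bf bg; rewrite RintegralD//; exact: bmeas_integrable. Qed.

Lemma integZ k f : bmeas f -> I (fun x => k * f x) = k * I f.
Proof. by move=> bf; rewrite RintegralZl//; exact: bmeas_integrable. Qed.

Lemma le_integ f g : bmeas f -> bmeas g -> (forall x, f x <= g x) -> I f <= I g.
Proof. by move=> bf bg fg; apply: le_Rintegral => //; exact: bmeas_integrable. Qed.

Lemma integ_cst k : I (fun=> k) = k * fine (mu setT).
Proof. by rewrite Rintegral_cst. Qed.

(** Markov's inequality, from [k * \1_U <= f]. *)
Lemma measure_le_integ k f (U : set (circle R)) : 0 <= k -> measurable U -> bmeas f ->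
  (forall x, 0 <= f x) -> (forall x, U x -> k <= f x) -> k * fine (mu U) <= I f.
Proof.
move=> k0 mU bf f0 kf.
have bU : bmeas (\1_U : _ -> R).
  split; first exact: measurable_indic.
  by exists 1 => x; rewrite indicE; case: (_ \in _); rewrite ?normr1 ?normr0.
have -> : fine (mu U) = I (\1_U : _ -> R).
  by rewrite /Rintegral integral_indic// setIT.
rewrite -integZ//; apply: le_integ => // [|x]; first exact: bmeasM (bmeas_cst _) bU.
rewrite indicE; have [Ux|Ux] := boolP (x \in U); last by rewrite mulr0.
by rewrite mulr1; apply: kf; exact: set_mem.
Qed.

End integral.
End circle_functions.

(** * Arcs, the Poisson kernel and the order of the exponents *)

Section arcs.
Variable R : realType.
Local Notation C := R[i].
Local Notation Re := complex.Re.
Local Notation Im := complex.Im.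

Lemma cisD (s t : R) : cis (s + t) = cis s * cis t.
Proof.
apply/eqP; rewrite eq_complex Re_mul Im_mul /= cosD sinD.
by rewrite eqxx /= addrC [sin s * _]mulrC.
Qed.

Lemma exists_arg (y : C) : sq y = 1 -> exists2 s, y = cis s & `|s| <= pi /\ cos `|s| = Re y.
Proof.
rewrite sqE; case: y => a b /= h.
have a1 : -1 <= a <= 1 by have := sqr_ge0 b; have := sqr_ge0 (a - 1); have := sqr_ge0 (a + 1); nra.
have [|p q] := @acos_def R a; first exact: a1.
have p0 : 0 <= acos a by case/andP: p.
have s0 : sin (acos a) = `|b|.
  by rewrite sin_acos// -sqrtr_sqr; congr Num.sqrt; rewrite -h addrC addKr.
have [b0|b0] := leP 0 b.
  exists (acos a); first by rewrite /cis q s0 ger0_norm.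
  by rewrite ger0_norm// q; case/andP: p.
exists (- acos a); first by rewrite /cis cosN sinN q s0 ltr0_norm// opprK.
by rewrite normrN ger0_norm// q; case/andP: p.
Qed.

Lemma conj_mul_cval (z : circle R) : (cval z)^* * cval z = 1.
Proof. by rewrite mulrC mulc_conj sq_cval. Qed.

Lemma Re_conj_mul_cis (s t : R) : Re ((cis s)^* * cis t) = cos (t - s).
Proof. by rewrite Re_mul /= cosB mulNr opprK [cos t * _]mulrC [sin t * _]mulrC. Qed.

(** The cosine decreases on [0, pi], so a bound on the angle becomes a lower bound on its cosine.
    This form does not mention arguments and shows that the arc is Borel. *)
Lemma closed_arcE (z : circle R) (eps : R) : 0 <= eps <= pi ->
  closed_arc z eps = [set x | cos eps <= Re ((cval z)^* * cval x)].
Proof.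
move=> /andP[e0 epi]; apply/seteqP; split => x /=.
  move=> [T [t [-> -> tT]]]; rewrite Re_conj_mul_cis -[leRHS]cos_norm.
  move: tT; rewrite le_eqVlt => /orP[/eqP -> //|tT].
  by apply: ltW; rewrite ltr_cos// in_itv /= ?e0 ?epi// normr_ge0 ltW// (lt_le_trans tT).
move=> h; have [T zT _] := exists_arg (sq_cval z).
have [|s ys [spi cs]] := @exists_arg ((cval z)^* * cval x).
  by rewrite sqM sq_conj !sq_cval mulr1.
exists T, (T + s); split => //.
  by rewrite cisD -zT -ys mulrA [_ * _^*]mulrC conj_mul_cval mul1r.
rewrite addrAC subrr add0r leNgt; apply/negP => es.
by move: h; rewrite -cs leNgt ltr_cos ?es// in_itv /= ?e0 ?epi ?spi ?normr_ge0.
Qed.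

Lemma closed_arc_measurable (z : circle R) (eps : R) : 0 <= eps <= pi ->
  measurable (closed_arc z eps).
Proof.
move=> he; rewrite closed_arcE//.
have m : measurable_fun setT (fun x : circle R => Re ((cval z)^* * cval x)).
  by have [[]] := cbmeasM (cbmeas_cst ((cval z)^*)) (cbmeas_cval R).
have := m measurableT _ (measurable_itv `[cos eps, +oo[); rewrite setTI.
by congr (measurable _); apply/seteqP; split => x /=; rewrite in_itv /= andbT.
Qed.

Lemma norm_sin_le (x : R) : `|sin x| <= `|x|.
Proof.
wlog x0 : x / 0 < x.
  move=> h; have [x0|x0|->] := ltrgt0P x.
  - by have := h x x0; rewrite [in leRHS]ger0_norm// ltW.
  - by have := h (- x); rewrite sinN !normrN oppr_gt0 => /(_ x0); rewrite [in leRHS]ltr0_norm.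
  - by rewrite sin0 normr0.
have [c _ ] := @MVT R sin cos 0 x x0 (fun y _ => is_derive_sin y)
  (continuous_subspaceT (@continuous_sin R)).
by rewrite sin0 !subr0 => ->; rewrite normrM ler_piMl// cos_max.
Qed.

(** The chord has length 2 |sin ((t - T) / 2)|, and |sin y| <= |y|. *)
Lemma closed_arc_chord (z x : circle R) (eps : R) :
  closed_arc z eps x -> sq (cval x - cval z) <= eps ^+ 2.
Proof.
move=> [T [t [zT xt tT]]].
have -> : sq (cval x - cval z) = (2 * sin ((t - T) / 2)) ^+ 2.
  have h : cos (t - T) = 1 - 2 * sin ((t - T) / 2) ^+ 2.
    rewrite [in LHS](_ : t - T = ((t - T) / 2) *+ 2).
      by rewrite cos_mulr2n cos2sin2 -mulr_natl; ring.
    by rewrite -mulr_natr divfK.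
  rewrite exprMn xt zT; have -> : 2 ^+ 2 * sin ((t - T) / 2) ^+ 2 = 2 * (1 - cos (t - T)).
    by rewrite h; ring.
  rewrite cosB; have := cos2Dsin2 t; have := cos2Dsin2 T; rewrite sqE /=.
  move: (cos t) (sin t) (cos T) (sin T) => a b c d h1 h2.
  by rewrite [RHS](_ : _ = (a ^+ 2 + b ^+ 2) + (c ^+ 2 + d ^+ 2) - 2 * (a * c + b * d)); [ring|rewrite h1 h2; ring].
have := norm_sin_le ((t - T) / 2); rewrite normrM [`|_^-1|]ger0_norm// => h.
rewrite -[leLHS]real_normK ?num_real// ler_pXn2r ?nnegrE//; last exact: le_trans tT.
by rewrite normrM (@ger0_norm _ 2)//; lra.
Qed.

Lemma poisson_kernel (x : circle R) (w : C) : normc w != 1 ->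
  1 + 2 * Re (w * (cval x - w)^-1) = (1 - sq w) * (sq (cval x - w))^-1.
Proof.
move=> w1; have s0 := sq_cval_sub_gt0 x w1.
rewrite inv_conj_sq mulrCA Re_mul Im_real mul0r subr0 Re_real.
apply: (mulIf (lt0r_neq0 s0)); rewrite -[RHS]mulrA mulVf ?gt_eqF// mulr1.
have e X : (1 + 2 * ((sq (cval x - w))^-1 * X)) * sq (cval x - w) = sq (cval x - w) + 2 * X.
  by field; rewrite gt_eqF.
rewrite e.
move: (sq_cval x); rewrite !sqE !ReImE => h.
rewrite -[in RHS]h; ring.
Qed.

Lemma poisson_integral (mu : {finite_measure set (circle R) -> \bar R}) (w : C) :
  normc w != 1 ->
  fine (mu setT) + 2 * Re (w * cintegral mu (fun x => (cval x - w)^-1)) =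
  (1 - sq w) * \int[mu]_x (sq (cval x - w))^-1.
Proof.
move=> w1; have [b1 b2] := cbmeas_cauchy w1.
have b3 := bmeas_inv_sq w1.
pose f x := Re (cval x - w)^-1; pose g x := Im (cval x - w)^-1.
have c1 : bmeas (fun x => Re w * f x) by apply: bmeasM => //; exact: bmeas_cst.
have c2 : bmeas (fun x => - Im w * g x) by apply: bmeasM => //; exact: bmeas_cst.
have c3 : bmeas (fun x => 2 * (Re w * f x + - Im w * g x)).
  by apply: bmeasM; [exact: bmeas_cst|exact: bmeasD].
transitivity (\int[mu]_x (1 + 2 * (Re w * f x + - Im w * g x))).
  rewrite integD//; last exact: bmeas_cst.
  rewrite integ_cst mul1r integZ; last exact: bmeasD.
  by rewrite integD// !integZ// Re_mul /= mulNr.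
rewrite -integZ//; apply: eq_Rintegral => x _.
by rewrite -poisson_kernel// Re_mul mulNr.
Qed.

(** For the normalized solution starting at (1, 1), the two power laws give L^(g1 - g2) <= C2 / C1
    for all large [L]. Hence beta <= 1, which later permits [eps <= eps ^ beta]. *)
Lemma exponents_le (alpha : int -> C) (z : C) (C1 C2 g1 g2 L0 : R) :
  (forall n : int, normc (alpha n) < 1) ->
  0 < C1 -> power_law_bounds alpha z C1 C2 g1 g2 L0 -> g1 <= g2.
Proof.
move=> alpha_in_D C10 pl; rewrite leNgt; apply/negP => g21.
have [P [Q [h p0 q0]]] := exists_solution alpha_in_D z 1 1.
have nrm : normalized (interleave P Q).
  rewrite /normalized (interleave_even P Q 0) (interleave_odd P Q 0) p0 q0.
  by rewrite ComplexField.Normc.normc1 expr1n.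
pose L := Num.max L0 (Num.max 1 (((C2 / C1) + 1) `^ (g1 - g2)^-1)).
have L1 : 1 <= L by rewrite /L !le_max lexx orbT.
have Lp : 0 < L by exact: lt_le_trans L1.
have [|lo up] := pl _ (szego_transfer alpha_in_D h) nrm L; first by rewrite /L le_max lexx.
have C20 : 0 <= C2 / C1.
  rewrite divr_ge0 ?(ltW C10)//.
  have : 0 <= C2 * L `^ g2.
    by apply: le_trans up; apply: le_trans lo; rewrite mulr_ge0 ?powR_ge0 ?(ltW C10).
  by rewrite pmulr_lge0 ?powR_gt0.
have d0 : 0 < g1 - g2 by rewrite subr_gt0.
have : L `^ (g1 - g2) <= C2 / C1.
  rewrite ler_pdivlMr// mulrC.
  rewrite -(@ler_pM2r _ (L `^ g2)) ?powR_gt0// -mulrA -powRD; last first.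
    by rewrite (gt_eqF Lp) implybT.
  by rewrite subrK (le_trans lo).
rewrite leNgt => /negP; apply.
apply: lt_le_trans (_ : C2 / C1 + 1 <= _); first by rewrite ltrDl.
have -> : C2 / C1 + 1 = ((C2 / C1 + 1) `^ (g1 - g2)^-1) `^ (g1 - g2).
  by rewrite -powRrM mulVf ?gt_eqF// powRr1// addr_ge0.
apply: ge0_ler_powR; rewrite ?nnegrE ?powR_ge0 ?(ltW d0) ?(ltW Lp)//.
by rewrite /L !le_max lexx !orbT.
Qed.

End arcs.

(** * From Green function bounds to Hoelder continuity *)

Section holder.
Variable R : realType.
Local Notation C := R[i].
Local Notation Re := complex.Re.

Lemma normc_rad (z : C) (r : R) : 0 <= r -> sq z = 1 -> normc (r%:C * z) = r.
Proof.
by move=> r0 z1; rewrite ComplexField.Normc.normcM normc_real// normc_sqrt z1 sqrtr1 mulr1.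
Qed.

Lemma Re_le_normc (x : C) : Re x <= normc x.
Proof.
apply: le_trans (ler_norm _) _; rewrite normc_sqrt sqE -sqrtr_sqr.
by rewrite ler_sqrt ?addr_ge0 ?sqr_ge0// lerDl sqr_ge0.
Qed.

(** With w = (1 - eps) z, every x in [U] has |x - w| <= 2 eps, so on [U] the Poisson kernel is at
    least (1 - |w|^2) / (4 eps^2) = (2 - eps) / (4 eps) >= 1 / (4 eps). *)
Lemma spectral_arc_bound (mu : {finite_measure set (circle R) -> \bar R})
    (z : circle R) (eps B : R) (U : set (circle R)) :
  0 < eps -> eps < 1 -> measurable U ->
  (forall x, U x -> sq (cval x - cval z) <= eps ^+ 2) ->
  normc (cintegral mu (fun x => (cval x - (1 - eps)%:C * cval z)^-1)) <= B ->
  fine (mu U) <= 4 * eps * (fine (mu setT) + 2 * B).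
Proof.
move=> e0 e1 mU hU hB; set w := (1 - eps)%:C * cval z.
have r0 : 0 <= 1 - eps by rewrite subr_ge0 ltW.
have nw : normc w = 1 - eps by rewrite normc_rad// sq_cval.
have w1 : normc w != 1 by rewrite nw lt_eqF// gtrBl.
have h1 : (4 * eps ^+ 2)^-1 * fine (mu U) <= \int[mu]_x (sq (cval x - w))^-1.
  apply: measure_le_integ => //.
  - by rewrite invr_ge0 mulr_ge0 ?sqr_ge0.
  - exact: bmeas_inv_sq.
  - by move=> x; rewrite invr_ge0 sq_ge0.
  move=> x Ux; rewrite lef_pV2 ?posrE ?sq_cval_sub_gt0 ?mulr_gt0 ?exprn_gt0//.
  have -> : cval x - w = (cval x - cval z) + eps%:C * cval z.
    by rewrite /w rmorphB rmorph1; ring.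
  apply: le_trans (sqD_le2 _ _) _; rewrite sqM sq_real sq_cval mulr1.
  by have := hU x Ux; lra.
have := poisson_integral mu w1; rewrite -(sq_normc w) nw => pois.
have h2 : Re (w * cintegral mu (fun x => (cval x - w)^-1)) <= B.
  apply: le_trans (Re_le_normc _) _; rewrite ComplexField.Normc.normcM nw.
  by apply: le_trans hB; rewrite ler_piMl ?normc_ge0// gerBl ltW.
have U0 : 0 <= fine (mu U) by exact: fine_ge0.
have d0 : 0 <= 1 - (1 - eps) ^+ 2 by rewrite subr_ge0 expr_le1// gerBl ltW.
have h3 := ler_wpM2l d0 h1; rewrite -pois in h3.
have h4 : fine (mu U) <= 4 * eps * ((1 - (1 - eps) ^+ 2) * ((4 * eps ^+ 2)^-1 * fine (mu U))).
  have -> : 4 * eps * ((1 - (1 - eps) ^+ 2) * ((4 * eps ^+ 2)^-1 * fine (mu U))) =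
    (2 - eps) * fine (mu U) by field; rewrite gt_eqF.
  by rewrite ler_peMl//; lra.
apply: (le_trans h4); rewrite ler_wpM2l ?mulr_ge0 ?(ltW e0)//.
by apply: (le_trans h3); lra.
Qed.

Lemma spectral_measure_green (alpha : int -> C) k
    (mu : {finite_measure set (circle R) -> \bar R}) w :
  is_spectral_measure alpha (@delta R k) mu -> normc w != 1 ->
  cintegral mu (fun x => (cval x - w)^-1) = green alpha k k w.
Proof. by move=> h /eqP w1; rewrite -h. Qed.

Lemma holder_of_green_bound (alpha : int -> C) (z : circle R) (C4 beta : R)
    (mu0 mu1 : {finite_measure set (circle R) -> \bar R}) :
  beta <= 1 -> 0 <= C4 ->
  is_spectral_measure alpha (@delta R 0) mu0 ->
  is_spectral_measure alpha (@delta R 1) mu1 ->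
  (forall r, 9 / 10 < r -> r < 1 ->
    normc (green alpha 0 0 (r%:C * cval z)) <= C4 * (1 - r) `^ (beta - 1) /\
    normc (green alpha 1 1 (r%:C * cval z)) <= C4 * (1 - r) `^ (beta - 1)) ->
  holder_continuous_at beta (measure_add mu0 mu1) z.
Proof.
move=> b1 C40 sp0 sp1 G.
pose M (mu : {finite_measure set (circle R) -> \bar R}) := 4 * (fine (mu setT) + 2 * C4).
exists (M mu0 + M mu1).
have e10 : (0 : R) < 1 / 10 by lra.
near=> eps.
have e0 : 0 < eps by [].
have e1 : eps < 1 / 10 by near: eps; exact: nbhs_right_lt.
have epi : 0 <= eps <= pi.
  by rewrite (ltW e0)/=; have := pi_ge2 R; lra.
have mU := closed_arc_measurable z epi.
have w1 : normc ((1 - eps)%:C * cval z) != 1.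
  by rewrite normc_rad ?sq_cval//; [rewrite lt_eqF//|]; lra.
have bd k (mu : {finite_measure set (circle R) -> \bar R}) :
    is_spectral_measure alpha (@delta R k) mu ->
    normc (green alpha k k ((1 - eps)%:C * cval z)) <= C4 * eps `^ (beta - 1) ->
    (mu (closed_arc z eps) <= (M mu * eps `^ beta)%:E)%E.
  move=> sp Gk.
  rewrite -(@fineK _ (mu (closed_arc z eps))) ?fin_num_measure// lee_fin.
  have e1' : eps < 1 by lra.
  apply: le_trans (@spectral_arc_bound mu z eps (C4 * eps `^ (beta - 1)) _ e0 e1' mU _ _) _.
  - by move=> x; exact: closed_arc_chord.
  - by rewrite (spectral_measure_green sp w1).
  have eb : eps * eps `^ (beta - 1) = eps `^ beta.
    rewrite -{1}(powRr1 (ltW e0)) -powRD; first by rewrite addrC subrK.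
    by rewrite (gt_eqF e0) implybT.
  have -> : 4 * eps * (fine (mu setT) + 2 * (C4 * eps `^ (beta - 1))) =
    4 * (fine (mu setT) * eps + 2 * C4 * (eps * eps `^ (beta - 1))) by ring.
  have -> : M mu * eps `^ beta = 4 * (fine (mu setT) * eps `^ beta + 2 * C4 * eps `^ beta).
    by rewrite /M; ring.
  rewrite eb ler_wpM2l// lerD2r ler_wpM2l ?fine_ge0//.
  by rewrite -[leLHS](powRr1 (ltW e0)) ger_powR// ?e0//=; lra.
have [|| G0 G1] := G (1 - eps); [lra|lra|].
have e1e : 1 - (1 - eps) = eps by rewrite opprB addrC subrK.
rewrite e1e in G0 G1.
by rewrite measure_addE mulrDl EFinD; apply: leeD; [exact: bd sp0 G0|exact: bd sp1 G1].
Unshelve. all: by end_near.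
Qed.

End holder.

(** * Linearity of sums over the integers *)

Section absolutely_summable.
Variable R : realType.
Implicit Types f g h : int -> R.

Definition asum f := summable [set: int] (EFin \o f).

Lemma asumE f : asum f <-> (\esum_(j in [set: int]) (`|f j|%:E) < +oo)%E.
Proof. by []. Qed.

Lemma asum_le f g : (forall j, `|f j| <= `|g j|) -> asum g -> asum f.
Proof.
move=> fg; apply: le_lt_trans; apply: le_esum => j _ /=.
by rewrite lee_fin fg.
Qed.

Lemma asumD f g : asum f -> asum g -> asum (fun j => f j + g j).
Proof. exact: summableD. Qed.

Lemma asumN f : asum f -> asum (fun j => - f j).
Proof. by apply: asum_le => j; rewrite normrN. Qed.

Lemma esumZ k (a : int -> \bar R) : 0 <= k -> (forall j, (0 <= a j)%E) ->
  (\esum_(j in [set: int]) (k%:E * a j) = k%:E * \esum_(j in [set: int]) a j)%E.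
Proof.
move=> k0 a0; rewrite /esum -ereal_supZl//; last first.
  apply/set0P; exists (\sum_(x \in set0) a x)%E; exists set0 => //.
rewrite image_comp; congr (ereal_sup _); apply: eq_imagel => A _ /=.
by rewrite ge0_mule_fsumr.
Qed.

Lemma asumZ k f : asum f -> asum (fun j => k * f j).
Proof.
rewrite !asumE => sf; under eq_esum do rewrite normrM EFinM.
rewrite esumZ//.
have : (\esum_(j in [set: int]) `|f j|%:E)%E \is a fin_num by rewrite ge0_fin_numE ?esum_ge0.
by move=> /fineK <-; rewrite -EFinM ltry.
Qed.

Lemma esum_fin_num f : asum f -> (forall j, 0 <= f j) ->
  (\esum_(j in [set: int]) (f j)%:E)%E \is a fin_num.
Proof.
move=> sf f0; rewrite ge0_fin_numE; last by rewrite esum_ge0// => j _; rewrite lee_fin.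
by move: sf; rewrite asumE; under eq_esum do rewrite ger0_norm//.
Qed.

Lemma rsum_ge0E f : (forall j, 0 <= f j) -> rsum f = fine (\esum_(j in [set: int]) (f j)%:E).
Proof.
move=> f0; rewrite /rsum (_ : (EFin \o f)^\+ = EFin \o f)%E; last first.
  by apply/funext => j; rewrite funeposE; apply/max_idPl; rewrite lee_fin.
rewrite (_ : (EFin \o f)^\- = cst 0)%E; last first.
  by apply/funext => j; rewrite funenegE; apply/max_idPr; rewrite leeNl oppe0 lee_fin.
by rewrite [X in (_ - X)%E]esum1// sube0.
Qed.

(** Any splitting into nonnegative summable families is allowed, not only the one by positive and
    negative parts; this freedom is what makes [rsum] linear. *)
Lemma rsumB_ge0 g h : asum g -> asum h -> (forall j, 0 <= g j) -> (forall j, 0 <= h j) ->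
  rsum (fun j => g j - h j) = rsum g - rsum h.
Proof.
move=> sg sh g0 h0; rewrite (rsum_ge0E g0) (rsum_ge0E h0) /rsum.
have := @esumB _ _ [set: int] (EFin \o g) (EFin \o h) sg sh
  (fun i _ => g0 i) (fun i _ => h0 i).
rewrite (_ : ((EFin \o g) \- (EFin \o h))%E = EFin \o (fun j => g j - h j)) => [->|//].
by rewrite fineB//; exact: esum_fin_num.
Qed.

Lemma rsum_ge0 f : (forall j, 0 <= f j) -> 0 <= rsum f.
Proof. by move=> f0; rewrite rsum_ge0E// fine_ge0// esum_ge0// => j _; rewrite lee_fin. Qed.

Lemma esum_rsum f : asum f -> (forall j, 0 <= f j) ->
  (\esum_(j in [set: int]) (f j)%:E = (rsum f)%:E)%E.
Proof.
by move=> sf f0; rewrite rsum_ge0E// fineK//; exact: esum_fin_num.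
Qed.

Lemma rsumD_ge0 g h : asum g -> asum h -> (forall j, 0 <= g j) -> (forall j, 0 <= h j) ->
  rsum (fun j => g j + h j) = rsum g + rsum h.
Proof.
move=> sg sh g0 h0; apply: EFin_inj; rewrite EFinD -!esum_rsum//.
- by rewrite -esumD// => j _; rewrite lee_fin.
- exact: asumD.
- by move=> j; rewrite addr_ge0.
Qed.

Definition pos_part f j := (`|f j| + f j) / 2.
Definition neg_part f j := (`|f j| - f j) / 2.

Lemma pos_part_ge0 f j : 0 <= pos_part f j.
Proof. by rewrite divr_ge0// -lerBlDr sub0r -normrN ler_norm. Qed.

Lemma neg_part_ge0 f j : 0 <= neg_part f j.
Proof. by rewrite divr_ge0// subr_ge0 ler_norm. Qed.

Lemma pos_neg_part f j : pos_part f j - neg_part f j = f j.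
Proof. by rewrite /pos_part /neg_part; field. Qed.

Lemma asum_pos_part f : asum f -> asum (pos_part f).
Proof.
apply: asum_le => j; rewrite ger0_norm ?pos_part_ge0// /pos_part.
by rewrite ler_pdivrMr// mulr_natr mulr2n lerD2l ler_norm.
Qed.

Lemma asum_neg_part f : asum f -> asum (neg_part f).
Proof.
apply: asum_le => j; rewrite ger0_norm ?neg_part_ge0// /neg_part.
by rewrite ler_pdivrMr// mulr_natr mulr2n lerD2l -normrN ler_norm.
Qed.

Lemma rsumE f : asum f -> rsum f = rsum (pos_part f) - rsum (neg_part f).
Proof.
move=> sf; rewrite -rsumB_ge0; [|exact: asum_pos_part|exact: asum_neg_part|exact: pos_part_ge0|exact: neg_part_ge0].
by congr rsum; apply/funext => j; rewrite pos_neg_part.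
Qed.

Lemma rsumD f g : asum f -> asum g -> rsum (fun j => f j + g j) = rsum f + rsum g.
Proof.
move=> sf sg.
have := @rsumB_ge0 (fun j => pos_part f j + pos_part g j) (fun j => neg_part f j + neg_part g j).
rewrite (rsumD_ge0 (asum_pos_part sf) (asum_pos_part sg) (pos_part_ge0 f) (pos_part_ge0 g)).
rewrite (rsumD_ge0 (asum_neg_part sf) (asum_neg_part sg) (neg_part_ge0 f) (neg_part_ge0 g)).
have -> : (fun j => pos_part f j + pos_part g j - (neg_part f j + neg_part g j)) = (fun j => f j + g j).
  by apply/funext => j; rewrite -[in RHS](pos_neg_part f) -[in RHS](pos_neg_part g); ring.
move=> ->.
- by rewrite (rsumE sf) (rsumE sg); ring.
- by apply: asumD; exact: asum_pos_part.
- by apply: asumD; exact: asum_neg_part.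
- by move=> j; rewrite addr_ge0 ?pos_part_ge0.
- by move=> j; rewrite addr_ge0 ?neg_part_ge0.
Qed.

Lemma rsumZ k f : asum f -> rsum (fun j => k * f j) = k * rsum f.
Proof.
have pos c g : 0 <= c -> asum g -> (forall j, 0 <= g j) -> rsum (fun j => c * g j) = c * rsum g.
  move=> c0 sg g0; apply: EFin_inj; rewrite EFinM -!esum_rsum//.
  - by rewrite -esumZ// => j; rewrite lee_fin.
  - exact: asumZ.
  - by move=> j; rewrite mulr_ge0.
wlog k0 : k f / 0 <= k.
  move=> h sf; have [/h|/ltW k0] := leP 0 k; first exact.
  have := h (- k) (fun j => - f j); rewrite oppr_ge0 => /(_ k0 (asumN sf)).
  under [in LHS]eq_fun do rewrite mulrNN.
  move=> ->; suff -> : rsum (fun j => - f j) = - rsum f by rewrite mulrNN.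
  have := rsumD sf (asumN sf); rewrite (_ : (fun j => f j + - f j) = (fun=> 0)); last first.
    by apply/funext => j; rewrite subrr.
  rewrite (@rsum_single _ 0)// => e.
  by apply/eqP; rewrite -addr_eq0 addrC -e.
move=> sf.
have := @rsumB_ge0 (fun j => k * pos_part f j) (fun j => k * neg_part f j).
rewrite (pos _ _ k0 (asum_pos_part sf) (pos_part_ge0 f)).
rewrite (pos _ _ k0 (asum_neg_part sf) (neg_part_ge0 f)).
have -> : (fun j => k * pos_part f j - k * neg_part f j) = (fun j => k * f j).
  by apply/funext => j; rewrite -mulrBr pos_neg_part.
move=> ->.
- by rewrite (rsumE sf) mulrBr.
- by apply: asumZ; exact: asum_pos_part.
- by apply: asumZ; exact: asum_neg_part.
- by move=> j; rewrite mulr_ge0 ?pos_part_ge0.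
- by move=> j; rewrite mulr_ge0 ?neg_part_ge0.
Qed.

Lemma rsum_reindex (e : int -> int) f : bijective e -> asum f ->
  asum (fun j => f (e j)) /\ rsum (fun j => f (e j)) = rsum f.
Proof.
move=> be sf.
have be' : set_bij [set: int] [set: int] e by rewrite setTT_bijective.
have sfe g : asum g -> asum (fun j => g (e j)).
  by rewrite !asumE (@reindex_esum _ _ _ _ _ e (fun j => `|g j|%:E) be').
split; first exact: sfe.
have pos g : asum g -> (forall j, 0 <= g j) -> rsum (fun j => g (e j)) = rsum g.
  move=> sg g0; apply: EFin_inj; rewrite -!esum_rsum//; last exact: sfe.
  by rewrite [RHS](@reindex_esum _ _ _ _ _ e (fun j => (g j)%:E) be').
rewrite (rsumE sf) (rsumE (sfe _ sf)).
by congr (_ - _); [exact: pos (asum_pos_part sf) (pos_part_ge0 f)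
  |exact: pos (asum_neg_part sf) (neg_part_ge0 f)].
Qed.

Lemma le_rsum f g : asum f -> asum g -> (forall j, f j <= g j) -> rsum f <= rsum g.
Proof.
move=> sf sg fg; rewrite -subr_ge0.
have <- : rsum (fun j => g j + (-1) * f j) = rsum g - rsum f.
  by rewrite rsumD//; [rewrite rsumZ// mulN1r|exact: asumZ].
by apply: rsum_ge0 => j; rewrite mulN1r subr_ge0.
Qed.

End absolutely_summable.

(** * Square summable sequences as a real inner product space *)

Section l2_space.
Variable R : realType.
Local Notation C := R[i].
Local Notation Re := complex.Re.
Local Notation Im := complex.Im.
Implicit Types (u v x y : int -> C) (c : C).

Definition vadd u v : int -> C := fun j => u j + v j.
Definition vscale c u : int -> C := fun j => c * u j.
(** The real part of the inner product: symmetric, bilinear over the reals, and enough to recover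
    the complex inner product by rotating one argument. *)
Definition rip u v : R := rsum (fun j => Re ((u j)^* * v j)).
Definition nrm2 u : R := rsum (fun j => sq (u j)).

Lemma l2E u : l2 u <-> asum (fun j => sq (u j)).
Proof.
by rewrite /l2 /asum; under [X in summable _ X]eq_fun do rewrite sq_normc.
Qed.

Lemma l2_le u v w : (forall j, sq (u j) <= 2 * (sq (v j) + sq (w j))) -> l2 v -> l2 w -> l2 u.
Proof.
move=> h /l2E sv /l2E sw; apply/l2E; apply: asum_le (asumZ 2 (asumD sv sw)) => j.
by rewrite !ger0_norm ?sq_ge0 ?mulr_ge0 ?addr_ge0 ?sq_ge0.
Qed.

Lemma l2D u v : l2 u -> l2 v -> l2 (vadd u v).
Proof. by apply: l2_le => j; exact: sqD_le2. Qed.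

Lemma l2Z c u : l2 u -> l2 (vscale c u).
Proof.
move=> /l2E su; apply/l2E; apply: asum_le (asumZ (sq c) su) => j.
by rewrite /vscale sqM.
Qed.

Lemma l2_delta k : l2 (@delta R k).
Proof.
rewrite /l2 /summable (@esum_single _ _ k) ?ltry// => j /negbTE jk.
by rewrite /delta jk ComplexField.Normc.normc0 expr0n /= normr0.
Qed.

Lemma l2_0 : l2 (fun=> 0 : C).
Proof.
have := l2Z 0 (l2_delta 0); congr l2; apply/funext => j.
by rewrite /vscale mul0r.
Qed.

Lemma asum_rip u v : l2 u -> l2 v -> asum (fun j => Re ((u j)^* * v j)).
Proof.
move=> /l2E su /l2E sv; apply: asum_le (asumD su sv) => j.
rewrite Re_mul ReImE ReImE mulNr opprK [leRHS]ger0_norm ?addr_ge0 ?sq_ge0// !sqE.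
rewrite ler_norml; apply/andP; split.
- have := sqr_ge0 (Re (u j) + Re (v j)); have := sqr_ge0 (Im (u j) + Im (v j)).
  have := sqr_ge0 (Re (u j)); have := sqr_ge0 (Im (u j)).
  have := sqr_ge0 (Re (v j)); have := sqr_ge0 (Im (v j)); nra.
- have := sqr_ge0 (Re (u j) - Re (v j)); have := sqr_ge0 (Im (u j) - Im (v j)).
  have := sqr_ge0 (Re (u j)); have := sqr_ge0 (Im (u j)).
  have := sqr_ge0 (Re (v j)); have := sqr_ge0 (Im (v j)); nra.
Qed.

Lemma ripC u v : rip u v = rip v u.
Proof. by congr rsum; apply/funext => j; rewrite !ReImE; ring. Qed.

Lemma ripDr u v x : l2 u -> l2 v -> l2 x -> rip u (vadd v x) = rip u v + rip u x.
Proof.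
move=> lu lv lx; rewrite -rsumD; try exact: asum_rip.
by congr rsum; apply/funext => j; rewrite mulrDr Re_add.
Qed.

Lemma ripDl u v x : l2 u -> l2 v -> l2 x -> rip (vadd u v) x = rip u x + rip v x.
Proof. by move=> lu lv lx; rewrite ripC ripDr// ![rip x _]ripC. Qed.

Lemma ripZr u v k : l2 u -> l2 v -> rip u (vscale k%:C v) = k * rip u v.
Proof.
move=> lu lv; rewrite -rsumZ; last exact: asum_rip.
by congr rsum; apply/funext => j; rewrite /vscale !ReImE; ring.
Qed.

Lemma rip_conj c u v : rip (vscale c u) v = rip u (vscale c^* v).
Proof. by congr rsum; apply/funext => j; rewrite /vscale !ReImE; ring. Qed.

Lemma nrm2E u : nrm2 u = rip u u.
Proof. by congr rsum; apply/funext => j; rewrite sqE !ReImE; ring. Qed.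

Lemma nrm2_ge0 u : 0 <= nrm2 u.
Proof. by apply: rsum_ge0 => j; exact: sq_ge0. Qed.

Lemma nrm2_0 : nrm2 (fun=> 0) = 0.
Proof. by rewrite /nrm2 (@rsum_single _ 0) => [|j _]; rewrite sq0. Qed.

Lemma nrm2D u v : l2 u -> l2 v -> nrm2 (vadd u v) = nrm2 u + nrm2 v + 2 * rip u v.
Proof.
move=> lu lv; rewrite !nrm2E ripDr//; last exact: l2D.
by rewrite !ripDl// (ripC v u); ring.
Qed.

Lemma nrm2Z c u : l2 u -> nrm2 (vscale c u) = sq c * nrm2 u.
Proof.
move=> /l2E su; rewrite -rsumZ//.
by congr rsum; apply/funext => j; rewrite /vscale sqM.
Qed.

Lemma nrm2D_le2 u v : l2 u -> l2 v -> nrm2 (vadd u v) <= 2 * (nrm2 u + nrm2 v).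
Proof.
move=> lu lv; have /l2E s := l2D lu lv; move/l2E : lu => su; move/l2E : lv => sv.
rewrite -rsumD// -rsumZ; last exact: asumD.
apply: le_rsum => //; first by apply: asumZ; exact: asumD.
by move=> j; exact: sqD_le2.
Qed.

Lemma rip_le_half u v : l2 u -> l2 v -> 2 * `|rip u v| <= nrm2 u + nrm2 v.
Proof.
move=> lu lv; have h1 := nrm2_ge0 (vadd u v).
have h2 := nrm2_ge0 (vadd u (vscale (-1)%:C v)).
rewrite nrm2D// in h1; rewrite nrm2D ?ripZr ?nrm2Z ?sq_real// in h2; last exact: l2Z.
rewrite -[2]ger0_norm// -normrM ler_norml; move: h1 h2; nra.
Qed.

Lemma rip_le u v : l2 u -> l2 v -> `|rip u v| <= nrm2 u + nrm2 v.
Proof. by move=> lu lv; apply: le_trans (rip_le_half lu lv); rewrite ler_peMl// ler1n. Qed.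

Lemma sq_le_nrm2 u j : l2 u -> sq (u j) <= nrm2 u.
Proof.
move=> /l2E su.
have -> : sq (u j) = rsum (fun i => if i == j then sq (u i) else 0).
  by rewrite (@rsum_single _ j) ?eqxx// => i /negbTE ->.
apply: le_rsum => //; last by move=> i; case: ifP => // _; exact: sq_ge0.
by apply: asum_le su => i; case: ifP => // _; rewrite normr0.
Qed.

Lemma nrm2_delta k : nrm2 (@delta R k) = 1.
Proof.
rewrite /nrm2 (@rsum_single _ k) ?/delta ?eqxx.
  by rewrite -sq_normc ComplexField.Normc.normc1 expr1n.
by move=> j /negbTE ->; rewrite sq0.
Qed.

Lemma Re_mulNi (x : C) : Re ((0 -i* 1)%C * x) = Im x.
Proof. by case: x => a b; rewrite /= mul0r mulN1r opprK add0r. Qed.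

Lemma Im_mulNi (x : C) : Im ((0 -i* 1)%C * x) = - Re x.
Proof. by case: x => a b; rewrite /= mul0r mulN1r add0r. Qed.

Lemma inner_rip u v : l2_inner u v = rip u v +i* rip u (vscale (0 -i* 1)%C v).
Proof.
rewrite /l2_inner /csum; congr (_ +i* _); congr rsum; apply/funext => j.
by rewrite /vscale Re_mul Re_mulNi Im_mulNi !ReImE; ring.
Qed.

(** The free scalar [c] lets one identity of real numbers carry both the real and the imaginary
    part. *)
Lemma Re_mul_inner c u v : l2 u -> l2 v -> Re (c * l2_inner u v) = rip u (vscale c v).
Proof.
move=> lu lv; rewrite inner_rip Re_mul /=.
have -> : vscale c v = vadd (vscale (Re c)%:C v) (vscale (- Im c)%:C (vscale (0 -i* 1)%C v)).
  apply/funext => j; rewrite /vadd /vscale; apply/eqP; rewrite eq_complex.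
  rewrite Re_add Im_add [Re (_ * (_ * _))]Re_mul [Im (_ * (_ * _))]Im_mul.
  by rewrite Re_mulNi Im_mulNi !ReImE; apply/andP; split; apply/eqP; ring.
rewrite ripDr// ?ripZr//; [ring|exact: l2Z|exact: l2Z|exact/l2Z/l2Z].
Qed.

End l2_space.

(** * Unitarity of the factors *)

Section theta_l2.
Variable R : realType.
Local Notation C := R[i].
Variable alpha : int -> C.
Hypothesis alpha_in_D : forall n : int, normc (alpha n) < 1.
Implicit Types (u v : int -> C).

Definition partner (b : bool) (j : int) : int :=
  if odd `|j|%N == b then j + 1 else j - 1.

Lemma odd_absz_sub1_neq (b : bool) (j : int) : odd `|j|%N != b -> odd `|(j - 1)%R|%N = b.
Proof. by rewrite odd_absz_sub1; case: odd; case: b. Qed.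

Lemma partnerK b : involutive (partner b).
Proof.
move=> j; have [jb|/negbTE jb] := eqVneq (odd `|j|%N) b; rewrite /partner.
  by rewrite jb eqxx odd_absz_add1 jb; case: (b); rewrite /= addrK.
by rewrite jb odd_absz_sub1; move: jb; case: odd; case: b => //= _; rewrite subrK.
Qed.

Lemma bijective_shift (k : int) : bijective (fun j : int => j + k).
Proof. by exists (fun j => j - k) => j; rewrite ?addrK ?subrK. Qed.

Lemma l2_theta b u : l2 u -> l2 (theta b alpha u).
Proof.
move=> /l2E su; apply/l2E.
have [s1 _] := rsum_reindex (bijective_shift (-1)) su.
have [s2 _] := rsum_reindex (bijective_shift 1) su.
apply: asum_le (asumD (asumD s1 su) s2) => j.
rewrite ger0_norm ?sq_ge0// ger0_norm ?addr_ge0 ?sq_ge0//.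
exact: theta_sq_le.
Qed.

Lemma theta_vadd b u v : theta b alpha (vadd u v) = vadd (theta b alpha u) (theta b alpha v).
Proof. by apply/funext => j; rewrite /theta /vadd; case: ifP => _; ring. Qed.

Lemma theta_vscale b (c : C) u : theta b alpha (vscale c u) = vscale c (theta b alpha u).
Proof. by apply/funext => j; rewrite /theta /vscale; case: ifP => _; ring. Qed.

(** The identity on the pair of [j] and [partner b j], summed over all [j], counts each pair twice;
    reindexing by the involution turns both sides into twice a norm. *)
Lemma nrm2_theta b u : l2 u -> nrm2 (theta b alpha u) = nrm2 u.
Proof.
move=> lu; have /l2E st := l2_theta b lu; move/l2E: (lu) => su.
have bp : bijective (partner b) by exists (partner b); exact: partnerK.
have pair j : sq (theta b alpha u j) + sq (theta b alpha u (partner b j)) =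
    sq (u j) + sq (u (partner b j)).
  rewrite /partner; case: ifPn => [/eqP jb|jb]; first exact: theta_isometry.
  rewrite addrC [RHS]addrC -{2 4}(subrK 1 j); apply: theta_isometry => //.
  exact: odd_absz_sub1_neq.
have [s1 e1] := rsum_reindex bp st; have [s2 e2] := rsum_reindex bp su.
have : nrm2 (theta b alpha u) + nrm2 (theta b alpha u) = nrm2 u + nrm2 u.
  rewrite /nrm2 -{2}e1 -{2}e2 -!rsumD//.
  by congr rsum; apply/funext => j; exact: pair.
by lra.
Qed.

Lemma rip_theta b u v : l2 u -> l2 v -> rip (theta b alpha u) (theta b alpha v) = rip u v.
Proof.
move=> lu lv.
have := nrm2_theta b (l2D lu lv); rewrite theta_vadd !nrm2D//; try exact: l2_theta.
by rewrite !nrm2_theta//; lra.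
Qed.

Definition conj_seq (a : int -> C) : int -> C := fun n => ((a n)^*)%R.

Lemma conj_seq_in_D n : normc (conj_seq alpha n) < 1.
Proof. by rewrite normc_conj. Qed.

Lemma rho_conj_seq n : rho (conj_seq alpha) n = rho alpha n.
Proof. by rewrite /rho normc_conj. Qed.

(** Each block is unitary, and its adjoint is the block with the conjugate coefficient. *)
Lemma theta_conjK b u : theta b (conj_seq alpha) (theta b alpha u) = u.
Proof.
apply/funext => j.
have inv j0 (e : odd `|j0|%N = b) :
    theta b (conj_seq alpha) (theta b alpha u) j0 = u j0 /\
    theta b (conj_seq alpha) (theta b alpha u) (j0 + 1) = u (j0 + 1).
  rewrite !(theta_fst _ _ e) !(theta_snd _ _ e) !(theta_fst _ _ e) !rho_conj_seq /conj_seq conjCK.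
  have h := real_rho_sqr alpha_in_D j0.
  split.
    transitivity ((alpha j0 * (alpha j0)^* + (rho alpha j0)%:C * (rho alpha j0)%:C) * u j0); first by ring.
    by rewrite h addrC subrK mul1r.
  transitivity ((alpha j0 * (alpha j0)^* + (rho alpha j0)%:C * (rho alpha j0)%:C) * u (j0 + 1)); first by ring.
  by rewrite h addrC subrK mul1r.
have [jb|jb] := eqVneq (odd `|j|%N) b; first by have [] := inv j jb.
by rewrite -(subrK 1 j); have [] := inv (j - 1) (odd_absz_sub1_neq jb).
Qed.

End theta_l2.

(** * Coordinatewise limits and the Neumann series *)

Section pointwise_convergence.
Variable R : realType.
Local Notation C := R[i].
Local Notation Re := complex.Re.
Local Notation Im := complex.Im.
Implicit Types (x : int -> C) (X : nat -> int -> C).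

Definition pcv X x : Prop := forall j,
  (fun n => Re (X n j)) @ \oo --> Re (x j) /\ (fun n => Im (X n j)) @ \oo --> Im (x j).

Lemma pcv_cst x : pcv (fun=> x) x.
Proof. by move=> j; split; exact: cvg_cst. Qed.

Lemma pcvD X Y x y : pcv X x -> pcv Y y -> pcv (fun n => vadd (X n) (Y n)) (vadd x y).
Proof.
move=> hx hy j; have [a b] := hx j; have [c d] := hy j.
by split; rewrite /vadd ?Re_add ?Im_add; under eq_fun do rewrite ?Re_add ?Im_add; exact: cvgD.
Qed.

Lemma pcvZ c X x : pcv X x -> pcv (fun n => vscale c (X n)) (vscale c x).
Proof.
move=> hx j; have [a b] := hx j.
split; rewrite /vscale ?Re_mul ?Im_mul; under eq_fun do rewrite ?Re_mul ?Im_mul.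
- by apply: cvgB; apply: cvgMr.
- by apply: cvgD; apply: cvgMr.
Qed.

Lemma pcv_theta b (alpha : int -> C) X x : pcv X x ->
  pcv (fun n => theta b alpha (X n)) (theta b alpha x).
Proof.
move=> hx j; pose sh k (u : int -> C) : int -> C := fun i => u (i + k).
have hs k : pcv (fun n => sh k (X n)) (sh k x) by move=> i; exact: hx.
rewrite /theta; case: ifP => _.
- exact: (pcvD (pcvZ (alpha j)^* hx) (pcvZ (rho alpha j)%:C (hs 1))) j.
- have := (pcvD (pcvZ (rho alpha (j - 1))%:C (hs (-1))) (pcvZ (- alpha (j - 1)) hx)) j.
  by rewrite /vadd /vscale /sh mulNr; under eq_fun do rewrite mulNr; under [X in _ /\ (X @ _ --> _)]eq_fun do rewrite mulNr.
Qed.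

Lemma pcv_unique X x y : pcv X x -> pcv X y -> x = y.
Proof.
move=> hx hy; apply/funext => j; have [a b] := hx j; have [c d] := hy j.
apply/eqP; rewrite eq_complex; apply/andP; split; apply/eqP.
- exact: (cvg_unique _ a c).
- exact: (cvg_unique _ b d).
Qed.

(** Fatou's lemma for the counting measure: each finite sum of |x_j|^2 is a limit of sums that are
    at most [B]. *)
Lemma l2_of_pcv X x B : pcv X x -> (forall n, l2 (X n)) -> (forall n, nrm2 (X n) <= B) -> l2 x.
Proof.
move=> hx lX XB; apply/l2E.
apply: (@le_lt_trans _ _ B%:E); last exact: ltry.
apply: ge_ereal_sup => _ [A [finA _] <-].
rewrite fsbig_finite//= sumEFin lee_fin.
have cv : (fun n => \sum_(j <- finmap.enum_fset (fset_set A)) `|sq (X n j)|) @ \oo --> \sum_(j <- finmap.enum_fset (fset_set A)) `|sq (x j)|.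
  apply: cvg_big => [|j _]; first exact: add_continuous.
  apply: cvg_norm; rewrite sqE; under eq_fun do rewrite sqE.
  by have [a b] := hx j; apply: cvgD; rewrite expr2; under eq_fun do rewrite expr2; apply: cvgM.
apply: (cvgr_to_le cv); apply: nearW => n.
have /l2E sX := lX n.
apply: le_trans (XB n); rewrite -lee_fin /nrm2 -esum_rsum; last 2 first.
- exact: sX.
- by move=> j; exact: sq_ge0.
apply: esum_ge; exists A; first by split.
rewrite fsbig_finite//= -sumEFin; apply: lee_sum => j _.
by rewrite ger0_norm ?sq_ge0.
Qed.

End pointwise_convergence.

Section neumann.
Variable R : realType.
Local Notation C := R[i].
Local Notation Re := complex.Re.
Local Notation Im := complex.Im.
Variable F : (int -> C) -> int -> C.
Hypothesis F_l2 : forall u, l2 u -> l2 (F u).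
Hypothesis F_vadd : forall u v, F (vadd u v) = vadd (F u) (F v).
Hypothesis F_vscale : forall c u, F (vscale c u) = vscale c (F u).
Hypothesis F_nrm2 : forall u, l2 u -> nrm2 (F u) = nrm2 u.
Hypothesis F_pcv : forall X x, pcv X x -> pcv (fun n => F (X n)) (F x).

(** Convexity of the square for X + s Y = (1 - s) (X / (1 - s)) + s Y with s = |c|. The number |x|^2
    / (1 - s)^2 is a fixed point of the resulting recursion, which keeps the partial sums of the
    Neumann series bounded. *)
Lemma nrm2_add_scale_le (c : C) (x y : int -> C) : l2 x -> l2 y -> normc c < 1 ->
  nrm2 (vadd x (vscale c y)) <= nrm2 x / (1 - normc c) + normc c * nrm2 y.
Proof.
move=> lx ly c1; set s := normc c.
have s0 : 0 <= s by exact: normc_ge0.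
have s1 : 0 < 1 - s by rewrite subr_gt0.
have /l2E sxy := l2D lx (l2Z c ly); move/l2E: lx => sx; move/l2E: ly => sy.
rewrite mulrC -!rsumZ// -rsumD; [|exact: asumZ|exact: asumZ].
apply: le_rsum => //; first by apply: asumD; exact: asumZ.
move=> j; rewrite /vadd /vscale.
have h : normc (x j + c * y j) <= normc (x j) + s * normc (y j).
  by rewrite -ComplexField.Normc.normcM; exact: normc_add.
rewrite -!sq_normc; have := normc_ge0 (x j + c * y j).
move: h; move: (normc (x j)) (normc (y j)) (normc _) => X Y Z h Z0.
apply: le_trans (_ : (X + s * Y) ^+ 2 <= _).
  by rewrite ler_pXn2r ?nnegrE//; exact: le_trans Z0 h.
rewrite -lerBlDr [leRHS]mulrC ler_pdivlMr//.
have : 0 <= s * (X - (1 - s) * Y) ^+ 2 by rewrite mulr_ge0 ?sqr_ge0.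
by rewrite -subr_ge0 => h2; rewrite -subr_ge0; apply: le_trans h2 _; rewrite le_eqVlt; apply/orP; left; apply/eqP; ring.
Qed.

(** The terms are dominated by a geometric series in each coordinate, so the partial sums converge
    coordinatewise. The uniform norm bound puts the limit in l2, and continuity of [F] passes to the
    limit in X_(n+1) = phi + c F X_n. *)
Lemma neumann_series (c : C) (phi : int -> C) : l2 phi -> normc c < 1 ->
  exists2 psi, l2 psi & psi = vadd phi (vscale c (F psi)).
Proof.
move=> lphi c1; set s := normc c in c1 *.
have s0 : 0 <= s by exact: normc_ge0.
have s1 : 0 < 1 - s by rewrite subr_gt0.
pose Y := fix Y n : int -> C := if n is m.+1 then vscale c (F (Y m)) else phi.
pose X := fix X n : int -> C := if n is m.+1 then vadd (X m) (Y m) else (fun=> 0).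
have lY n : l2 (Y n) by elim: n => [//|n IH] /=; apply: l2Z; exact: F_l2.
have lX n : l2 (X n) by elim: n => [|n IH] /=; [exact: l2_0|exact: l2D].
have F0 : F (fun=> 0) = (fun=> 0).
  have -> : (fun=> 0) = vscale (0 : C) (fun=> 0) by apply/funext => j; rewrite /vscale mul0r.
  by rewrite F_vscale; apply/funext => j; rewrite /vscale !mul0r.
have XS n : X n.+1 = vadd phi (vscale c (F (X n))).
  elim: n => [|n IH].
    by rewrite /= F0; apply/funext => j; rewrite /vadd /vscale mulr0 addr0 add0r.
  rewrite -[LHS]/(vadd (X n.+1) (Y n.+1)) {1}IH -[X n.+1]/(vadd (X n) (Y n)) F_vadd.
  by apply/funext => j; rewrite /vadd /vscale /= mulrDr addrA.
have nY n : nrm2 (Y n) = (s ^+ 2) ^+ n * nrm2 phi.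
  elim: n => [|n IH]; first by rewrite expr0 mul1r.
  rewrite /= nrm2Z; last exact: F_l2.
  by rewrite F_nrm2// IH -(sq_normc c) -/s [in RHS]exprS mulrA.
have nX n : nrm2 (X n) <= nrm2 phi / (1 - s) ^+ 2.
  elim: n => [|n IH].
    by rewrite /= nrm2_0 divr_ge0 ?nrm2_ge0 ?sqr_ge0.
  rewrite XS; apply: le_trans (nrm2_add_scale_le lphi (F_l2 (lX n)) c1) _.
  rewrite F_nrm2// -/s.
  apply: le_trans (lerD (lexx _) (ler_wpM2l s0 IH)) _.
  by rewrite le_eqVlt; apply/orP; left; apply/eqP; field; rewrite gt_eqF.
pose K := Num.sqrt (nrm2 phi).
have Yb n j : normc (Y n j) <= geometric K s n.
  have sn : 0 <= s ^+ n by exact: exprn_ge0.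
  rewrite normc_sqrt /geometric /= /K -[s ^+ n]ger0_norm// -sqrtr_sqr -sqrtrM ?nrm2_ge0//.
  rewrite ler_sqrt ?mulr_ge0 ?nrm2_ge0 ?sqr_ge0//.
  have -> : nrm2 phi * (s ^+ n) ^+ 2 = nrm2 (Y n) by rewrite nY mulrC -!exprM mulnC.
  exact: sq_le_nrm2.
have gcv : cvg (series (geometric K s) @ \oo) by apply: is_cvg_geometric_series; rewrite ger0_norm.
have scv (f : nat -> R) j : (forall n, `|f n| <= normc (Y n j)) -> cvg (series f @ \oo).
  move=> fY; apply: normed_cvg; apply: series_le_cvg gcv => n //=.
    by rewrite mulr_ge0 ?sqrtr_ge0 ?exprn_ge0.
  exact: le_trans (fY n) (Yb n j).
have XE n j : Re (X n j) = series (fun k => Re (Y k j)) n /\ Im (X n j) = series (fun k => Im (Y k j)) n.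
  elim: n => [|n [h1 h2]]; first by rewrite /series /= !big_geq.
  by rewrite /= /vadd Re_add Im_add h1 h2 !seriesSr.
pose psi j := lim (series (fun k => Re (Y k j)) @ \oo) +i* lim (series (fun k => Im (Y k j)) @ \oo).
have pX : pcv X psi.
  move=> j; split => /=.
  - under eq_fun do rewrite (XE _ _).1.
    apply: (scv _ j) => n; rewrite normc_sqrt sqE -sqrtr_sqr.
    by rewrite ler_sqrt ?addr_ge0 ?sqr_ge0// lerDl sqr_ge0.
  - under eq_fun do rewrite (XE _ _).2.
    apply: (scv _ j) => n; rewrite normc_sqrt sqE -sqrtr_sqr.
    by rewrite ler_sqrt ?addr_ge0 ?sqr_ge0// lerDr sqr_ge0.
exists psi; first exact: l2_of_pcv pX lX nX.
apply: pcv_unique (_ : pcv (fun n => X n.+1) _) _.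
  by move=> j; have [a b] := pX j; split;
    [rewrite (cvg_shiftS (fun n => Re (X n j)))|rewrite (cvg_shiftS (fun n => Im (X n j)))].
have -> : (fun n => X n.+1) = (fun n => vadd phi (vscale c (F (X n)))) by apply/funext.
by apply: pcvD; [exact: pcv_cst|apply: pcvZ; exact: F_pcv].
Qed.

End neumann.

(** * The operator [E], its resolvent and its polynomials *)

Section cmv_operator.
Variable R : realType.
Local Notation C := R[i].
Variable alpha : int -> C.
Hypothesis alpha_in_D : forall n : int, normc (alpha n) < 1.
Implicit Types (u v x y phi psi : int -> C) (p q : {poly C}).
Local Notation E := (cmv alpha).

Lemma cmvE u : E u = theta false alpha (theta true alpha u).
Proof. by apply/funext => j; exact: cmv_theta. Qed.

Lemma l2_cmv u : l2 u -> l2 (E u).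
Proof. by move=> lu; rewrite cmvE; do 2 apply: (l2_theta alpha_in_D). Qed.

Lemma cmv_vadd u v : E (vadd u v) = vadd (E u) (E v).
Proof. by rewrite !cmvE !theta_vadd. Qed.

Lemma cmv_vscale c u : E (vscale c u) = vscale c (E u).
Proof. by rewrite !cmvE !theta_vscale. Qed.

Lemma nrm2_cmv u : l2 u -> nrm2 (E u) = nrm2 u.
Proof. by move=> lu; rewrite cmvE !(nrm2_theta alpha_in_D)//; exact: l2_theta. Qed.

Lemma rip_cmv u v : l2 u -> l2 v -> rip (E u) (E v) = rip u v.
Proof. by move=> lu lv; rewrite !cmvE !(rip_theta alpha_in_D)//; exact: l2_theta. Qed.

Lemma pcv_cmv X x : pcv X x -> pcv (fun n => E (X n)) (E x).
Proof.
by move=> h; rewrite cmvE; under eq_fun do rewrite cmvE; do 2 apply: pcv_theta.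
Qed.

Definition cmv_inv u := theta true (conj_seq alpha) (theta false (conj_seq alpha) u).

Lemma conj_seqK : conj_seq (conj_seq alpha) = alpha.
Proof. by apply/funext => n; rewrite /conj_seq conjCK. Qed.

Lemma theta_conjKV b u : theta b alpha (theta b (conj_seq alpha) u) = u.
Proof.
rewrite -{1}conj_seqK; apply: theta_conjK => n; exact: conj_seq_in_D.
Qed.

Lemma cmv_invK u : E (cmv_inv u) = u.
Proof. by rewrite cmvE !theta_conjKV. Qed.

(** Inside the circle the Neumann series runs over the inverse of [E] with ratio [w], outside over
    [E] with ratio w^-1. *)
Lemma resolvent_exists w phi : l2 phi -> normc w != 1 ->
  exists2 psi, l2 psi & E psi = vadd phi (vscale w psi).
Proof.
move=> lphi; have cD n : normc (conj_seq alpha n) < 1 by exact: conj_seq_in_D.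
rewrite neq_lt => /orP[w1|w1].
  have l2i u : l2 u -> l2 (cmv_inv u) by move=> lu; do 2 apply: (l2_theta cD).
  have [||||psi lpsi e] := @neumann_series R cmv_inv l2i _ _ _ _ w _ (l2i _ lphi) w1.
  - by move=> u v; rewrite /cmv_inv !theta_vadd.
  - by move=> c u; rewrite /cmv_inv !theta_vscale.
  - by move=> u lu; rewrite /cmv_inv !(nrm2_theta cD)//; exact: l2_theta.
  - by move=> X x h; do 2 apply: pcv_theta.
  by exists psi => //; rewrite {1}e cmv_vadd cmv_vscale !cmv_invK.
have w0 : w != 0.
  by apply/eqP => w0; move: w1; rewrite w0 ComplexField.Normc.normc0 ltr10.
have wi : normc w^-1 < 1 by rewrite ComplexField.Normc.normcV invf_lt1// (lt_trans _ w1).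
have [psi lpsi e] := neumann_series l2_cmv cmv_vadd cmv_vscale nrm2_cmv pcv_cmv
  (l2Z (- w^-1) lphi) wi.
exists psi => //; apply/funext => j; move/(congr1 (fun f => w * f j)) : e.
rewrite /vadd /vscale mulrDr mulNr mulrN !mulVKf// => ->.
by rewrite addrA subrr add0r.
Qed.

Lemma resolventP w phi : l2 phi -> normc w != 1 ->
  l2 (resolvent alpha w phi) /\
  E (resolvent alpha w phi) = vadd phi (vscale w (resolvent alpha w phi)).
Proof.
move=> lphi w1; have [psi lpsi e] := resolvent_exists lphi w1.
rewrite /resolvent; case: xgetP => [y _ [ly h]|/(_ psi)].
  by split=> //; apply/funext => j; rewrite /vadd /vscale -h subrK.
by case; split=> // j; rewrite e /vadd /vscale addrK.
Qed.

(* [p(E) x], by Horner's rule. *)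
Definition pe p x : int -> C := foldr (fun c y => vadd (vscale c x) (E y)) (fun=> 0) p.

Lemma cmv0 : E (fun=> 0) = (fun=> 0).
Proof.
have -> : (fun=> 0) = vscale (0 : C) (fun=> 0) :> (int -> C).
  by apply/funext => j; rewrite /vscale mul0r.
by rewrite cmv_vscale; apply/funext => j; rewrite /vscale !mul0r.
Qed.

Lemma pe0 x : pe 0 x = (fun=> 0).
Proof. by rewrite /pe polyseq0. Qed.

(** For [p = 0] the coefficient list on the left degenerates; the sides still agree because [E] maps
    0 to 0. *)
Lemma pe_MXaddC p c x : pe (p * 'X + c%:P) x = vadd (vscale c x) (E (pe p x)).
Proof.
rewrite -cons_poly_def /pe polyseq_cons; case: ifPn => [//|].
rewrite negbK => /nilP ->; rewrite polyseqC /= cmv0.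
have [->|c0] := eqVneq c 0; last by rewrite /= cmv0.
by apply/funext => j; rewrite /= /vadd /vscale mul0r addr0.
Qed.

Lemma poly_MXaddC p : exists q c, p = q * 'X + c%:P.
Proof. by elim/poly_ind: p => [|p c _]; [exists 0, 0; rewrite mul0r addr0|exists p, c]. Qed.

Lemma l2_pe p x : l2 x -> l2 (pe p x).
Proof.
move=> lx; elim/poly_ind: p => [|p c IH]; first by rewrite pe0; exact: l2_0.
by rewrite pe_MXaddC; apply: l2D; [exact: l2Z|exact: l2_cmv].
Qed.

Lemma pe_cmv p x : pe p (E x) = E (pe p x).
Proof.
elim/poly_ind: p => [|p c IH]; first by rewrite !pe0 cmv0.
by rewrite !pe_MXaddC IH cmv_vadd cmv_vscale.
Qed.

Lemma pe_vadd p x y : pe p (vadd x y) = vadd (pe p x) (pe p y).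
Proof.
elim/poly_ind: p => [|p c IH]; first by rewrite !pe0; apply/funext => j; rewrite /vadd addr0.
by rewrite !pe_MXaddC IH cmv_vadd; apply/funext => j; rewrite /vadd /vscale; ring.
Qed.

Lemma pe_vscale p a x : pe p (vscale a x) = vscale a (pe p x).
Proof.
elim/poly_ind: p => [|p c IH]; first by rewrite !pe0; apply/funext => j; rewrite /vscale mulr0.
by rewrite !pe_MXaddC IH cmv_vscale; apply/funext => j; rewrite /vadd /vscale; ring.
Qed.

Lemma pe_add p q x : pe (p + q) x = vadd (pe p x) (pe q x).
Proof.
elim/poly_ind: p q => [|p c IH] q.
  by rewrite add0r pe0; apply/funext => j; rewrite /vadd add0r.
have [q' [d ->]] := poly_MXaddC q.
rewrite addrACA -mulrDl -polyCD !pe_MXaddC IH cmv_vadd.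
by apply/funext => j; rewrite /vadd /vscale; ring.
Qed.

Lemma pe_scale a p x : pe (a *: p) x = vscale a (pe p x).
Proof.
elim/poly_ind: p => [|p c IH].
  by rewrite scaler0 pe0; apply/funext => j; rewrite /vscale mulr0.
rewrite scalerDr scalerAl scale_polyC !pe_MXaddC IH cmv_vscale.
by apply/funext => j; rewrite /vadd /vscale; ring.
Qed.

Lemma pe_mul p q x : pe (p * q) x = pe p (pe q x).
Proof.
elim/poly_ind: p => [|p c IH]; first by rewrite mul0r !pe0.
rewrite mulrDl mulrAC mul_polyC pe_add pe_scale pe_MXaddC -IH.
have -> : p * q * 'X = p * q * 'X + 0%:P by rewrite addr0.
rewrite pe_MXaddC; apply/funext => j; rewrite /vadd /vscale; ring.
Qed.

Lemma pe1 x : pe 1 x = x.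
Proof.
have -> : (1 : {poly C}) = 0 * 'X + 1%:P by rewrite mul0r add0r.
by rewrite pe_MXaddC pe0 cmv0; apply/funext => j; rewrite /vadd /vscale mul1r addr0.
Qed.

Lemma peX x : pe 'X x = E x.
Proof.
have -> : ('X : {poly C}) = 1 * 'X + 0%:P by rewrite mul1r addr0.
by rewrite pe_MXaddC pe1; apply/funext => j; rewrite /vadd /vscale mul0r add0r.
Qed.

Lemma cbmeas_horner p : cbmeas (fun x : circle R => p.[cval x]).
Proof.
elim/poly_ind: p => [|p c IH].
  have := cbmeas_cst (0 : C); congr cbmeas; apply/funext => x; by rewrite horner0.
have := cbmeasD (cbmeasM IH (cbmeas_cval R)) (cbmeas_cst c).
by congr cbmeas; apply/funext => x; rewrite hornerMXaddC.
Qed.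

Lemma l2_iter_cmv n x : l2 x -> l2 (iter n E x).
Proof. by move=> lx; elim: n => [//|n IH] /=; exact: l2_cmv. Qed.

Lemma nrm2_iter_cmv n x : l2 x -> nrm2 (iter n E x) = nrm2 x.
Proof. by move=> lx; elim: n => [//|n IH] /=; rewrite nrm2_cmv//; exact: l2_iter_cmv. Qed.

Lemma iter_cmv_vadd n x y : iter n E (vadd x y) = vadd (iter n E x) (iter n E y).
Proof. by elim: n => [//|n IH] /=; rewrite IH cmv_vadd. Qed.

Lemma iter_cmv_vscale n c x : iter n E (vscale c x) = vscale c (iter n E x).
Proof. by elim: n => [//|n IH] /=; rewrite IH cmv_vscale. Qed.

End cmv_operator.

(** * Moments of the spectral measure and polynomial functional calculus *)

Section spectral_moments.
Variable R : realType.
Local Notation C := R[i].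
Local Notation Re := complex.Re.
Variable alpha : int -> C.
Hypothesis alpha_in_D : forall n : int, normc (alpha n) < 1.
Variables (mu : {finite_measure set (circle R) -> \bar R}) (phi : int -> C).
Hypothesis lphi : l2 phi.
Hypothesis spec : is_spectral_measure alpha phi mu.
Local Notation E := (cmv alpha).
Local Notation I f := (\int[mu]_x (f x)).

Lemma norm_integ_le f M : bmeas f -> (forall x, `|f x| <= M) -> `|I f| <= M * fine (mu setT).
Proof.
move=> bf fM.
have h1 : I f <= I (fun=> M).
  by apply: le_integ => // [|x]; [exact: bmeas_cst|exact: le_trans (ler_norm _) (fM x)].
have h2 : I (fun=> - M) <= I f.
  by apply: le_integ => // [|x]; [exact: bmeas_cst|move: (fM x); rewrite ler_norml => /andP[]].
rewrite !integ_cst in h1 h2.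
by rewrite ler_norml h1 andbT -mulNr.
Qed.

Lemma abs_Re_le (x : C) : `|Re x| <= normc x.
Proof.
rewrite ler_norml Re_le_normc andbT lerNl -Re_opp -(normc_opp x).
exact: Re_le_normc.
Qed.

Lemma cbmeasX f n : cbmeas f -> cbmeas (fun x : circle R => (f x : C) ^+ n).
Proof.
move=> bf; elim: n => [|n IH].
  by have := @cbmeas_cst R 1; congr cbmeas; apply/funext => x; rewrite expr0.
by have := cbmeasM bf IH; congr cbmeas; apply/funext => x; rewrite exprS.
Qed.

Lemma Re_mul_cintegral c f : cbmeas f -> Re (c * cintegral mu f) = I (fun x => Re (c * f x)).
Proof.
move=> [b1 b2]; rewrite Re_mul /cintegral /=.
rewrite -!integZ// -mulN1r -integZ; last by apply: bmeasM => //; exact: bmeas_cst.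
rewrite -integD.
- by apply: eq_Rintegral => x _; rewrite Re_mul mulN1r.
- by apply: bmeasM => //; exact: bmeas_cst.
- by apply: bmeasM; [exact: bmeas_cst|apply: bmeasM => //; exact: bmeas_cst].
Qed.

(** [A k t] compares operator and measure at w = 1/t, and [d k] is the discrepancy of the k-th
    moments. The resolvent equation on one side and division by x - w on the other give A_k = t
    (A_(k+1) - d_k). The spectral hypothesis is A_0 = 0. If A_k vanishes, A_(k+1) is the constant
    d_k; since A_(k+2) is bounded in t, the next instance of the recursion makes d_k of order t,
    hence 0. *)
Lemma spectral_moment n c :
  rip phi (vscale c (iter n E phi)) = I (fun x => Re (c * cval x ^+ n)).
Proof.
pose w (t : R) : C := (t^-1)%:C.
pose psi t := resolvent alpha (w t) phi.
pose tr (t : R) := 0 < t <= 1 / 2.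
have w2 t : tr t -> 2 <= normc (w t).
  move=> /andP[t0 t1]; rewrite /w normc_real ?invr_ge0 ?(ltW t0)//.
  by rewrite -[2]invrK lef_pV2 ?posrE ?invr_gt0//; lra.
have w1 t : tr t -> normc (w t) != 1 by move=> /w2; apply: contraTN => /eqP ->; rewrite -ltNge ltr1n.
have lpsi t : tr t -> l2 (psi t) by move=> /w1/(resolventP alpha_in_D lphi) [].
have epsi t : tr t -> E (psi t) = vadd phi (vscale (w t) (psi t)).
  by move=> /w1/(resolventP alpha_in_D lphi) [].
(* From w psi = E psi - phi one gets |w|^2 |psi|^2 <= 2 (|psi|^2 + |phi|^2), and |w|^2 >= 4. *)
have npsi t : tr t -> nrm2 (psi t) <= nrm2 phi.
  move=> ht; have hw := w2 t ht.
  have h : vscale (w t) (psi t) = vadd (E (psi t)) (vscale (-1) phi).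
    by rewrite epsi//; apply/funext => j; rewrite /vadd /vscale; ring.
  have := nrm2D_le2 (l2_cmv alpha_in_D (lpsi t ht)) (l2Z (-1) lphi).
  rewrite -h !nrm2Z ?nrm2_cmv//; try exact: lpsi.
  have -> : sq (-1 : C) = 1 by rewrite sqN -sq_normc ComplexField.Normc.normc1 expr1n.
  rewrite -sq_normc => h2.
  have h4 : 0 <= (normc (w t) ^+ 2 - 4) * nrm2 (psi t) by rewrite mulr_ge0 ?nrm2_ge0//; nra.
  move: h2 h4; move: (normc (w t) ^+ 2) (nrm2 (psi t)) (nrm2 phi) => X Y Z; nra.
pose kern k t (x : circle R) := cval x ^+ k * (cval x - w t)^-1.
have bkern k t : tr t -> cbmeas (kern k t).
  by move=> ht; apply: cbmeasM; [exact/cbmeasX/cbmeas_cval|apply: cbmeas_cauchy; exact: w1].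
have bpow k : cbmeas (fun x : circle R => c * cval x ^+ k).
  by apply: cbmeasM; [exact: cbmeas_cst|exact/cbmeasX/cbmeas_cval].
have bckern k t : tr t -> cbmeas (fun x => c * kern k t x).
  by move=> ht; apply: cbmeasM; [exact: cbmeas_cst|exact: bkern].
pose A k t := rip phi (vscale c (iter k E (psi t))) - I (fun x => Re (c * kern k t x)).
pose d k := rip phi (vscale c (iter k E phi)) - I (fun x => Re (c * cval x ^+ k)).
have lit k x : l2 x -> l2 (vscale c (iter k E x)) by move=> lx; apply: l2Z; exact: (l2_iter_cmv alpha_in_D).
have rec k t : tr t -> A k t = t * (A k.+1 t - d k).
  move=> ht; have /andP[t0 _] := ht.
  have e1 : rip phi (vscale c (iter k.+1 E (psi t))) =
      rip phi (vscale c (iter k E phi)) + t^-1 * rip phi (vscale c (iter k E (psi t))).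
    rewrite iterSr epsi// iter_cmv_vadd iter_cmv_vscale.
    rewrite -ripZr//; last by apply: lit; exact: lpsi.
    rewrite -ripDr//; [|exact: lit|by apply/l2Z/lit; exact: lpsi].
    by congr rip; apply/funext => j; rewrite /vadd /vscale /w; ring.
  have e2 : I (fun x => Re (c * kern k.+1 t x)) =
      I (fun x => Re (c * cval x ^+ k)) + t^-1 * I (fun x => Re (c * kern k t x)).
    rewrite -integZ; last exact: (bckern _ _ ht).1.
    rewrite -integD; [|exact: (bpow k).1|by apply: bmeasM; [exact: bmeas_cst|exact: (bckern _ _ ht).1]].
    apply: eq_Rintegral => x _.
    have -> : kern k.+1 t x = cval x ^+ k + w t * kern k t x.
      have nz : cval x - w t != 0.
        apply/eqP => z; have := sq_cval_sub_gt0 x (w1 t ht); by rewrite z sq0 ltxx.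
      apply: (mulIf nz); rewrite mulrDl /kern -!mulrA mulVf// !mulr1 exprS; ring.
    by rewrite mulrDr Re_add mulrCA [Re (w t * _)]Re_mul Im_real mul0r subr0.
  rewrite /A /d e1 e2; field; by rewrite gt_eqF.
have A0 t : tr t -> A 0%N t = 0.
  move=> ht; rewrite /A /= -Re_mul_inner//; last exact: lpsi.
  rewrite spec; last by apply/eqP; exact: w1.
  rewrite Re_mul_cintegral; last by apply: cbmeas_cauchy; exact: w1.
  apply/eqP; rewrite subr_eq0; apply/eqP; apply: eq_Rintegral => x _.
  by rewrite /kern expr0 mul1r.
pose K := nrm2 phi + sq c * nrm2 phi + normc c * fine (mu setT).
have AK k t : tr t -> `|A k t| <= K.
  move=> ht; apply: le_trans (ler_normB _ _) _; apply: lerD.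
    apply: le_trans (rip_le lphi (lit _ _ (lpsi t ht))) _.
    have lps := lpsi t ht.
    rewrite lerD2l (nrm2Z c (l2_iter_cmv alpha_in_D k lps)) (nrm2_iter_cmv alpha_in_D k lps).
    by rewrite ler_wpM2l ?sq_ge0 ?npsi.
  apply: norm_integ_le; first exact: (bckern _ _ ht).1.
  move=> x; apply: le_trans (abs_Re_le _) _.
  rewrite /kern ComplexField.Normc.normcM ler_piMr ?normc_ge0//.
  rewrite ComplexField.Normc.normcM.
  have -> : normc (cval x ^+ k) = 1.
    elim: k => [|k IH]; first by rewrite expr0 ComplexField.Normc.normc1.
    by rewrite exprS ComplexField.Normc.normcM IH normc_cval mulr1.
  rewrite mul1r ComplexField.Normc.normcV invf_le1.
    have h1 := normc_add (w t - cval x) (cval x).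
    rewrite subrK normc_cval -opprB normc_opp in h1; have := w2 t ht; lra.
  by rewrite normc_sqrt sqrtr_gt0 sq_cval_sub_gt0// w1.
have tr2 : tr (1 / 2) by rewrite /tr; apply/andP; split; lra.
have step k : (forall t, tr t -> A k t = 0) -> d k = 0 /\ (forall t, tr t -> A k.+1 t = 0).
  move=> h.
  have dA t : tr t -> A k.+1 t = d k.
    move=> ht; have := rec k t ht; rewrite h// => /esym/eqP.
    have /andP[t0 _] := ht.
    by rewrite mulf_eq0 gt_eqF//= subr_eq0 => /eqP.
  have small t : tr t -> `|d k| <= t * (K + `|d k.+1|).
    move=> ht; rewrite -(dA t ht) rec// normrM; have /andP[t0 _] := ht.
    rewrite gtr0_norm// ler_wpM2l ?(ltW t0)//.
    by apply: le_trans (ler_normB _ _) _; rewrite lerD2r AK.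
  have d0 : d k = 0.
    apply/eqP; rewrite -normr_le0 leNgt; apply/negP => dk.
    set B := K + `|d k.+1| in small.
    have B0 : 0 <= B by have := small _ tr2; lra.
    pose t := Num.min (1 / 2) (`|d k| / (2 * (B + 1))).
    have B1 : 0 < B + 1 by rewrite ltr_wpDl.
    have tt : tr t.
      rewrite /tr /t ge_min lexx /= andbT lt_min divr_gt0//=.
      by rewrite divr_gt0// mulr_gt0.
    have := small _ tt; apply/negP; rewrite -ltNge.
    apply: le_lt_trans (_ : `|d k| / (2 * (B + 1)) * B < _).
      by rewrite ler_wpM2r// /t ge_min lexx orbT.
    rewrite mulrAC ltr_pdivrMr ?mulr_gt0// ltr_pM2l//; lra.
  by split=> // t ht; rewrite dA.
have all k : forall t, tr t -> A k t = 0.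
  by elim: k => [//|k IH]; exact: (step k IH).2.
by apply/eqP; rewrite -subr_eq0; apply/eqP; exact: (step n (all n)).1.
Qed.

Lemma rip_phi_pe k (p : {poly C}) :
  rip phi (pe alpha p (iter k E phi)) = I (fun x => Re (p.[cval x] * cval x ^+ k)).
Proof.
elim/poly_ind: p k => [|p c IH] k.
  rewrite pe0 /rip (@rsum_single _ 0) => [|j _]; last by rewrite mulr0.
  rewrite mulr0; transitivity (I (fun=> 0)); first by rewrite integ_cst mul0r.
  by apply: eq_Rintegral => x _; rewrite horner0 mul0r.
rewrite pe_MXaddC -pe_cmv -iterS ripDr//; last 2 first.
- by apply: l2Z; exact: (l2_iter_cmv alpha_in_D).
- by apply: (l2_pe alpha_in_D) => //; exact: (l2_iter_cmv alpha_in_D).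
rewrite IH spectral_moment -integD.
- by apply: eq_Rintegral => x _; rewrite hornerMXaddC mulrDl Re_add addrC exprS mulrA.
- have : cbmeas (fun x : circle R => c * cval x ^+ k).
    by apply: cbmeasM; [exact: cbmeas_cst|exact/cbmeasX/cbmeas_cval].
  by case.
- have : cbmeas (fun x : circle R => p.[cval x] * cval x ^+ k.+1).
    by apply: cbmeasM; [exact: cbmeas_horner|exact/cbmeasX/cbmeas_cval].
  by case.
Qed.

(** One factor [E] can be removed from both arguments: by unitarity for the operator, by conj x * x
    = 1 for the integral. What remains of the constant terms are inner products with [phi]
    itself. *)
Lemma rip_pe (p q : {poly C}) :
  rip (pe alpha p phi) (pe alpha q phi) = I (fun x => Re ((p.[cval x])^* * q.[cval x])).
Proof.
have lpe s : l2 (pe alpha s phi) by exact: (l2_pe alpha_in_D).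
have one s : rip phi (pe alpha s phi) = I (fun x => Re s.[cval x]).
  by rewrite (rip_phi_pe 0); apply: eq_Rintegral => x _; rewrite expr0 mulr1.
have bh s : bmeas (fun x : circle R => Re s.[cval x]) by case: (cbmeas_horner s).
elim/poly_ind: p q => [|p c IH] q.
  rewrite pe0 /rip (@rsum_single _ 0) => [|j _]; last by rewrite rmorph0 mul0r.
  rewrite rmorph0 mul0r; transitivity (I (fun=> 0)); first by rewrite integ_cst mul0r.
  by apply: eq_Rintegral => x _; rewrite horner0 rmorph0 mul0r.
have [q' [d ->]] := poly_MXaddC q.
set Q := q' * 'X + d%:P.
rewrite pe_MXaddC ripDl//; [|exact: l2Z|exact: (l2_cmv alpha_in_D)].
rewrite rip_conj -pe_scale one.
have -> : rip (E (pe alpha p phi)) (pe alpha Q phi) =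
    rip phi (pe alpha (d^* *: (p * 'X)) phi) + rip (pe alpha p phi) (pe alpha q' phi).
  rewrite /Q pe_MXaddC ripDr//; [|exact: (l2_cmv alpha_in_D)|exact: l2Z|exact: (l2_cmv alpha_in_D)].
  rewrite rip_cmv//; congr (_ + _).
  rewrite ripC rip_conj pe_scale; congr (rip _ (vscale _ _)).
  have -> : p * 'X = p * 'X + 0%:P by rewrite addr0.
  by rewrite pe_MXaddC; apply/funext => j; rewrite /vadd /vscale mul0r add0r.
rewrite one IH -!integD//; last first.
- have : cbmeas (fun x : circle R => (p.[cval x])^* * q'.[cval x]).
    by apply: cbmeasM; [exact/cbmeas_conj/cbmeas_horner|exact: cbmeas_horner].
  by case.
- apply: bmeasD => //.
  have : cbmeas (fun x : circle R => (p.[cval x])^* * q'.[cval x]).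
    by apply: cbmeasM; [exact/cbmeas_conj/cbmeas_horner|exact: cbmeas_horner].
  by case.
apply: eq_Rintegral => x _.
rewrite /Q !hornerZ hornerM hornerX !hornerMXaddC.
have z1 := conj_mul_cval x.
have -> : Re (d^* * (p.[cval x] * cval x)) = Re ((p.[cval x] * cval x)^* * d).
  by rewrite !ReImE; ring.
rewrite -!Re_add; congr Re; rewrite rmorphD !rmorphM.
transitivity (c^* * (q'.[cval x] * cval x + d) + ((p.[cval x])^* * (cval x)^* * d +
   ((cval x)^* * cval x) * ((p.[cval x])^* * q'.[cval x]))); first by rewrite z1 mul1r.
ring.
Qed.

End spectral_moments.

(** * Damping polynomials: the identity behind one factor *)

Section damping_polynomials.
Variable R : realType.
Local Notation C := R[i].
Local Notation Re := complex.Re.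
Variable alpha : int -> C.
Hypothesis alpha_in_D : forall n : int, normc (alpha n) < 1.
Local Notation E := (cmv alpha).
Implicit Types (p q : {poly C}) (x y psi : int -> C) (z w : C) (r : R).

Lemma conj_real_mul (k : R) (v : C) : ((k%:C * v)^*)%R = k%:C * (v^*)%R.
Proof. by rewrite rmorphM; congr (_ * _); apply/eqP; rewrite eq_complex /= oppr0 !eqxx. Qed.

Lemma sq_one_sub (v : C) : sq (1 - v) = 1 - 2 * Re v + sq v.
Proof.
have -> : (1 : C) = (1 : R)%:C by rewrite rmorph1.
by rewrite !sqE !Re_add !Im_add !Re_opp !Im_opp Re_real Im_real; ring.
Qed.

(** The truncated Neumann series of (1 - conj w E)^-1. *)
Definition geom_poly w (N : nat) : {poly C} := \sum_(i < N) (w^* *: 'X) ^+ i.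

Lemma geom_polyE w N : (1 - w^* *: 'X) * geom_poly w N = 1 - (w^* *: 'X) ^+ N.
Proof. by rewrite -opprB mulNr -subrX1 opprB. Qed.

Lemma nrm2_sub x y : l2 x -> l2 y ->
  nrm2 (vadd x (vscale (-1) y)) = nrm2 x + nrm2 y - 2 * rip x y.
Proof.
move=> lx ly; have -> : (-1 : C) = (-1)%:C by rewrite rmorphN rmorph1.
by rewrite nrm2D ?nrm2Z ?ripZr ?sq_real//; [ring|exact: l2Z].
Qed.

Lemma pe_sub p q x : pe alpha (p - q) x = vadd (pe alpha p x) (vscale (-1) (pe alpha q x)).
Proof. by rewrite pe_add -scaleN1r pe_scale. Qed.

Lemma pe_linear w y : pe alpha (1 - w^* *: 'X) y = vadd y (vscale (-1) (vscale w^* (E y))).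
Proof. by rewrite pe_sub pe1 pe_scale peX. Qed.

Lemma nrm2_pe_linear w y : l2 y ->
  nrm2 (pe alpha (1 - w^* *: 'X) y) = (1 + sq w) * nrm2 y - 2 * rip y (vscale w^* (E y)).
Proof.
move=> ly; have lE := l2_cmv alpha_in_D ly.
rewrite pe_linear nrm2_sub ?nrm2Z ?nrm2_cmv ?sq_conj//; [ring|exact: l2Z].
Qed.

(** For unitary [E], the operators E - w and 1 - conj w E have the same norm on each vector. For |w|
    < 1 the second one is inverted by a series in nonnegative powers of [E], hence by polynomials up
    to a small remainder. *)
Lemma nrm2_cmv_sub w y : l2 y ->
  nrm2 (vadd (E y) (vscale (-1) (vscale w y))) = nrm2 (pe alpha (1 - w^* *: 'X) y).
Proof.
move=> ly; have lE := l2_cmv alpha_in_D ly.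
rewrite nrm2_pe_linear// nrm2_sub ?nrm2Z ?nrm2_cmv//; last exact: l2Z.
by rewrite ripC rip_conj; ring.
Qed.

Lemma nrm2_pe_monomial z N x : sq z = 1 -> l2 x ->
  nrm2 (pe alpha ((z^* *: 'X) ^+ N) x) = nrm2 x.
Proof.
move=> z1 lx; elim: N => [|N IH]; first by rewrite expr0 pe1.
have lp := l2_pe alpha_in_D ((z^* *: 'X) ^+ N) lx.
have lE := l2_cmv alpha_in_D lp.
by rewrite exprS pe_mul pe_scale peX nrm2Z// sq_conj z1 mul1r nrm2_cmv.
Qed.

Section one_factor.
Variables (z : C) (r : R) (N : nat).
Hypotheses (z1 : sq z = 1) (r0 : 0 < r) (r1 : r < 1).
Let w := r%:C * z.
Let tau := r ^+ N.

Lemma tau_ge0 : 0 <= tau. Proof. by rewrite exprn_ge0// ltW. Qed.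
Lemma tau_le1 : tau <= 1. Proof. by rewrite exprn_ile1// ltW. Qed.

Lemma sq_w : sq w = r ^+ 2.
Proof. by rewrite sqM sq_real z1 mulr1. Qed.

Lemma w_monomial : (w^* *: 'X) ^+ N = tau%:C *: (z^* *: 'X) ^+ N :> {poly C}.
Proof.
have -> : w^* *: 'X = r%:C *: (z^* *: 'X) :> {poly C}.
  by rewrite scalerA /w conj_real_mul.
by rewrite exprZn -rmorphXn.
Qed.

(** The monomial acts as [tau] times an isometry, so both bounds are triangle inequalities. *)
Lemma nrm2_geom_residue x : l2 x ->
  (1 - tau) ^+ 2 * nrm2 x <= nrm2 (pe alpha (1 - (w^* *: 'X) ^+ N) x) <= (1 + tau) ^+ 2 * nrm2 x.
Proof.
move=> lx; set u := pe alpha ((z^* *: 'X) ^+ N) x.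
have lu : l2 u by exact: l2_pe.
have nu : nrm2 u = nrm2 x by exact: nrm2_pe_monomial.
rewrite pe_sub pe1 w_monomial pe_scale -/u nrm2_sub//; last exact: l2Z.
rewrite nrm2Z// sq_real nu ripZr//.
have := rip_le_half lx lu; rewrite nu => h.
have := ler_wpM2l tau_ge0 h; have := ler_norm (rip x u); have := ler_norm (- rip x u).
rewrite normrN => h1 h2 h3.
have h4 := ler_wpM2l tau_ge0 h1; have h5 := ler_wpM2l tau_ge0 h2.
by apply/andP; split; nra.
Qed.

(* An approximation of [(1 - conj z E) (1 - conj w E)^-1]: its symbol has modulus at most [1] on
   the circle and is small at distance at most [1 - r] from [z], while [nrm2_damping] bounds
   what it removes from a vector by the resolvent at [w]. *)
Definition damping_poly : {poly C} :=
  (Num.sqrt r / (1 + tau))%:C *: ((1 - z^* *: 'X) * geom_poly w N).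

(** Everything rests on r |(1 - conj z E) y|^2 = |(1 - conj w E) y|^2 - (1 - r)^2 |y|^2, true
    because (1 + r^2) - (1 - r)^2 = 2 r. This explains the factor sqrt r in [damping_poly]; the
    denominator 1 + tau pays for the truncation. *)
Lemma nrm2_damping x : l2 x -> (1 + tau) ^+ 2 * nrm2 (pe alpha damping_poly x) =
  nrm2 (pe alpha (1 - (w^* *: 'X) ^+ N) x) - (1 - r) ^+ 2 * nrm2 (pe alpha (geom_poly w N) x).
Proof.
move=> lx; set y := pe alpha (geom_poly w N) x.
have ly : l2 y by exact: l2_pe.
have lE : l2 (E y) by exact: l2_cmv.
have t0 : 1 + tau != 0 by rewrite gt_eqF// ltr_pwDl// tau_ge0.
rewrite -geom_polyE pe_mul -/y /damping_poly pe_scale pe_mul -/y.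
rewrite nrm2Z; last exact: l2_pe.
rewrite sq_real expr_div_n sqr_sqrtr ?(ltW r0)// !nrm2_pe_linear// z1 sq_w.
have -> : vscale w^* (E y) = vscale r%:C (vscale z^* (E y)).
  by apply/funext => j; rewrite /vscale /w [conjc _]conj_real_mul mulrA.
rewrite ripZr//; last exact: l2Z.
by field.
Qed.

Lemma damping_contraction x : l2 x -> nrm2 (pe alpha damping_poly x) <= nrm2 x.
Proof.
move=> lx; have t0 : 0 < (1 + tau) ^+ 2 by rewrite exprn_gt0// ltr_pwDl// tau_ge0.
rewrite -(ler_pM2l t0) nrm2_damping//.
have /andP[_ h] := nrm2_geom_residue lx; apply: le_trans h.
by rewrite gerBl mulr_ge0 ?sqr_ge0 ?nrm2_ge0.
Qed.

(** The remainder 4 tau is (1 + tau)^2 - (1 - tau)^2. *)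
Lemma damping_defect x : l2 x -> nrm2 x - nrm2 (pe alpha damping_poly x) <=
  (1 - r) ^+ 2 * nrm2 (pe alpha (geom_poly w N) x) + 4 * tau * nrm2 x.
Proof.
move=> lx; have t0 : 0 < (1 + tau) ^+ 2 by rewrite exprn_gt0// ltr_pwDl// tau_ge0.
have t1 : 1 <= (1 + tau) ^+ 2 by rewrite expr_ge1// ?lerDl ?addr_ge0 ?tau_ge0.
rewrite -(ler_pM2l t0) mulrBr (nrm2_damping lx).
have /andP[h _] := nrm2_geom_residue lx.
have n0 := nrm2_ge0 x.
have y0 : 0 <= (1 - r) ^+ 2 * nrm2 (pe alpha (geom_poly w N) x) by rewrite mulr_ge0 ?sqr_ge0 ?nrm2_ge0.
have h1 : 0 <= ((1 + tau) ^+ 2 - 1) * ((1 - r) ^+ 2 * nrm2 (pe alpha (geom_poly w N) x) + 4 * tau * nrm2 x).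
  by rewrite mulr_ge0 ?subr_ge0// addr_ge0// !mulr_ge0// tau_ge0.
rewrite -subr_ge0 in h; rewrite -subr_ge0; apply: le_trans (addr_ge0 h h1) _.
by rewrite le_eqVlt; apply/orP; left; apply/eqP; ring.
Qed.

Lemma sq_one_sub_ge (v : C) : (1 - normc v) ^+ 2 <= sq (1 - v).
Proof. exact: sq_cval_sub_ge (circle1 R) v. Qed.

(** The identity of [nrm2_damping] with [E] replaced by a point of the circle. *)
Lemma damping_symbol (x : circle R) : (1 + tau) ^+ 2 * sq damping_poly.[cval x] =
  sq (1 - (w^* * cval x) ^+ N) - (1 - r) ^+ 2 * sq (geom_poly w N).[cval x].
Proof.
have t0 : 1 + tau != 0 by rewrite gt_eqF// ltr_pwDl// tau_ge0.
have hl v : (1 - v^* *: 'X : {poly C}).[cval x] = 1 - v^* * cval x.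
  by rewrite hornerD hornerN hornerZ hornerX hornerC.
have hp : (1 - (w^* *: 'X) ^+ N : {poly C}).[cval x] = 1 - (w^* * cval x) ^+ N.
  by rewrite hornerD hornerN horner_exp hornerZ hornerX hornerC.
rewrite -hp -geom_polyE hornerM hl /damping_poly hornerZ hornerM hl !sqM sq_real.
rewrite expr_div_n sqr_sqrtr ?(ltW r0)//.
have h : r * sq (1 - z^* * cval x) = sq (1 - w^* * cval x) - (1 - r) ^+ 2.
  have er v : Re (r%:C * v) = r * Re v by rewrite Re_mul Re_real Im_real mul0r subr0.
  rewrite /w conj_real_mul -mulrA !sq_one_sub er !sqM.
  by rewrite sq_real sq_conj z1 sq_cval; ring.
rewrite mulrA -mulrBl -h; field; exact: t0.
Qed.

End one_factor.
End damping_polynomials.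

(** * Size of one factor and cyclicity *)

Section damping_bounds.
Variable R : realType.
Local Notation C := R[i].
Local Notation Re := complex.Re.
Variable alpha : int -> C.
Hypothesis alpha_in_D : forall n : int, normc (alpha n) < 1.
Local Notation E := (cmv alpha).
Implicit Types (p q : {poly C}) (x y psi : int -> C).

Section one_factor.
Variables (z : circle R) (r : R) (N : nat).
Hypotheses (r0 : 0 < r) (r1 : r < 1).
Let w := r%:C * cval z.
Let tau := r ^+ N.
Let z1 := sq_cval z.

Lemma normc_conj_mul_pow (x : circle R) : normc ((w^* * cval x) ^+ N) = tau.
Proof.
have h : normc (w^* * cval x) = r.
  by rewrite ComplexField.Normc.normcM normc_conj normc_cval mulr1 normc_rad// ltW.
rewrite /tau; elim: N => [|n IH]; first by rewrite !expr0 ComplexField.Normc.normc1.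
by rewrite !exprS ComplexField.Normc.normcM IH h.
Qed.

Lemma damping_symbol_le1 (x : circle R) : sq (damping_poly (cval z) r N).[cval x] <= 1.
Proof.
have t0 := tau_ge0 N r0.
have t1 : 0 < (1 + tau) ^+ 2 by rewrite exprn_gt0// ltr_pwDl.
rewrite -(ler_pM2l t1) (damping_symbol N z1 r0) mulr1.
apply: le_trans (_ : sq (1 - (w^* * cval x) ^+ N) <= _).
  by rewrite gerBl mulr_ge0 ?sqr_ge0 ?sq_ge0.
rewrite -sq_normc ler_pXn2r ?nnegrE ?normc_ge0 ?addr_ge0//.
by apply: le_trans (normc_add _ _) _; rewrite ComplexField.Normc.normc1 normc_opp normc_conj_mul_pow.
Qed.

(** Within 1 - r of z one has |1 - conj w x| <= 2 (1 - r). The geometric sum is then at least (1 -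
    tau) / (2 (1 - r)) in modulus, and the subtracted term at least (1 - tau)^2 / 4. For tau <= 1/8
    this exceeds (1 + tau)^2 / 8, whence 7/8. *)
Lemma damping_symbol_ball (x : circle R) : tau <= 1 / 8 ->
  sq (cval x - cval z) <= (1 - r) ^+ 2 -> sq (damping_poly (cval z) r N).[cval x] <= 7 / 8.
Proof.
move=> t8 xz.
have t0 : 0 <= tau := tau_ge0 N r0.
have t1 : 0 < (1 + tau) ^+ 2 by rewrite exprn_gt0// ltr_pwDl.
have d0 : 0 < 1 - r by rewrite subr_gt0.
rewrite -(ler_pM2l t1) (damping_symbol N z1 r0) -/w.
set v := (w^* * cval x) ^+ N.
have nv : normc v = tau by exact: normc_conj_mul_pow.
have u1 : sq (1 - v) <= (1 + tau) ^+ 2.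
  rewrite -sq_normc ler_pXn2r ?nnegrE ?normc_ge0 ?addr_ge0//.
  by apply: le_trans (normc_add _ _) _; rewrite ComplexField.Normc.normc1 normc_opp nv.
have u2 : (1 - tau) ^+ 2 <= sq (1 - v) by rewrite -nv; exact: sq_one_sub_ge.
have geo : sq (1 - w^* * cval x) * sq (geom_poly w N).[cval x] = sq (1 - v).
  have := congr1 (fun p => sq p.[cval x]) (geom_polyE w N).
  by rewrite hornerM !hornerD !hornerN horner_exp !hornerZ hornerX hornerC sqM => ->.
have den : sq (1 - w^* * cval x) <= 4 * (1 - r) ^+ 2.
  have -> : sq (1 - w^* * cval x) = sq (cval x - w).
    have e : sq (cval x - w) = sq (cval x) - 2 * Re (w^* * cval x) + sq w.
      by rewrite !sqE !ReImE; ring.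
    by rewrite e sq_one_sub sqM sq_conj sq_cval mulr1.
  have -> : cval x - w = (cval x - cval z) + (1 - r)%:C * cval z.
    by rewrite /w rmorphB rmorph1; ring.
  apply: le_trans (sqD_le2 _ _) _; rewrite [sq (_ * cval z)]sqM sq_real z1 mulr1; lra.
have s0 := sq_ge0 (geom_poly w N).[cval x].
have low : (1 - tau) ^+ 2 / 4 <= (1 - r) ^+ 2 * sq (geom_poly w N).[cval x].
  rewrite ler_pdivrMr//; apply: (le_trans u2); rewrite -geo.
  by apply: le_trans (ler_wpM2r s0 den) _; rewrite le_eqVlt; apply/orP; left; apply/eqP; ring.
have t3 : (1 + tau) ^+ 2 / 8 <= (1 - tau) ^+ 2 / 4 by nra.
by move: low u1 t3; lra.
Qed.

End one_factor.

(** Since phi = (E - w) psi, the left side is the squared norm of the geometric sum times 1 - conj w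
    E applied to [psi]. This telescopes to [psi] minus tau times an isometric image, and (1 + tau)^2
    <= 4. *)
Lemma nrm2_geom_le (w : C) (z : C) (r : R) N phi psi : sq z = 1 -> 0 < r -> r < 1 ->
  w = r%:C * z -> l2 psi -> E psi = vadd phi (vscale w psi) ->
  nrm2 (pe alpha (geom_poly w N) phi) <= 4 * nrm2 psi.
Proof.
move=> z1 r0 r1 wE lpsi e.
have -> : phi = vadd (E psi) (vscale (-1) (vscale w psi)).
  by rewrite e; apply/funext => j; rewrite /vadd /vscale; ring.
have ly : l2 (pe alpha (geom_poly w N) psi) by exact: (l2_pe alpha_in_D).
rewrite pe_vadd !pe_vscale pe_cmv (nrm2_cmv_sub alpha_in_D w ly) -pe_mul geom_polyE wE.
have /andP[_ h] := nrm2_geom_residue alpha_in_D N z1 r0 lpsi.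
apply: (le_trans h); rewrite ler_wpM2r ?nrm2_ge0//.
have := tau_ge0 N r0; have := tau_le1 N r0 r1; nra.
Qed.

(* [(1 - r^2) |psi|^2 = 1 + 2 Re (w G_kk(w))], because [E] preserves norms. *)
Lemma nrm2_resolvent_delta (k : int) (w : C) : normc w < 1 ->
  (1 - sq w) * nrm2 (resolvent alpha w (@delta R k)) = 1 + 2 * Re (w * green alpha k k w).
Proof.
move=> w1; have w1' : normc w != 1 by rewrite lt_eqF.
have [lpsi e] := resolventP alpha_in_D (l2_delta R k) w1'.
set psi := resolvent _ _ _ in lpsi e *.
rewrite /green Re_mul_inner//; last exact: l2_delta.
have := nrm2_cmv alpha_in_D lpsi; rewrite e nrm2D ?nrm2_delta ?nrm2Z//; last 2 first.
- exact: l2_delta.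
- exact: l2Z.
by rewrite -/psi; lra.
Qed.

(** The uniformity in [p] matters: [K] does not depend on the cover from which a polynomial is
    built. The vectors with this property form a subspace invariant under [E] and its inverse. *)
Definition delta_dominated x := l2 x /\ exists K, forall p,
  nrm2 (pe alpha p x) <=
  K * (nrm2 (pe alpha p (@delta R 0)) + nrm2 (pe alpha p (@delta R 1))).

Lemma delta_dominated_vadd x y : delta_dominated x -> delta_dominated y -> delta_dominated (vadd x y).
Proof.
move=> [lx [K hx]] [ly [M hy]]; split; first exact: l2D.
exists (2 * (K + M)) => p; rewrite pe_vadd.
apply: le_trans (nrm2D_le2 _ _) _; try exact: (l2_pe alpha_in_D).
rewrite -[2 * (K + M) * _]mulrA [(K + M) * _]mulrDl.
by rewrite ler_wpM2l// lerD.
Qed.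

Lemma delta_dominated_vscale c x : delta_dominated x -> delta_dominated (vscale c x).
Proof.
move=> [lx [K hx]]; split; first exact: l2Z.
exists (sq c * K) => p; rewrite pe_vscale nrm2Z; last exact: (l2_pe alpha_in_D).
by rewrite -mulrA ler_wpM2l ?sq_ge0.
Qed.

Lemma delta_dominated_cmv x : l2 x -> delta_dominated (E x) <-> delta_dominated x.
Proof.
move=> lx; have e p : nrm2 (pe alpha p (E x)) = nrm2 (pe alpha p x).
  by rewrite pe_cmv (nrm2_cmv alpha_in_D)//; exact: (l2_pe alpha_in_D).
split=> -[_ [K h]]; split.
- exact: lx.
- by exists K => p; rewrite -e; exact: h.
- exact: (l2_cmv alpha_in_D).
- by exists K => p; rewrite e; exact: h.
Qed.

Lemma delta_dominated_delta0 : delta_dominated (@delta R 0).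
Proof.
split; first exact: l2_delta.
by exists 1 => p; rewrite mul1r lerDl nrm2_ge0.
Qed.

Lemma delta_dominated_delta1 : delta_dominated (@delta R 1).
Proof.
split; first exact: l2_delta.
by exists 1 => p; rewrite mul1r lerDr nrm2_ge0.
Qed.

Lemma theta_delta_fst b (a : int -> C) j : odd `|j|%N = b ->
  theta b a (@delta R j) = vadd (vscale (a j)^* (@delta R j)) (vscale (rho a j)%:C (@delta R (j + 1))).
Proof.
move=> jb; apply/funext => i; rewrite /vadd /vscale /delta.
have [ib|ib] := eqVneq (odd `|i|%N) b.
  rewrite theta_fst// (_ : i + 1 == j = false) ?mulr0 ?addr0; last by lia.
  rewrite (_ : i == j + 1 = false) ?mulr0 ?addr0; last by lia.
  by have [->|_] := eqVneq i j; rewrite ?mulr0.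
have ib' := odd_absz_sub1_neq ib.
rewrite -{1}(subrK 1 i) theta_snd// subrK.
rewrite (_ : i == j = false) ?mulr0 ?subr0 ?add0r; last by lia.
rewrite (_ : (i - 1 == j) = (i == j + 1)); last by lia.
by have [->|_] := eqVneq i (j + 1); rewrite ?mulr0// addrK.
Qed.

Lemma theta_delta_snd b (a : int -> C) j : odd `|j|%N = b ->
  theta b a (@delta R (j + 1)) = vadd (vscale (rho a j)%:C (@delta R j)) (vscale (- a j) (@delta R (j + 1))).
Proof.
move=> jb; apply/funext => i; rewrite /vadd /vscale /delta.
have [ib|ib] := eqVneq (odd `|i|%N) b.
  rewrite theta_fst// (_ : i == j + 1 = false) ?mulr0 ?addr0 ?add0r; last by lia.
  rewrite (_ : (i + 1 == j + 1) = (i == j)); last by lia.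
  by have [->|_] := eqVneq i j; rewrite ?mulr0.
have ib' := odd_absz_sub1_neq ib.
rewrite -{1}(subrK 1 i) theta_snd// subrK.
rewrite (_ : i - 1 == j + 1 = false) ?mulr0 ?sub0r; last by lia.
rewrite (_ : i == j = false) ?mulr0 ?add0r; last by lia.
by have [->|_] := eqVneq i (j + 1); rewrite ?mulr0 ?oppr0// addrK mulNr.
Qed.

Lemma delta_dominated_cancel (c d : C) (x y : int -> C) : c != 0 -> l2 x -> delta_dominated y ->
  delta_dominated (vadd (vscale c x) (vscale d y)) -> delta_dominated x.
Proof.
move=> c0 lx gy gxy.
have -> : x = vscale c^-1 (vadd (vadd (vscale c x) (vscale d y)) (vscale (- d) y)).
  by apply/funext => j; rewrite /vadd /vscale mulNr addrK mulKf.
by apply: delta_dominated_vscale; apply: delta_dominated_vadd => //; exact: delta_dominated_vscale.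
Qed.

Lemma vaddC x y : vadd x y = vadd y x.
Proof. by apply/funext => j; rewrite /vadd addrC. Qed.

(** A factor of parity [b] maps the span of [delta j] and [delta (j + 1)] into itself. Through [E]
    or its inverse the property passes to the images under a factor of the other parity, and these
    contain [delta (j - 1)] and [delta (j + 2)] with a coefficient [rho], which is nonzero. *)
Lemma delta_dominated_step j : delta_dominated (@delta R j) -> delta_dominated (@delta R (j + 1)) ->
  delta_dominated (@delta R (j - 1)) /\ delta_dominated (@delta R (j + 2)).
Proof.
move=> g0 g1; set b := odd `|j|%N.
have rn (a : int -> C) i : (forall n, normc (a n) < 1) -> (rho a i)%:C != 0 :> C.
  by move=> aD; rewrite eq_complex /= eqxx andbT gt_eqF// rho_gt0.
have [a aD [ga0 ga1]] : exists2 a : int -> C, forall n, normc (a n) < 1 &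
    delta_dominated (theta (~~ b) a (@delta R j)) /\ delta_dominated (theta (~~ b) a (@delta R (j + 1))).
  have comb (a : int -> C) : delta_dominated (theta b a (@delta R j)) /\ delta_dominated (theta b a (@delta R (j + 1))).
    rewrite theta_delta_fst// theta_delta_snd//.
    by split; apply: delta_dominated_vadd; exact: delta_dominated_vscale.
  have cD n : normc (conj_seq alpha n) < 1 by exact: conj_seq_in_D.
  (* [theta false alpha] is [E] after [theta true (conj_seq alpha)]; the parity of [j] decides in
     which direction this is used. *)
  case bE : b comb => comb.
    exists alpha => //.
    have key x : l2 x -> delta_dominated (theta true (conj_seq alpha) x) -> delta_dominated (theta false alpha x).
      move=> lx h; have := delta_dominated_cmv (l2_theta cD true lx).
      by rewrite cmvE theta_conjKV// => -[_]; apply.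
    by have [h0 h1] := comb (conj_seq alpha); split; apply: key => //; exact: l2_delta.
  exists (conj_seq alpha) => //.
  have key x : l2 x -> delta_dominated (theta false alpha x) -> delta_dominated (theta true (conj_seq alpha) x).
    move=> lx h; have := delta_dominated_cmv (l2_theta cD true lx).
    by rewrite cmvE theta_conjKV// => -[+ _]; apply.
  by have [h0 h1] := comb alpha; split; apply: key => //; exact: l2_delta.
split.
- have ob : odd `|(j - 1)%R|%N = ~~ b by rewrite odd_absz_sub1.
  move: ga0; rewrite -{1}(subrK 1 j) theta_delta_snd// subrK => h.
  exact: delta_dominated_cancel (rn _ (j - 1) aD) (l2_delta R _) g0 h.
- have ob : odd `|(j + 1)%R|%N = ~~ b by rewrite odd_absz_add1.
  move: ga1; rewrite theta_delta_fst// vaddC -addrA => h.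
  exact: delta_dominated_cancel (rn _ (j + 1) aD) (l2_delta R _) g1 h.
Qed.

(* Cyclicity of [delta 0] and [delta 1]. *)
Lemma delta_dominated_delta k : delta_dominated (@delta R k).
Proof.
have rng n : forall j : int, - n%:Z <= j <= n%:Z + 1 -> delta_dominated (@delta R j).
  elim: n => [|n IH] j hj.
    have [->|->] : j = 0 \/ j = 1 by lia.
      exact: delta_dominated_delta0.
    exact: delta_dominated_delta1.
  have [hj'|hj'] := boolP (- n%:Z <= j <= n%:Z + 1); first exact: IH.
  have [->|->] : j = - n%:Z - 1 \/ j = n%:Z + 2 by lia.
  - by have [] // := @delta_dominated_step (- n%:Z) (IH _ _) (IH _ _); lia.
  - by have [] // := @delta_dominated_step n%:Z (IH _ _) (IH _ _); lia.
by apply: (rng `|k|%N); lia.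
Qed.

End damping_bounds.

(** * Defects of contractions and products of damping factors *)

Section damping_products.
Variable R : realType.
Local Notation C := R[i].
Variable alpha : int -> C.
Hypothesis alpha_in_D : forall n : int, normc (alpha n) < 1.
Implicit Types (p q : {poly C}) (x y phi : int -> C).

Definition contraction p := forall x, l2 x -> nrm2 (pe alpha p x) <= nrm2 x.
Definition defect p x := nrm2 x - nrm2 (pe alpha p x).

(** Parallelogram law: the defects of x + y and x - y add up to 2 (defect x + defect y), and the one
    of x - y is nonnegative. *)
Lemma defect_vadd_le p x y : contraction p -> l2 x -> l2 y ->
  defect p (vadd x y) <= 2 * (defect p x + defect p y).
Proof.
move=> cp lx ly.
have lm : l2 (vadd x (vscale (-1) y)) by apply: l2D => //; exact: l2Z.
have lpx := l2_pe alpha_in_D p lx; have lpy := l2_pe alpha_in_D p ly.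
have := cp _ lm; rewrite /defect !pe_vadd pe_vscale !nrm2_sub// !nrm2D//; lra.
Qed.

Lemma defect_vscale p c x : l2 x -> defect p (vscale c x) = sq c * defect p x.
Proof.
move=> lx; rewrite /defect pe_vscale !nrm2Z ?mulrBr//; exact: (l2_pe alpha_in_D).
Qed.

Definition restrict_seq (s : seq int) phi : int -> C := fun j => if j \in s then phi j else 0.

Lemma restrict_seq_cons k s phi : k \notin s ->
  restrict_seq (k :: s) phi = vadd (vscale (phi k) (@delta R k)) (restrict_seq s phi).
Proof.
move=> ks; apply/funext => j; rewrite /restrict_seq /vadd /vscale /delta inE.
by have [->|jk] := eqVneq j k; rewrite /= ?(negbTE ks) ?mulr1 ?addr0 ?mulr0 ?add0r.
Qed.

Lemma l2_restrict_seq s phi : uniq s -> l2 (restrict_seq s phi).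
Proof.
elim: s => [_|k s IH /= /andP[ks us]].
  have -> : restrict_seq [::] phi = (fun=> 0) by apply/funext.
  exact: l2_0.
by rewrite restrict_seq_cons//; apply: l2D; [apply: l2Z; exact: l2_delta|exact: IH].
Qed.

Lemma defect_restrict_seq s phi : uniq s -> exists2 K, 0 <= K & forall p, contraction p ->
  defect p (restrict_seq s phi) <= K * \sum_(k <- s) defect p (@delta R k).
Proof.
elim: s => [_|k s IH /= /andP[ks us]].
  exists 0 => // p _; rewrite mul0r.
  have -> : restrict_seq [::] phi = vscale 0 (@delta R 0).
    by apply/funext => j; rewrite /vscale mul0r.
  by rewrite defect_vscale ?sq0 ?mul0r//; exact: l2_delta.
have [K K0 hK] := IH us.
exists (2 * (sq (phi k) + K)); first by rewrite mulr_ge0 ?addr_ge0 ?sq_ge0.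
move=> p cp; rewrite restrict_seq_cons// big_cons.
have ld := l2_delta R k; have lr := l2_restrict_seq phi us.
apply: le_trans (defect_vadd_le cp (l2Z _ ld) lr) _.
rewrite defect_vscale//.
have d0 : 0 <= defect p (@delta R k) by rewrite subr_ge0 cp.
have s0 : 0 <= \sum_(j <- s) defect p (@delta R j).
  by apply: sumr_ge0 => j _; rewrite subr_ge0 cp//; exact: l2_delta.
have q0 := sq_ge0 (phi k); have := hK p cp.
have := mulr_ge0 K0 d0; have := mulr_ge0 q0 s0; nra.
Qed.

Lemma l2_finite_approx phi (eta : R) : l2 phi -> 0 < eta ->
  exists2 s, uniq s & exists2 y, l2 y & phi = vadd (restrict_seq s phi) y /\ nrm2 y <= eta.
Proof.
move=> lphi eta0; have /l2E sphi := lphi.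
have fin := esum_fin_num sphi (fun j => sq_ge0 (phi j)).
have [_ [A [finA _] <-] lt] := ub_ereal_sup_adherent eta0 fin.
pose s := finmap.enum_fset (fset_set A).
have us : uniq s by exact: finmap.fset_uniq.
have sA j : (j \in s) = (j \in A) by rewrite in_fset_set.
pose y := vadd phi (vscale (-1) (restrict_seq s phi)).
have ly : l2 y by apply: l2D => //; apply: l2Z; exact: l2_restrict_seq.
exists s => //; exists y => //; split.
  by apply/funext => j; rewrite /y /vadd /vscale mulN1r addrC subrK.
have yE j : sq (y j) = if j \in ~` A then sq (phi j) else 0.
  rewrite in_setC -sA /y /vadd /vscale /restrict_seq; case: (j \in s) => /=.
    by rewrite mulN1r subrr sq0.
  by rewrite mulr0 addr0.
have /l2E sy := ly.
rewrite -lee_fin /nrm2 -(esum_rsum sy (fun j => sq_ge0 (y j))).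
have -> : (\esum_(j in [set: int]) (sq (y j))%:E = \esum_(j in ~` A) (sq (phi j))%:E)%E.
  by rewrite [RHS]esum_mkcond; apply: eq_esum => j _; rewrite yE; case: ifP.
move: lt; rewrite -/(esum _ _) (esumID A) ?setTI; last by move=> j _; rewrite lee_fin sq_ge0.
rewrite esum_fset//; last by move=> j _; rewrite lee_fin sq_ge0.
rewrite fsbig_finite// sumEFin /=.
set a := \sum_(i <- _) _.
have efin : (\esum_(i in ~` A) (sq (phi i))%:E)%E \is a fin_num.
  rewrite ge0_fin_numE; last by apply: esum_ge0 => j _; rewrite lee_fin sq_ge0.
  apply: le_lt_trans (_ : _ <= (nrm2 phi)%:E)%E (ltry _).
  rewrite /nrm2 -(esum_rsum sphi (fun j => sq_ge0 (phi j))) [leRHS](esumID A) ?setTI.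
    by rewrite leeDr// esum_ge0// => j _; rewrite lee_fin sq_ge0.
  by move=> j _; rewrite lee_fin sq_ge0.
rewrite -(fineK efin) -!EFinD lte_fin lee_fin; lra.
Qed.

(** The tail [y] has defect at most |y|^2 for every contraction, so [s] and [K] depend only on [phi]
    and [eta]. *)
Lemma defect_finite_approx phi (eta : R) : l2 phi -> 0 < eta ->
  exists2 s, uniq s & exists2 K, 0 <= K & forall p, contraction p ->
    defect p phi <= eta + K * \sum_(k <- s) defect p (@delta R k).
Proof.
move=> lphi eta0.
have eta2 : 0 < eta / 2 by rewrite divr_gt0.
have [s us [y ly [phiE ny]]] := l2_finite_approx lphi eta2.
exists s => //; have [K K0 hK] := defect_restrict_seq phi us.
exists (2 * K); first by rewrite mulr_ge0.
move=> p cp; rewrite {1}phiE.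
apply: le_trans (defect_vadd_le cp (l2_restrict_seq phi us) ly) _.
have := hK p cp; have : defect p y <= nrm2 y by rewrite gerBl nrm2_ge0.
by move: ny; lra.
Qed.

Section product.
Variables (zs : nat -> circle R) (rs : nat -> R) (Ns : nat -> nat).
Hypotheses (r0 : forall i, 0 < rs i) (r1 : forall i, rs i < 1).
Let Q i := damping_poly (cval (zs i)) (rs i) (Ns i).
Let s i := geom_poly ((rs i)%:C * cval (zs i)) (Ns i).

Definition damping_prod n : {poly C} := \prod_(i < n) Q i.

Lemma damping_prod_contraction n : contraction (damping_prod n).
Proof.
elim: n => [|n IH] x lx; first by rewrite /damping_prod big_ord0 pe1.
rewrite /damping_prod big_ord_recr /= pe_mul.
have lq := l2_pe alpha_in_D (Q n) lx.
apply: (le_trans (IH _ lq)).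
by apply: (damping_contraction alpha_in_D) => //; exact: sq_cval.
Qed.

(** Telescoping: the new factor acts on a vector [u] already damped by the others. Polynomials in
    [E] commute and the product is a contraction, so in the bound [u] may be replaced by [x]. *)
Lemma damping_prod_defect n x : l2 x -> defect (damping_prod n) x <=
  \sum_(i < n) ((1 - rs i) ^+ 2 * nrm2 (pe alpha (s i) x) + 4 * rs i ^+ Ns i * nrm2 x).
Proof.
move=> lx; elim: n => [|n IH]; first by rewrite /defect /damping_prod !big_ord0 pe1 subrr.
rewrite big_ord_recr /=; apply: le_trans (lerD IH (lexx _)).
rewrite /defect /damping_prod big_ord_recr /= -/(damping_prod n) mulrC pe_mul.
set u := pe alpha (damping_prod n) x.
have lu : l2 u by exact: (l2_pe alpha_in_D).
have h := damping_defect alpha_in_D (Ns n) (sq_cval (zs n)) (r0 n) lu.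
have h1 : nrm2 u <= nrm2 x by exact: damping_prod_contraction.
have h2 : nrm2 (pe alpha (s n) u) <= nrm2 (pe alpha (s n) x).
  rewrite /u -pe_mul mulrC pe_mul; apply: damping_prod_contraction.
  exact: (l2_pe alpha_in_D).
have h3 := ler_wpM2l (sqr_ge0 (1 - rs n)) h2.
have h4 : 4 * rs n ^+ Ns n * nrm2 u <= 4 * rs n ^+ Ns n * nrm2 x.
  by rewrite ler_wpM2l// mulr_ge0// exprn_ge0// ltW.
by move: h h3 h4; rewrite -/(s n) -/(Q n); lra.
Qed.

Lemma damping_prod_symbol n (x : circle R) :
  sq (damping_prod n).[cval x] <= 1 /\
  (forall i, (i < n)%N -> rs i ^+ Ns i <= 1 / 8 ->
     sq (cval x - cval (zs i)) <= (1 - rs i) ^+ 2 -> sq (damping_prod n).[cval x] <= 7 / 8).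
Proof.
have q1 i : sq (Q i).[cval x] <= 1 by exact: damping_symbol_le1.
elim: n => [|n [IH1 IH2]].
  by rewrite /damping_prod big_ord0 hornerC; split=> //; rewrite -sq_normc ComplexField.Normc.normc1 expr1n.
rewrite /damping_prod big_ord_recr /= hornerM sqM -/(damping_prod n).
have a0 := sq_ge0 (damping_prod n).[cval x]; have b0 := sq_ge0 (Q n).[cval x].
split; first by rewrite mulr_ile1.
move=> i; rewrite ltnS leq_eqVlt => /orP[/eqP ->|lt_in] t8 xi.
  apply: le_trans (_ : sq (Q n).[cval x] <= _); first by rewrite ler_piMl.
  exact: damping_symbol_ball.
apply: le_trans (_ : sq (damping_prod n).[cval x] <= _); first by rewrite ler_piMr.
exact: IH2 lt_in t8 xi.
Qed.

End product.

(** The price of a family of balls in terms of [delta 0] and [delta 1] only; the defects of all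
    other vectors are measured against it. *)
Definition cover_cost (zs : nat -> circle R) (rs : nat -> R) (Ns : nat -> nat) n : R :=
  \sum_(i < n) ((1 - rs i) ^+ 2 *
    (nrm2 (pe alpha (geom_poly ((rs i)%:C * cval (zs i)) (Ns i)) (@delta R 0)) +
     nrm2 (pe alpha (geom_poly ((rs i)%:C * cval (zs i)) (Ns i)) (@delta R 1))) +
   4 * rs i ^+ Ns i).

Lemma damping_prod_defect_delta k : exists2 M, 0 <= M &
  forall zs rs Ns, (forall i, 0 < rs i) -> (forall i, rs i < 1) ->
  forall n, defect (damping_prod zs rs Ns n) (@delta R k) <= M * cover_cost zs rs Ns n.
Proof.
have [_ [M hM]] := delta_dominated_delta alpha_in_D k.
(* The truncation term 4 r^N does not pass through the domination by [delta 0] and [delta 1], so its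
   coefficient must be at least 1. *)
pose M' := Num.max 1 M.
have M1 : 1 <= M' by rewrite le_max lexx.
exists M'; first exact: le_trans M1.
move=> zs rs Ns r0 r1 n; rewrite /cover_cost mulr_sumr.
apply: le_trans (damping_prod_defect zs Ns r0 n (l2_delta R k)) _.
apply: ler_sum => i _; rewrite nrm2_delta mulr1 mulrDr; apply: lerD.
  rewrite mulrCA ler_wpM2l ?sqr_ge0//; apply: (le_trans (hM _)).
  by rewrite ler_wpM2r ?addr_ge0 ?nrm2_ge0// le_max lexx orbT.
by rewrite ler_peMl// mulr_ge0// exprn_ge0// ltW.
Qed.

Lemma damping_prod_defect_le phi (eta : R) : l2 phi -> 0 < eta ->
  exists2 K, 0 <= K & forall zs rs Ns, (forall i, 0 < rs i) -> (forall i, rs i < 1) ->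
  forall n, defect (damping_prod zs rs Ns n) phi <= eta + K * cover_cost zs rs Ns n.
Proof.
move=> lphi eta0; have [s us [K K0 hK]] := defect_finite_approx lphi eta0.
have [M M0 hM] : exists2 M, 0 <= M &
    forall zs rs Ns, (forall i, 0 < rs i) -> (forall i, rs i < 1) ->
    forall n, \sum_(k <- s) defect (damping_prod zs rs Ns n) (@delta R k) <= M * cover_cost zs rs Ns n.
  elim: (s) => [|k t [M M0 hM]].
    by exists 0 => // zs rs Ns _ _ n; rewrite big_nil mul0r.
  have [M' M0' hM'] := damping_prod_defect_delta k.
  exists (M' + M); first exact: addr_ge0.
  by move=> zs rs Ns r0 r1 n; rewrite big_cons mulrDl lerD ?hM ?hM'.
exists (K * M); first exact: mulr_ge0.
move=> zs rs Ns r0 r1 n.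
apply: le_trans (hK _ (@damping_prod_contraction zs rs Ns r0 n)) _.
by rewrite lerD2l -mulrA ler_wpM2l// hM.
Qed.

End damping_products.

(** * The measure of a finite union of balls *)

Section covering.
Variable R : realType.
Local Notation C := R[i].
Local Notation Re := complex.Re.
Variable alpha : int -> C.
Hypothesis alpha_in_D : forall n : int, normc (alpha n) < 1.

Definition chord_ball (z : circle R) (e : R) : set (circle R) :=
  [set x | sq (cval x - cval z) <= e ^+ 2].

Lemma chord_ball_measurable z e : measurable (chord_ball z e).
Proof.
have [m _] : bmeas (fun x : circle R => sq (cval x - cval z)).
  by apply: cbmeas_sq; apply: cbmeasD; [exact: cbmeas_cval|exact: cbmeas_cst].
have := m measurableT _ (measurable_itv `]-oo, e ^+ 2]); rewrite setTI.
by congr (measurable _); apply/seteqP; split => x /=; rewrite in_itv.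
Qed.

(** The resolvent identity gives eps |psi|^2 <= 1 + 2 C4 eps^(beta - 1). A further factor eps
    produces eps^beta, and beta <= 1 absorbs the constant term. *)
Lemma geom_delta_bound (z : circle R) (eps C4 beta : R) N k :
  0 < eps -> eps < 1 / 10 -> beta <= 1 -> 0 <= C4 ->
  normc (green alpha k k ((1 - eps)%:C * cval z)) <= C4 * eps `^ (beta - 1) ->
  eps ^+ 2 * nrm2 (pe alpha (geom_poly ((1 - eps)%:C * cval z) N) (@delta R k)) <=
    4 * (1 + 2 * C4) * eps `^ beta.
Proof.
move=> e0 e1 b1 C40 hG; set w := (1 - eps)%:C * cval z.
have r0 : 0 < 1 - eps by lra.
have r1 : 1 - eps < 1 by lra.
have nw : normc w = 1 - eps by rewrite normc_rad ?sq_cval// ltW.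
have w1 : normc w < 1 by rewrite nw.
have w1' : normc w != 1 by rewrite lt_eqF.
have [lpsi e] := resolventP alpha_in_D (l2_delta R k) w1'.
have h1 := nrm2_geom_le alpha_in_D N (sq_cval z) r0 r1 erefl lpsi e.
have := nrm2_resolvent_delta alpha_in_D k w1.
rewrite -sq_normc nw; set n := nrm2 _ => h2.
have n0 : 0 <= n by exact: nrm2_ge0.
have h3 : Re (w * green alpha k k w) <= C4 * eps `^ (beta - 1).
  apply: le_trans (Re_le_normc _) _; rewrite ComplexField.Normc.normcM nw.
  by apply: le_trans hG; rewrite ler_piMl ?normc_ge0// ltW.
have h4 : eps * n <= 1 + 2 * (C4 * eps `^ (beta - 1)).
  apply: le_trans (_ : (1 - (1 - eps) ^+ 2) * n <= _); last by rewrite h2; lra.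
  by rewrite ler_wpM2r//; nra.
have eb : eps * eps `^ (beta - 1) = eps `^ beta.
  rewrite -{1}(powRr1 (ltW e0)) -powRD; first by rewrite addrC subrK.
  by rewrite (gt_eqF e0) implybT.
have ee : eps <= eps `^ beta.
  by rewrite -[leLHS](powRr1 (ltW e0)) ger_powR// ?e0//=; lra.
apply: le_trans (ler_wpM2l (sqr_ge0 eps) h1) _.
have h5 := ler_wpM2l (ltW e0) h4.
rewrite mulrDr mulr1 in h5.
have e5 : eps * (2 * (C4 * eps `^ (beta - 1))) = 2 * C4 * eps `^ beta by rewrite -eb; ring.
rewrite e5 in h5; rewrite -/n.
have -> : eps ^+ 2 * (4 * n) = 4 * (eps * (eps * n)) by ring.
by rewrite -mulrA ler_wpM2l// mulrDl mul1r; apply: (le_trans h5); rewrite lerD2r.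
Qed.

Lemma cover_cost_le (zs : nat -> circle R) (eps : nat -> R) (Ns : nat -> nat) (C4 beta : R) n :
  (forall i, 0 < eps i) -> (forall i, eps i < 1 / 10) -> beta <= 1 -> 0 <= C4 ->
  (forall i, (1 - eps i) ^+ Ns i <= eps i `^ beta / 4) ->
  (forall i, normc (green alpha 0 0 ((1 - eps i)%:C * cval (zs i))) <= C4 * eps i `^ (beta - 1) /\
     normc (green alpha 1 1 ((1 - eps i)%:C * cval (zs i))) <= C4 * eps i `^ (beta - 1)) ->
  cover_cost alpha zs (fun i => 1 - eps i) Ns n <=
    (8 * (1 + 2 * C4) + 1) * \sum_(i < n) eps i `^ beta.
Proof.
move=> e0 e1 b1 C40 hN hG; rewrite mulr_sumr; apply: ler_sum => i _.
have [G0 G1] := hG i.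
have h0 := geom_delta_bound (Ns i) (e0 i) (e1 i) b1 C40 G0.
have h1 := geom_delta_bound (Ns i) (e0 i) (e1 i) b1 C40 G1.
rewrite (_ : 1 - (1 - eps i) = eps i); last by ring.
have := hN i; move: h0 h1; rewrite !mulrDr; lra.
Qed.

Lemma exp_lt_exists (r e : R) : 0 < r -> r < 1 -> 0 < e -> exists N, r ^+ N <= e.
Proof.
move=> r0 r1 e0.
have : (fun n => r ^+ n) @ \oo --> (0 : R) by apply: cvg_expr; rewrite ger0_norm// ltW.
move/cvgrPdist_le => /(_ _ e0) [N _ /(_ N (leqnn N))].
rewrite sub0r normrN ger0_norm; last by rewrite exprn_ge0 // ltW.
by move=> h; exists N.
Qed.

Variables (mu : {finite_measure set (circle R) -> \bar R}) (phi : int -> C).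
Hypothesis lphi : l2 phi.
Hypothesis spec : is_spectral_measure alpha phi mu.

Lemma measure_le_defect (zs : nat -> circle R) (rs : nat -> R) (Ns : nat -> nat) n U :
  (forall i, 0 < rs i) -> (forall i, rs i < 1) -> (forall i, rs i ^+ Ns i <= 1 / 8) ->
  measurable U -> (forall x, U x -> exists2 i, (i < n)%N & chord_ball (zs i) (1 - rs i) x) ->
  fine (mu U) <= 8 * defect alpha (damping_prod zs rs Ns n) phi.
Proof.
move=> r0 r1 hN mU hU; set W := damping_prod zs rs Ns n.
have bW : bmeas (fun x : circle R => sq W.[cval x]) by apply: cbmeas_sq; exact: cbmeas_horner.
have b1 : bmeas (fun x : circle R => 1 + - sq W.[cval x]).
  by apply: bmeasD; [exact: bmeas_cst|exact: bmeasN].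
have n1 : nrm2 phi = fine (mu setT).
  have := rip_pe alpha_in_D lphi spec 1 1; rewrite !pe1 -nrm2E => ->.
  rewrite -[RHS]mul1r -integ_cst; apply: eq_Rintegral => x _.
  by rewrite !hornerC rmorph1 mulr1.
have nW : nrm2 (pe alpha W phi) = \int[mu]_x sq W.[cval x].
  rewrite nrm2E (rip_pe alpha_in_D lphi spec); apply: eq_Rintegral => x _.
  by rewrite mulrC mulc_conj.
have dE : defect alpha W phi = \int[mu]_x (1 + - sq W.[cval x]).
  rewrite /defect n1 nW integD//; [|exact: bmeas_cst|exact: bmeasN].
  rewrite integ_cst mul1r; congr (_ + _).
  rewrite -mulN1r -integZ//; apply: eq_Rintegral => x _; by rewrite mulN1r.
rewrite dE mulrC -ler_pdivrMr// mulrC.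
apply: measure_le_integ => //; first by move=> x; rewrite subr_ge0; have [] := damping_prod_symbol zs Ns r0 r1 n x.
move=> x /hU [i lt_in hx].
have [_ /(_ i lt_in (hN i) hx)] := damping_prod_symbol zs Ns r0 r1 n x.
by rewrite -/W; lra.
Qed.

(** [K] is fixed by [phi] and [kappa] before the cover and [C4], so a cover can still be chosen fine
    enough for [K]. The truncation orders [Ns] come last and make (1 - eps)^N at most both 1/8 and
    eps^beta / 4. *)
Lemma measure_cover_le (kappa : R) : 0 < kappa -> exists2 K, 0 <= K &
  forall (zs : nat -> circle R) (eps : nat -> R) (C4 beta : R),
  (forall i, 0 < eps i) -> (forall i, eps i < 1 / 10) -> beta <= 1 -> 0 <= C4 ->
  (forall i, normc (green alpha 0 0 ((1 - eps i)%:C * cval (zs i))) <= C4 * eps i `^ (beta - 1) /\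
     normc (green alpha 1 1 ((1 - eps i)%:C * cval (zs i))) <= C4 * eps i `^ (beta - 1)) ->
  forall n, (mu (\big[setU/set0]_(i < n) chord_ball (zs i) (eps i)) <=
    (kappa + K * (8 * (1 + 2 * C4) + 1) * \sum_(i < n) eps i `^ beta)%:E)%E.
Proof.
move=> k0; have k8 : 0 < kappa / 8 by rewrite divr_gt0.
have [K K0 hK] := damping_prod_defect_le alpha_in_D lphi k8.
exists (8 * K); first by rewrite mulr_ge0.
move=> zs eps C4 beta e0 e1 b1 C40 hG n.
have r0 i : 0 < 1 - eps i by have := e1 i; lra.
have r1 i : 1 - eps i < 1 by have := e0 i; lra.
have exN i : exists N, (1 - eps i) ^+ N <= Num.min (1 / 8) (eps i `^ beta / 4).
  by apply: exp_lt_exists => //; rewrite lt_min !divr_gt0// powR_gt0.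
have [Ns hN] := choice exN.
have hN1 i : (1 - eps i) ^+ Ns i <= 1 / 8 by apply: (le_trans (hN i)); rewrite ge_min lexx.
have hN2 i : (1 - eps i) ^+ Ns i <= eps i `^ beta / 4.
  by apply: (le_trans (hN i)); rewrite ge_min lexx orbT.
set U := \big[setU/set0]_(i < n) _.
have mU : measurable U by apply: bigsetU_measurable => i _; exact: chord_ball_measurable.
rewrite -(@fineK _ (mu U)) ?fin_num_measure// lee_fin.
apply: le_trans (@measure_le_defect zs (fun i => 1 - eps i) Ns n U r0 r1 hN1 mU _) _.
  move=> x; rewrite /U -(bigcup_mkord n (fun i => chord_ball (zs i) (eps i))) => -[i /= lt_in hx]; exists i => //.
  by rewrite (_ : 1 - (1 - eps i) = eps i)//; ring.
have h1 := hK zs _ Ns r0 r1 n.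
have h2 := cover_cost_le n e0 e1 b1 C40 hN2 hG.
apply: le_trans (ler_wpM2l _ h1) _ => //.
have := ler_wpM2l K0 h2; set c := cover_cost _ _ _ _ _; set S := \sum_(i < n) _; lra.
Qed.

End covering.

(** * Covers of sets of zero Hausdorff measure *)

Section hausdorff_null.
Variable R : realType.

Lemma sum_half_powers (n : nat) : \sum_(i < n) (2^-1 : R) ^+ i.+1 <= 1.
Proof.
suff -> : \sum_(i < n) (2^-1 : R) ^+ i.+1 = 1 - 2^-1 ^+ n.
  by rewrite gerBl exprn_ge0.
elim: n => [|n IH]; first by rewrite big_ord0 expr0 subrr.
by rewrite big_ord_recr /= IH exprS; lra.
Qed.

(** Each member U_i of a cheap cover becomes a ball whose radius is at least the diameter and whose
    centre lies in B, where Green bounds will be available. Adding T/2 * 2^(-i-1) to diam^beta keeps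
    the radii positive for one-point sets and the total at most T. A member that misses B receives
    the filler centre [b]. *)
Lemma hausdorff_null_cover (A B : set (circle R)) (beta T : R) :
  0 < beta -> 0 < T -> hausdorff_measure (@chord_dist R) beta A = 0%E ->
  B `<=` A -> B !=set0 ->
  exists zs : nat -> circle R, exists eps : nat -> R,
  [/\ forall i, B (zs i), forall i, 0 < eps i,
      B `<=` \bigcup_i chord_ball (zs i) (eps i) &
      forall n, \sum_(i < n) eps i `^ beta <= T].
Proof.
move=> b0 T0 hA BA [b Bb].
have T2 : 0 < T / 2 by rewrite divr_gt0.
have : (hausdorff_premeasure (@chord_dist R) beta 1 A < (T / 2)%:E)%E.
  apply: le_lt_trans (_ : (_ <= 0)%E) _; last by rewrite lte_fin.
  by rewrite -hA; apply: ereal_sup_ubound; exists 1 => //=; rewrite ltr01.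
move=> /ereal_inf_lt[_ [U [AU dU ->]] lt_T].
pose D i := fine (diameter (@chord_dist R) (U i)).
have dist_le i x y : U i x -> U i y -> ((chord_dist x y)%:E <= diameter (@chord_dist R) (U i))%E.
  by move=> Ux Uy; apply: ereal_sup_ubound; exists x, y.
have fD i : U i !=set0 -> diameter (@chord_dist R) (U i) = (D i)%:E.
  move=> [x Ux]; rewrite fineK// fin_real//.
  rewrite (lt_le_trans _ (dist_le _ _ _ Ux Ux)) ?ltNyr//=.
  by rewrite (le_lt_trans (dU i)) ?ltry.
have D0 i : U i !=set0 -> 0 <= D i.
  move=> U0; rewrite -lee_fin -fD//; have [x Ux] := U0.
  by apply: le_trans (dist_le _ _ _ Ux Ux); rewrite lee_fin normc_ge0.
pose d i := if `[< U i !=set0 >] then D i `^ beta else 0.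
have d0 i : 0 <= d i by rewrite /d; case: asboolP => // _; exact: powR_ge0.
have sum_d n : \sum_(i < n) d i <= T / 2.
  rewrite -lee_fin -sumEFin; apply: le_trans (ltW lt_T).
  rewrite esum_mkcond (_ : (\esum_(i in _) _)%E = (\esum_(i in setT) (d i)%:E)%E); last first.
    apply: eq_esum => i _; rewrite /d; case: asboolP => h.
      by rewrite mem_set// fD// poweR_EFin.
    by rewrite memNset.
  rewrite -nneseries_esumT; last by move=> i; rewrite lee_fin.
  rewrite -(big_mkord xpredT (fun i => (d i)%:E)).
  by apply: nneseries_lim_ge => i _; rewrite lee_fin.
pose g i := d i + T / 2 * 2^-1 ^+ i.+1.
have g0 i : 0 < g i by rewrite ltr_wpDl// mulr_gt0// exprn_gt0// invr_gt0.
have gb i : (g i `^ beta^-1) `^ beta = g i.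
  by rewrite -powRrM mulVf ?gt_eqF// powRr1// ltW.
have pick i : exists z, B z /\ (forall x, B x -> U i x -> U i z).
  have [[x [Bx Ux]]|h] := pselect (exists x, B x /\ U i x); first by exists x.
  by exists b; split=> // x Bx Ux; exfalso; apply: h; exists x.
have [zs hzs] := choice pick.
exists zs, (fun i => g i `^ beta^-1); split.
- by move=> i; have [] := hzs i.
- by move=> i; rewrite powR_gt0.
- move=> x Bx; have [i _ Ux] := AU _ (BA _ Bx); exists i => //=.
  have Uz := (hzs i).2 _ Bx Ux; have U0 : U i !=set0 by exists x.
  rewrite /chord_ball /= -sq_normc lerXn2r ?nnegrE ?normc_ge0 ?powR_ge0//.
  apply: le_trans (_ : D i <= _).
    by rewrite -lee_fin -fD//; exact: dist_le.
  have Dd : D i = d i `^ beta^-1.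
    by rewrite /d; case: asboolP => // _; rewrite -powRrM divff ?gt_eqF// powRr1// D0.
  rewrite Dd ge0_ler_powR// ?nnegrE ?invr_ge0 ?(ltW b0)// ?(ltW (g0 i))//.
  by rewrite lerDl mulr_ge0 ?exprn_ge0 ?ltW// invr_ge0.
- move=> n; under eq_bigr do rewrite gb.
  rewrite big_split /= -mulr_sumr.
  have := sum_d n; have := ler_wpM2l (ltW T2) (sum_half_powers n); lra.
Qed.

End hausdorff_null.

(** * Negligibility on a set with uniform bounds *)

Section null_sets.
Variable R : realType.
Local Notation C := R[i].
Variable alpha : int -> C.
Hypothesis alpha_in_D : forall n : int, normc (alpha n) < 1.
Variables (mu : {finite_measure set (circle R) -> \bar R}) (phi : int -> C).
Hypothesis lphi : l2 phi.
Hypothesis spec : is_spectral_measure alpha phi mu.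

(** [B] is enclosed in countable unions of balls of measure at most kappa; the intersection of these
    over kappa = 1 / (j + 1) is a Borel null set containing [B]. *)
Lemma hausdorff_null_negligible (A B : set (circle R)) (C4 beta : R) :
  0 < beta -> beta <= 1 -> 0 <= C4 ->
  (forall z r, B z -> 9 / 10 < r -> r < 1 ->
     normc (green alpha 0 0 (r%:C * cval z)) <= C4 * (1 - r) `^ (beta - 1) /\
     normc (green alpha 1 1 (r%:C * cval z)) <= C4 * (1 - r) `^ (beta - 1)) ->
  hausdorff_measure (@chord_dist R) beta A = 0%E -> B `<=` A ->
  mu.-negligible B.
Proof.
move=> b0 b1 C40 hG hA BA.
have [->|/set0P B0] := eqVneq B set0; first exact: negligible_set0.
have small (kappa : R) : 0 < kappa -> exists G, [/\ measurable G, B `<=` G & (mu G <= kappa%:E)%E].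
  move=> k0; have k2 : 0 < kappa / 2 by rewrite divr_gt0.
  have [K K0 hK] := measure_cover_le alpha_in_D lphi spec k2.
  set M := K * (8 * (1 + 2 * C4) + 1) in hK.
  have M0 : 0 <= M by rewrite mulr_ge0// addr_ge0// mulr_ge0// addr_ge0// mulr_ge0.
  (* The first bound forces every radius below 1/10, which is the range r > 9/10 of the Green
     bounds; the second keeps the cost within kappa / 2. *)
  pose T := Num.min ((20^-1 : R) `^ beta) (kappa / 2 / (M + 1)).
  have T0 : 0 < T by rewrite lt_min powR_gt0 ?invr_gt0//= divr_gt0// ltr_wpDl.
  have MT : M * T <= kappa / 2.
    apply: le_trans (_ : (M + 1) * T <= _); first by rewrite ler_wpM2r ?(ltW T0)// lerDl.
    by rewrite mulrC -ler_pdivlMr ?ltr_wpDl// ge_min lexx orbT.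
  have [zs [eps [Bz e0 Bcov sumT]]] := hausdorff_null_cover b0 T0 hA BA B0.
  have e1 i : eps i < 1 / 10.
    have : eps i `^ beta <= (20^-1 : R) `^ beta.
      apply: le_trans (_ : T <= _); last by rewrite ge_min lexx.
      apply: le_trans (sumT i.+1); rewrite big_ord_recr /= lerDr.
      by apply: sumr_ge0 => j _; exact: powR_ge0.
    have [h _|h] := ltP (eps i) (1 / 10) => //.
    have : (20^-1 : R) `^ beta < eps i `^ beta.
      rewrite gt0_ltr_powR// ?nnegrE ?invr_ge0// ?(ltW (e0 i))//.
      by apply: lt_le_trans h; lra.
    by rewrite ltNge => /negP.
  exists (\bigcup_i chord_ball (zs i) (eps i)); split=> //.
    by apply: bigcup_measurable => i _; exact: chord_ball_measurable.
  pose F n := \big[setU/set0]_(i < n) chord_ball (zs i) (eps i).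
  have mF n : measurable (F n).
    by apply: bigsetU_measurable => i _; exact: chord_ball_measurable.
  have FE : \bigcup_n F n = \bigcup_i chord_ball (zs i) (eps i).
    apply/seteqP; split => x [i _].
      by rewrite /F -(bigcup_mkord i (fun i => chord_ball (zs i) (eps i))) => -[j _ h]; exists j.
    by move=> h; exists i.+1 => //; rewrite /F big_ord_recr; right.
  rewrite -FE.
  have cvF : (mu \o F) n @[n --> \oo] --> mu (\bigcup_n F n).
    apply: nondecreasing_cvg_mu => //; first by apply: bigcup_measurable => i _.
    by move=> n m nm; apply/subsetPset; exact: (@subset_bigsetU _ (fun i => chord_ball (zs i) (eps i))).
  rewrite -(cvg_lim _ cvF)//; apply: lime_le; first by apply/cvg_ex; eexists; exact: cvF.
  near=> n => /=; apply: le_trans (hK zs eps C4 beta e0 e1 b1 C40 _ n) _.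
    move=> i; have r1 : 9 / 10 < 1 - eps i by have := e1 i; lra.
    have r2 : 1 - eps i < 1 by have := e0 i; lra.
    by have := hG _ _ (Bz i) r1 r2; rewrite subKr.
  rewrite lee_fin -/M; have h := ler_wpM2l M0 (sumT n).
  by rewrite [leRHS](splitr kappa) lerD2l (le_trans h).
have pos (j : nat) : 0 < (j.+1%:R : R)^-1 by rewrite invr_gt0.
have [G hG'] := choice (fun j => small _ (pos j)).
exists (\bigcap_j G j); split.
- by apply: bigcapT_measurable => j; have [] := hG' j.
- apply/eqP; rewrite -measure_le0; apply/lee_addgt0Pr => e e_gt0; rewrite add0e.
  have [j _ /(_ j (leqnn j)) hj] : \forall j \near \oo, (j.+1%:R : R)^-1 < e.
    exact: near_infty_natSinv_lt (PosNum e_gt0).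
  have [mG _ le_G] := hG' j.
  apply: le_trans (_ : (mu (G j) <= _)%E).
    apply: le_measure; rewrite ?inE//; first by apply: bigcapT_measurable => k; have [] := hG' k.
    exact: bigcap_inf.
  by apply: (le_trans le_G); rewrite lee_fin ltW.
- by move=> x Bx j _; have [_ + _] := hG' j; apply.
Unshelve. all: by end_near. Qed.

End null_sets.

(** * Conclusion, with constants depending on the point *)

Lemma power_law_bounds_weaken (R : realType) (alpha : int -> R[i]) (z : R[i])
    (C1 C2 g1 g2 L0 C1' C2' L0' : R) :
  C1' <= C1 -> C2 <= C2' -> L0 <= L0' ->
  power_law_bounds alpha z C1 C2 g1 g2 L0 -> power_law_bounds alpha z C1' C2' g1 g2 L0'.
Proof.
move=> h1 h2 h0 h eta sol nrm L hL.
have [lo hi] := h eta sol nrm L (le_trans h0 hL).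
split; first by apply: le_trans lo; rewrite ler_wpM2r ?powR_ge0.
by apply: (le_trans hi); rewrite ler_wpM2r ?powR_ge0.
Qed.

Theorem theorem1 (R : realType) (alpha : int -> R[i])
    (alpha_in_D : forall n : int, normc (alpha n) < 1) :
  (* (1) *)
  (forall (Sigma : set (circle R)) (C1 C2 g1 g2 L0 : R),
    0 < C1 -> 0 < C2 -> 0 < g1 -> 0 < g2 -> 0 < L0 ->
    (forall z : circle R, Sigma z ->
       power_law_bounds alpha (cval z) C1 C2 g1 g2 L0) ->
    let beta := 2 * g1 / (g1 + g2) in
    (exists C4 : R, forall (z : circle R) (r : R),
       Sigma z -> 9 / 10 < r -> r < 1 ->
       normc (green alpha 0 0 (r%:C * cval z) + green alpha 1 1 (r%:C * cval z))
         <= C4 * (1 - r) `^ (beta - 1)) /\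
    (forall mu0 mu1 : {finite_measure set (circle R) -> \bar R},
       is_spectral_measure alpha (delta R 0) mu0 ->
       is_spectral_measure alpha (delta R 1) mu1 ->
       forall z : circle R, Sigma z ->
         holder_continuous_at beta (measure_add mu0 mu1) z)) /\
  (* (2) *)
  (forall (S : set (circle R)) (mS : measurable S) (g1 g2 : R),
    0 < g1 -> 0 < g2 ->
    (forall z : circle R, S z ->
       exists C1 C2 L0 : R, [/\ 0 < C1, 0 < C2, 0 < L0 &
         power_law_bounds alpha (cval z) C1 C2 g1 g2 L0]) ->
    forall (phi : int -> R[i])
           (mu : {finite_measure set (circle R) -> \bar R}),
      l2 phi -> is_spectral_measure alpha phi mu ->
      purely_continuous (2 * g1 / (g1 + g2)) (mrestr mu mS)).
Proof.
have beta_le1 z C1 C2 g1 g2 L0 : 0 < C1 -> 0 < g1 -> 0 < g2 ->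
    power_law_bounds alpha z C1 C2 g1 g2 L0 -> 2 * g1 / (g1 + g2) <= 1.
  move=> C10 g10 g20 h; have := exponents_le alpha_in_D C10 h.
  by rewrite ler_pdivrMr ?addr_gt0//; lra.
split.
  move=> Sigma C1 C2 g1 g2 L0 C10 C20 g10 g20 L00 bnd beta.
  have [C4 [C40 hG]] := green_power_bound alpha_in_D C10 C20 g10 g20 L00.
  split.
    exists (C4 + C4) => z r Sz r9 r1; apply: le_trans (normc_add _ _) _.
    have [G0 G1] := hG _ _ (sq_cval z) (bnd z Sz) r9 r1.
    by rewrite mulrDl lerD.
  move=> mu0 mu1 s0 s1 z Sz; apply: (holder_of_green_bound _ (ltW C40) s0 s1).
    exact: beta_le1 C10 g10 g20 (bnd z Sz).
  by move=> r; apply: hG (sq_cval z) (bnd z Sz).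
move=> S mS g1 g2 g10 g20 bnd phi mu lphi spec A mA hA.
have b0 : 0 < 2 * g1 / (g1 + g2) by rewrite divr_gt0 ?mulr_gt0 ?addr_gt0.
(* One integer governs all three constants and a larger one weakens every bound, so countably many
   pieces exhaust the set. *)
pose B m := [set z | (A `&` S) z /\
  power_law_bounds alpha (cval z) m.+1%:R^-1 m.+1%:R g1 g2 m.+1%:R].
have nB m : mu.-negligible (B m).
  have m0 : 0 < m.+1%:R :> R by [].
  have m1 : 0 < m.+1%:R^-1 :> R by rewrite invr_gt0.
  (* A point of the piece supplies the power laws from which beta <= 1 is deduced. *)
  have [->|/set0P [z0 [_ hz0]]] := eqVneq (B m) set0; first exact: negligible_set0.
  have [C4 [C40 hG]] := green_power_bound alpha_in_D m1 m0 g10 g20 m0.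
  apply: (hausdorff_null_negligible alpha_in_D lphi spec b0 _ (ltW C40) _ hA).
  - exact: beta_le1 m1 g10 g20 hz0.
  - by move=> z r [_ hz]; apply: hG (sq_cval z) hz.
  - by move=> z [[]].
rewrite /mrestr; apply: measure_negligible; first exact: measurableI.
apply: (negligibleS _ (negligible_bigcup nB)) => z ASz.
have [C1 [C2 [L0 [C10 C20 L00 h]]]] := bnd z ASz.2.
pose x := Num.max C1^-1 (Num.max C2 L0).
have x0 : 0 <= x by rewrite le_max invr_ge0 ltW.
have x_lt : x <= (Num.truncn x).+1%:R by rewrite ltW// truncnS_gt.
have [xC1 xC2 xL0] : [/\ C1^-1 <= x, C2 <= x & L0 <= x] by rewrite !le_max !lexx !orbT.
exists (Num.truncn x) => //; split=> //.
apply: power_law_bounds_weaken h; [|exact: le_trans x_lt|exact: le_trans x_lt].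
by rewrite -[leRHS]invrK lef_pV2 ?posrE ?invr_gt0// (le_trans xC1).
Qed.
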